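(* Let $\alpha\in(0,2)$, $b\in\mathbb R^d$, $\lambda>0$, let $\sigma$ be a finite Borel measure on $\mathbb S^{d-1}$ and let $q:\mathbb S^{d-1}\times(0,\infty)\to[0,\infty)$ be a Borel function with $0\le q\le1$ and $u\mapsto q(\xi,u)$ nonincreasing for each $\xi$. Let $\{Y_t:t\ge0\}$ be a TSOU-process with parameter $\lambda$ and limiting distribution $\mathrm{TS}_{\alpha,d}(\sigma,q,b)$. Fix $t>0$ and let $$K=\int_{\mathbb S^{d-1}}\int_0^\infty\left(q(\xi,u)-q(\xi,ue^{\lambda t})\right)u^{-1-\alpha}\,\mathrm du\,\sigma(\mathrm d\xi).$$ Let $s\ge 0$ and $y\in\mathbb R^d$. If $K=0$, then, given $Y_s=y$, $$Y_{s+t}\stackrel{d}{=}e^{-\lambda t}y+d_\alpha+X_0,$$ and if $0<K<\infty$, then, given $Y_s=y$, $$Y_{s+t}\stackrel{d}{=}e^{-\lambda t}y+d_\alpha+X_0+\sum_{j=1}^NX_j-\psi.$$ Here $$\psi=e^{-\alpha\lambda t}\int_{\mathbb S^{d-1}}\int_0^\infty h_\alpha(u\xi)\left(q(\xi,u)-q(\xi,ue^{\lambda t})\right)u^{-\alpha}\,\mathrm du\,\xi\,\sigma(\mathrm d\xi)$$ and $N,X_0,X_1,X_2,\dots$ are independent random variables such that: 1. $X_0\sim\mathrm{TS}_{\alpha,d}(\sigma_0,q,0)$, where $\sigma_0(\mathrm d\xi)=(1-e^{-\alpha\lambda t})\sigma(\mathrm d\xi)$; 2. $X_1,X_2,\dots$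 are iid with $X_i\stackrel{d}{=}\xi W$, where $\xi\in\mathbb S^{d-1}$, $W>0$, and the joint distribution of $(\xi,W)$ is $$H(\mathrm d\xi,\mathrm du)=\frac1K\left(q(\xi,u)-q(\xi,ue^{\lambda t})\right)u^{-1-\alpha}\,\mathrm du\,\sigma(\mathrm d\xi),\quad u>0,\ \xi\in\mathbb S^{d-1};$$ 3. $N$ has a Poisson distribution with mean $Ke^{-\alpha\lambda t}$.
   Context: $\mathbb S^{d-1}$ is the unit sphere of $\mathbb R^d$. $\mathrm{ID}_d(A,M,b)_h$ denotes the infinitely divisible distribution on $\mathbb R^d$ with characteristic function $\exp\{-\frac12\langle z,Az\rangle+i\langle b,z\rangle+\int_{\mathbb R^d}(e^{i\langle z,x\rangle}-1-i\langle z,x\rangle h(x))M(\mathrm dx)\}$. Set $h_\alpha(x)=0$ if $\alpha\in(0,1)$, $h_1(x)=1_{[|x|\le1]}$, $h_\alpha(x)=1$ if $\alpha\in(1,2)$. The tempered stable distribution is $\mathrm{TS}_{\alpha,d}(\sigma,q,b)=\mathrm{ID}_d(0,L_\alpha,b)_{h_\alpha}$, where $L_\alpha(B)=\int_{\mathbb S^{d-1}}\int_0^\infty1_B(u\xi)u^{-1-\alpha}q(\xi,u)\,\mathrm du\,\sigma(\mathrm d\xi)$. An OU-process with parameter $\lambda>0$ and background driving Lévy process (BDLP) $Z$ is $Y_t=e^{-\lambda t}Y_0+\int_0^te^{-\lambda(t-s)}\,\mathrm dZ_s$, the strong solution of $\mathrm dY_t=-\lambda Y_t\,\mathrm dt+\mathrm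 dZ_t$, with $Z$ a Lévy process on $\mathbb R^d$ and $Y_0$ independent of $Z$; it is a Markov process. The TSOU-process with parameter $\lambda$ and limiting distribution $\mathrm{TS}_{\alpha,d}(\sigma,q,b)$ is the OU-process having this limiting distribution, i.e. the one whose BDLP satisfies $Z_1\sim\mathrm{ID}_d(0,\lambda M,\lambda c_\alpha)_{h_\alpha}$, where $M(B)=\int_{\mathbb S^{d-1}}\int_0^\infty1_B(u\xi)\,\mathrm d\rho_\xi(u)\,\sigma(\mathrm d\xi)$ with $\rho_\xi(u)=-u^{-\alpha}q(\xi,u)$ (Stieltjes integral with respect to a nondecreasing function), $c_\alpha=b$ if $\alpha\ne1$ and $c_1=b-\int_{|x|>1}\frac{x}{|x|}M(\mathrm dx)$. The vector $d_\alpha$ (depending on $t$) is $d_\alpha=(1-e^{-\lambda t})b$ if $\alpha\neq1$, and $d_1=(1-e^{-\lambda t})b+\int_{1<|x|\le e^{\lambda t}}x(|x|^{-1}-e^{-\lambda t})M(\mathrm dx)-(1-e^{-\lambda t})\int_{|x|>1}\frac{x}{|x|}M(\mathrm dx)$. ''Given $Y_s=y$, $Y_{s+t}\stackrel d=X$'' means that the transition probability $P_t(y,\cdot)$ of the Markov process $Y$ is the law of $X$. *)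

(* Defs.v *)
From HB Require Import structures.
From mathcomp Require Import all_boot all_order all_algebra.
From mathcomp Require Import complex.
From mathcomp Require Import all_classical all_reals all_analysis.

Set Implicit Arguments.
Unset Strict Implicit.
Unset Printing Implicit Defensive.

Import Order.TTheory GRing.Theory Num.Theory.
Import numFieldNormedType.Exports.

Local Open Scope classical_set_scope.
Local Open Scope ring_scope.

(* R^d is 'rV[R]_d.  The norm the library puts on it is the sup norm: it has the
   same open sets, hence the same Borel sets, as the Euclidean norm [enorm]
   below, which is the one used everywhere else. *)
Section borel.
Variables (R : realType) (m n : nat).
Let G : set (set 'M[R]_(m, n)) := open.

HB.instance Definition _ := @isMeasurable.Build default_measure_display
  'M[R]_(m, n) <<s G >> (@sigma_algebra0 _ setT G) (@sigma_algebraC _ G)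
  (@sigma_algebra_bigcup _ setT G).
End borel.

Section euclidean.
Variables (R : realType) (d : nat).

Definition dot (x y : 'rV[R]_d) : R := \sum_j x ord0 j * y ord0 j.

Definition enorm (x : 'rV[R]_d) : R := Num.sqrt (dot x x).

Definition sphere : set 'rV[R]_d := [set x | enorm x = 1].

End euclidean.

Arguments sphere {R d}.

(* Integrals against a bare set function; they are only used for countably
   additive ones. *)
Section integrals.
Context (R : realType) (disp : measure_display) (T : measurableType disp).
Variables (mu : set T -> \bar R) (D : set T).

Definition rint (f : T -> R) : R := fine (\int[mu]_(x in D) (f x)%:E)%E.

Definition vint d (f : T -> 'rV[R]_d) : 'rV[R]_d :=
  \row_j rint (fun x => f x ord0 j).

Definition cint (f : T -> R[i]) : R[i] :=
  Complex (rint (fun x => complex.Re (f x))) (rint (fun x => complex.Im (f x))).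

End integrals.

Definition cexp (R : realType) (w : R[i]) : R[i] :=
  (real_complex R (expR (complex.Re w)) *
   Complex (cos (complex.Im w)) (sin (complex.Im w)))%R.

Section infinitely_divisible.
Local Open Scope complex_scope.
Variables (R : realType) (d : nat).
Implicit Types (mu M : set 'rV[R]_d -> \bar R) (h : 'rV[R]_d -> R).

Definition charfun mu (z : 'rV[R]_d) : R[i] :=
  cint mu setT (fun x => cexp ('i * (dot z x)%:C)).

Definition ID_exponent (A : 'M[R]_d) M (b : 'rV[R]_d) h (z : 'rV[R]_d) : R[i] :=
  - (2^-1 * dot z (z *m A^T))%:C + 'i * (dot b z)%:C
  + cint M setT (fun x => cexp ('i * (dot z x)%:C) - 1 - 'i * (dot z x * h x)%:C).

Definition is_ID (A : 'M[R]_d) M (b : 'rV[R]_d) h mu : Prop :=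
  forall z, charfun mu z = cexp (ID_exponent A M b h z).

End infinitely_divisible.

(* The measure dF on (0, +oo) of a function F nondecreasing there.  F need not
   be right-continuous, so ]a, b] gets mass F(b+) - F(a+); nor bounded near 0.
   These conditions determine the measure. *)
Definition stieltjes_spec (R : realType) (F : R -> R)
    (m : {measure set R -> \bar R}) : Prop :=
  m [set u | u <= 0] = 0%E /\
  forall a b : R, 0 < a -> a <= b ->
    m `]a, b]%classic = (lim (F u @[u --> b^'+]) - lim (F u @[u --> a^'+]))%:E.

Definition stieltjes (R : realType) (F : R -> R) : {measure set R -> \bar R} :=
  if pselect (exists m, stieltjes_spec F m) is left ex then sval (cid ex)
  else mzero.

Section tempered_stable.
Variables (R : realType) (d : nat).
Variables (alpha : R) (sigma : set 'rV[R]_d -> \bar R) (q : 'rV[R]_d -> R -> R).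

Definition trunc (x : 'rV[R]_d) : R :=
  if alpha < 1 then 0
  else if alpha == 1 then (if enorm x <= 1 then 1 else 0)
  else 1.

Definition TS_levy (B : set 'rV[R]_d) : \bar R :=
  (\int[sigma]_(xi in sphere) \int[lebesgue_measure]_(u in `]0%R, +oo[)
     (\1_B (u *: xi) * (u `^ (- 1 - alpha) * q xi u))%:E)%E.

Definition is_TS (b : 'rV[R]_d) (mu : set 'rV[R]_d -> \bar R) : Prop :=
  is_ID 0 TS_levy b trunc mu.

Definition rho (xi : 'rV[R]_d) (u : R) : R := - (u `^ (- alpha) * q xi u).

Definition bdlp_levy (B : set 'rV[R]_d) : \bar R :=
  (\int[sigma]_(xi in sphere) \int[stieltjes (rho xi)]_(u in `]0%R, +oo[)
     (\1_B (u *: xi))%:E)%E.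

Let radial : 'rV[R]_d :=
  vint bdlp_levy [set x | 1 < enorm x] (fun x => (enorm x)^-1 *: x).

Definition bdlp_drift (b : 'rV[R]_d) : 'rV[R]_d :=
  if alpha == 1 then b - radial else b.

(* The law of Z_1 for which the OU-process with parameter lambda and BDLP Z has
   limiting distribution TS_alpha(sigma, q, b). *)
Definition is_TS_bdlp_law (lambda : R) (b : 'rV[R]_d)
    (mu : set 'rV[R]_d -> \bar R) : Prop :=
  is_ID 0 (fun B => lambda%:E * bdlp_levy B)%E (lambda *: bdlp_drift b) trunc mu.

Definition trans_drift (lambda t : R) (b : 'rV[R]_d) : 'rV[R]_d :=
  if alpha == 1 then
    (1 - expR (- (lambda * t))) *: b
    + vint bdlp_levy [set x | 1 < enorm x <= expR (lambda * t)]
        (fun x => ((enorm x)^-1 - expR (- (lambda * t))) *: x)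
    - (1 - expR (- (lambda * t))) *: radial
  else (1 - expR (- (lambda * t))) *: b.

Definition q_drop (lambda t : R) (xi : 'rV[R]_d) (u : R) : R :=
  q xi u - q xi (u * expR (lambda * t)).

Definition jump_mass (lambda t : R) : \bar R :=
  (\int[sigma]_(xi in sphere) \int[lebesgue_measure]_(u in `]0%R, +oo[)
     (q_drop lambda t xi u * u `^ (- 1 - alpha))%:E)%E.

(* H, the joint law of (xi, W); [jump_law] below is the law of xi W. *)
Definition jump_polar_law (lambda t : R) (C : set ('rV[R]_d * R)) : \bar R :=
  (((fine (jump_mass lambda t))^-1)%:E *
   \int[sigma]_(xi in sphere) \int[lebesgue_measure]_(u in `]0%R, +oo[)
     (\1_C (xi, u) * (q_drop lambda t xi u * u `^ (- 1 - alpha)))%:E)%E.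

Definition jump_law (lambda t : R) (B : set 'rV[R]_d) : \bar R :=
  jump_polar_law lambda t ((fun p : 'rV[R]_d * R => p.2 *: p.1) @^-1` B).

Definition psi (lambda t : R) : 'rV[R]_d :=
  expR (- (alpha * lambda * t)) *:
  vint sigma sphere (fun xi =>
    rint lebesgue_measure `]0, +oo[
      (fun u => trunc (u *: xi) * q_drop lambda t xi u * u `^ (- alpha)) *: xi).

End tempered_stable.

Section independence.
Context (R : realType) (disp : measure_display) (T : measurableType disp).
Variable P : probability T R.

Definition independent_systems (I : eqType) (E : I -> set (set T)) : Prop :=
  forall (s : seq I) (A : I -> set T), uniq s ->
    (forall i, i \in s -> E i (A i)) ->
    P (\bigcap_(i in [set` s]) A i) = (\prod_(i <- s) P (A i))%E.

End independence.

Section ornstein_uhlenbeck.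
Context (R : realType) (disp : measure_display) (T : measurableType disp).
Variables (P : probability T R) (d : nat).
Local Notation V := 'rV[R]_d.
(* Only the times t >= 0 of a process matter. *)
Implicit Types (X Y Z : R -> {RV P >-> V}).

Definition sigma_process X (J : set R) : set (set T) :=
  <<s \bigcup_(r in J) g_sigma_algebra_preimage (X r) >>.

Definition cadlag (f : R -> V) : Prop :=
  (forall t, 0 <= t -> f s @[s --> t^'+] --> f t) /\
  (forall t, 0 < t -> cvg (f s @[s --> t^'-])).

Record is_levy Z : Prop := IsLevy {
  levy_start : {ae P, forall w, Z 0 w = 0} ;
  levy_indep : forall (n : nat) (t : nat -> R), 0 <= t 0%N ->
    {homo t : i j / (i <= j)%N >-> i <= j} ->
    independent_systems P (fun i : 'I_n =>
      g_sigma_algebra_preimage (fun w => Z (t i.+1) w - Z (t i) w)) ;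
  levy_station : forall s t, 0 <= s -> 0 <= t -> forall B : set V, measurable B ->
    P [set w | B (Z (s + t) w - Z s w)] = P [set w | B (Z t w)] ;
  levy_stoch_cont : forall t e : R, 0 <= t -> 0 < e ->
    P [set w | e < enorm (Z s w - Z t w)] @[s --> within [set s | 0 <= s] (nbhs t)]
      --> 0%E ;
  levy_cadlag : {ae P, forall w, cadlag (fun t => Z t w)} }.

(* I = \int_a^b f(s) dZ_s: limit in probability, as the mesh tends to 0, of the
   sums \sum_k f(s_k) (Z_{s_{k+1}} - Z_{s_k}) over subdivisions of [a, b]; f is
   meant to be continuous. *)
Definition is_stoch_integral (f : R -> R) Z (a b : R) (I : T -> V) : Prop :=
  forall e : R, 0 < e -> exists2 delta : R, 0 < delta &
    forall (n : nat) (s : nat -> R), s 0%N = a -> s n = b ->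
      (forall k, (k < n)%N -> s k <= s k.+1 < s k + delta) ->
      (P [set w | e < enorm (\sum_(k < n) f (s k) *: (Z (s k.+1) w - Z (s k) w)
                             - I w)]%R <= e%:E)%E.

Definition is_OU (lambda : R) Z Y : Prop :=
  [/\ 0 < lambda, is_levy Z,
      independent_systems P (fun b : bool =>
        if b then g_sigma_algebra_preimage (Y 0)
        else sigma_process Z [set r | 0 <= r]) &
      forall t, 0 <= t ->
        is_stoch_integral (fun s => expR (- (lambda * (t - s)))) Z 0 t
          (fun w => Y t w - expR (- (lambda * t)) *: Y 0 w)].

Definition is_TSOU (alpha : R) (sigma : set V -> \bar R) (q : V -> R -> R)
    (b : V) (lambda : R) Z Y : Prop :=
  is_OU lambda Z Y /\
  is_TS_bdlp_law alpha sigma q lambda b (distribution P (Z 1)).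

Definition transition_function (Pt : R -> R.-pker V ~> V) : Prop :=
  (forall x B, measurable B -> Pt 0 x B = \d_x B) /\
  (forall s t x B, 0 <= s -> 0 <= t -> measurable B ->
     Pt (s + t) x B = (\int[Pt s x]_y Pt t y B)%E).

Definition is_markov (Pt : R -> R.-pker V ~> V) Y : Prop :=
  forall s t, 0 <= s -> 0 <= t ->
  forall A B, sigma_process Y `[0, s] A -> measurable B ->
    P (A `&` [set w | B (Y (s + t) w)]) = (\int[P]_(w in A) Pt t (Y s w) B)%E.

(* The transition function of the OU-process with parameter lambda and BDLP Z.
   The Markov property of a single process determines Pt t y only for almost
   every y with respect to the laws of its marginals; Pt has to serve for all
   initial variables, in particular for Y_0 = y with y arbitrary. *)
Definition is_OU_transition (lambda : R) Z (Pt : R -> R.-pker V ~> V) : Prop :=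
  transition_function Pt /\ forall Y, is_OU lambda Z Y -> is_markov Pt Y.

End ornstein_uhlenbeck.

(* "Given Y_s = y, Y_u has law law_given Pt s u y" (0 <= s <= u), for a
   time-homogeneous Markov process Y with transition function Pt. *)
Definition law_given (R : realType) d (Pt : R -> R.-pker 'rV[R]_d ~> 'rV[R]_d)
  (s u : R) (y : 'rV[R]_d) : {measure set 'rV[R]_d -> \bar R} := Pt (u - s) y.

(* Main.v *)
Require Import Defs.
From HB Require Import structures.
From mathcomp Require Import all_boot all_order all_algebra.
From mathcomp Require Import complex.
From mathcomp Require Import all_classical all_reals all_analysis.
From mathcomp Require Import measurable_realfun lebesgue_integral_under.
From mathcomp Require Import ring lra.

(** The transition probability [P_t(y, .)] is the law of
    [e^(- lambda t) y + I], where [I] is the integral of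
    [e^(- lambda (t - s))] against [dZ_s] over [[0, t]]: the equation is affine in
    the initial value, so the process can be restarted from the constant [y] on
    the space of [Z], and the Markov property at time [0] reads off its law
    ([ou_transition_law]). It remains to compare characteristic functions, which
    determine laws on [R^d] ([charfun_inj], [eq_law_of_cfun]).

    If [psi_Z] is the Levy-Khintchine exponent of [Z_1], the characteristic
    function of [I] at [z] is the exponential of the time integral of
    [psi_Z (e^(- lambda (t - s)) z)] ([levy_cfun_exponent],
    [stochastic_integral_cfun], [riemann_sum_cvg]). In polar coordinates the Levy
    measure of [Z_1] leaves the mass [v^(- alpha) q(xi, v)], up to the factor
    [lambda], beyond distance [v] in direction [xi]. It is the image of
    [sigma] times Lebesgue measure under the quantile function of this tail
    ([stieltjes_quantile], [bdlp_levyE]), so the time integral is an integral over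
    jumps and their times. A jump reaches distance [v] at time [t] if its size was
    between [v] and [v e^(lambda t)]; by Tonelli the jumps present at time [t] have
    radial density
    [v^(- 1) (v^(- alpha) q(v) - (v e^(lambda t))^(- alpha) q(v e^(lambda t)))]
    ([flow_image]), which is the sum of
    [(1 - e^(- alpha lambda t)) q(v) v^(- 1 - alpha)] and
    [e^(- alpha lambda t) (q(v) - q(v e^(lambda t))) v^(- 1 - alpha)]
    ([trans_density_split]).

    The first density belongs to the Levy measure of [X_0]. The second has total
    mass [K e^(- alpha lambda t)]. If [K = 0] it vanishes; if [0 < K < oo] it is the
    Levy measure of a compound Poisson law with jump law [H], whose
    Levy-Khintchine exponent differs from that of the random sum
    ([compound_poisson_cfun]) by the compensator [psi] ([jump_exponentE]).

    The drift [lambda c] of [Z_1] contributes [(1 - e^(- lambda t)) c]. When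
    [alpha = 1] the truncation at the unit ball does not commute with the
    contraction: jumps that start outside the ball and end inside produce the
    additional integral in [d_1] ([flow_correction1]).

    The estimates rest on one function: [levy_gauge] dominates the
    Levy-Khintchine kernel for the truncation that goes with [alpha], and as
    [q <= 1] the quantile is at most [x^(- 1 / alpha)] ([quantile_le]), which
    makes the gauge integrable since [alpha < 2]. *)

Set Implicit Arguments.
Unset Strict Implicit.
Unset Printing Implicit Defensive.

Import Order.TTheory GRing.Theory Num.Theory.
Import numFieldNormedType.Exports.

Local Open Scope classical_set_scope.
Local Open Scope ring_scope.

(** * Borel sets of vectors *)

Section measurable_comparisons.
Context (R : realType) (disp : measure_display) (T : measurableType disp).
Implicit Types f g : T -> R.

Lemma measurable_set_bool (h : T -> bool) : measurable_fun setT h ->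
  measurable [set w | h w].
Proof. by move=> mh; rewrite -[X in measurable X]setTI; exact: mh. Qed.

Lemma measurable_set_lt f g : measurable_fun setT f -> measurable_fun setT g ->
  measurable [set w | f w < g w].
Proof. by move=> mf mg; apply/measurable_set_bool/measurable_fun_ltr. Qed.

Lemma measurable_set_le f g : measurable_fun setT f -> measurable_fun setT g ->
  measurable [set w | f w <= g w].
Proof. by move=> mf mg; apply/measurable_set_bool/measurable_fun_ler. Qed.

End measurable_comparisons.

Section borel_vectors.
Variables (R : realType) (d : nat).
Local Notation V := 'rV[R]_d.

Lemma open_measurable_rV (U : set V) : open U -> measurable U.
Proof. by move=> oU; exact: sub_sigma_algebra. Qed.

Lemma continuous_measurable_rV (f : V -> R) : continuous f ->
  measurable_fun setT f.
Proof.
move=> cf; apply: (measurability _ (RGenOInfty.measurableE R)) => //.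
move=> _ [_ [a ->] <-]; rewrite setTI; apply: open_measurable_rV.
by apply: open_comp => // x _; exact: cf.
Qed.

Lemma measurable_coord (j : 'I_d) : measurable_fun setT (fun x : V => x ord0 j).
Proof. by apply: continuous_measurable_rV; exact: coord_continuous. Qed.

Let box (c : 'rV[rat]_d * nat) : set V :=
  [set x | forall j, `|ratr (c.1 ord0 j) - x ord0 j| < c.2.+1%:R^-1].

(** The boxes with rational centres and radii [1 / (n + 1)] form a countable base
    of the topology, so measurability of a vector-valued function can be tested
    coordinate by coordinate. *)
Let open_boxes (U : set V) : open U ->
  U = \bigcup_c (if `[< box c `<=` U >] then box c else set0).
Proof.
move=> oU; apply/seteqP; split => [x Ux|x [c _]]; last by case: asboolP => // + cx; exact.
have /nbhs_ballP[e /= e0 xeU] : nbhs x U by exact: open_nbhs_nbhs.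
have [n ne] : exists n : nat, n.+1%:R^-1 < e / 2.
  have := near_infty_natSinv_lt (PosNum (divr_gt0 e0 (ltr0n R 2))).
  by case=> n _ /(_ n (leqnn n)) /= ?; exists n.
have qP j : exists r : rat, `|ratr r - x ord0 j| < (n.+1%:R^-1 : R).
  have /rat_in_itvoo[r] : x ord0 j - n.+1%:R^-1 < x ord0 j + (n.+1%:R^-1 : R).
    by rewrite ltrBlDr -addrA ltrDl addr_gt0 ?invr_gt0.
  rewrite in_itv /= => /andP[r1 r2]; exists r.
  by rewrite ltr_distl r1 r2.
pose c := (\row_j sval (cid (qP j)), n).
have cx : box c x by move=> j; rewrite /= mxE; exact: svalP (cid (qP j)).
exists c => //; case: asboolP => // -[] y cy; apply: xeU; split => // i j.
rewrite (ord1 i) /ball /=.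
rewrite -(subrK (ratr (c.1 ord0 j)) (x ord0 j)) -addrA.
apply: (le_lt_trans (ler_normD _ _)).
rewrite (splitr e) ltrD//; last exact: lt_trans (cy j) ne.
by rewrite distrC; exact: lt_trans (cx j) ne.
Qed.

Lemma measurable_fun_rV disp (T : measurableType disp) (f : T -> V) :
  (forall j, measurable_fun setT (fun w => f w ord0 j)) -> measurable_fun setT f.
Proof.
move=> mf; apply: (@measurability _ _ T V setT f open) => //.
move=> _ [U oU <-]; rewrite setTI (open_boxes oU) preimage_bigcup.
apply: countable_bigcupT_measurable => [|c]; first exact: countableP.
case: asboolP => _; last by rewrite preimage_set0.
rewrite (_ : _ @^-1` _ =
    \bigcap_(j in [set: 'I_d]) [set w | `|ratr (c.1 ord0 j) - f w ord0 j| < c.2.+1%:R^-1]).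
  apply: fin_bigcap_measurable => // j _.
  apply: measurable_set_lt => //.
  by apply: measurableT_comp => //; exact: measurable_funB.
by apply/seteqP; split => [w h j _|w h j]; apply: h.
Qed.

Section vector_operations.
Context (disp : measure_display) (T : measurableType disp).
Implicit Types f g : T -> V.

Lemma measurable_coord_comp f (j : 'I_d) : measurable_fun setT f ->
  measurable_fun setT (fun w => f w ord0 j).
Proof. exact: (measurableT_comp (measurable_coord j)). Qed.

Lemma measurable_vecD f g : measurable_fun setT f -> measurable_fun setT g ->
  measurable_fun setT (fun w => f w + g w).
Proof.
move=> mf mg; apply: measurable_fun_rV => j.
rewrite (_ : (fun _ => _) = (fun w => f w ord0 j + g w ord0 j)); last first.
  by apply/funext => w; rewrite mxE.
by apply: measurable_funD; exact: measurable_coord_comp.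
Qed.

Lemma measurable_vecZ (k : T -> R) f : measurable_fun setT k ->
  measurable_fun setT f -> measurable_fun setT (fun w => k w *: f w).
Proof.
move=> mk mf; apply: measurable_fun_rV => j.
rewrite (_ : (fun _ => _) = (fun w => k w * f w ord0 j)); last first.
  by apply/funext => w; rewrite mxE.
by apply: measurable_funM => //; exact: measurable_coord_comp.
Qed.

Lemma measurable_vecB f g : measurable_fun setT f -> measurable_fun setT g ->
  measurable_fun setT (fun w => f w - g w).
Proof.
move=> mf mg; apply: measurable_vecD => //.
under eq_fun do rewrite -scaleN1r.
exact: measurable_vecZ.
Qed.

Lemma measurable_vec_sum (I : Type) (s : seq I) (F : I -> T -> V) :
  (forall i, measurable_fun setT (F i)) ->
  measurable_fun setT (fun w => \sum_(i <- s) F i w).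
Proof.
move=> mF; elim: s => [|i s IH]; first by under eq_fun do rewrite big_nil; exact: measurable_cst.
by under eq_fun do rewrite big_cons; exact: measurable_vecD.
Qed.

Lemma measurable_dot f g : measurable_fun setT f -> measurable_fun setT g ->
  measurable_fun setT (fun w => dot (f w) (g w)).
Proof.
move=> mf mg; rewrite /dot; apply: measurable_sum => j.
by apply: measurable_funM; exact: measurable_coord_comp.
Qed.

Lemma measurable_enorm f : measurable_fun setT f ->
  measurable_fun setT (fun w => enorm (f w)).
Proof.
move=> mf; rewrite /enorm; apply: (measurableT_comp (f := @Num.sqrt R)).
  by apply: continuous_measurable_fun; exact: sqrt_continuous.
exact: measurable_dot.
Qed.

End vector_operations.

Lemma measurable_sphere : measurable (sphere : set V).
Proof.
rewrite /sphere; have mn := measurable_enorm (@measurable_id _ V setT).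
rewrite (_ : mkset _ = [set x : V | enorm x <= 1] `&` [set x | 1 <= enorm x]).
  by apply: measurableI; exact: measurable_set_le.
apply/seteqP; split => [x /= ->|x /= [x1 x2]]; first by rewrite lexx.
by apply: le_anti; rewrite x1.
Qed.

End borel_vectors.

(** * Images of weighted measures *)

Section bare_integrals.
Context (R : realType) (disp : measure_display) (T : measurableType disp).
Import HBNNSimple.

(** An integral is a supremum over simple functions, whose level sets are
    measurable. *)
Lemma eq_measurable_integral (mu nu : set T -> \bar R) (D : set T) (f : T -> \bar R) :
  (forall B, measurable B -> mu B = nu B) ->
  (\int[mu]_(x in D) f x = \int[nu]_(x in D) f x)%E.
Proof.
move=> munu; rewrite /integral.
have E (h : {nnsfun T >-> R}) : sintegral mu h = sintegral nu h.
  by rewrite /sintegral; apply: eq_fsbigr => x _; rewrite munu.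
by congr (ereal_sup _ - ereal_sup _)%E; apply/seteqP; split => _ [h hf <-];
  exists h.
Qed.

End bare_integrals.

(** Every Levy measure and jump law below is the image of a fixed reference
    measure with a density, under a map into [R^d]; transporting integrals to the
    reference space makes Fubini and dominated convergence available there. *)
Section weighted_image.
Local Open Scope ereal_scope.
Context (R : realType) (d1 d2 : measure_display).
Context (T : measurableType d1) (W : measurableType d2).
Variables (mu : {measure set T -> \bar R}) (phi : T -> W) (w : T -> R).
Hypothesis mphi : measurable_fun setT phi.
Hypothesis mw : measurable_fun setT w.
Hypothesis w0 : forall x, (0 <= w x)%R.

Let mterm (g : W -> R) : measurable_fun setT g ->
  measurable_fun setT (fun x => (g (phi x) * w x)%:E).
Proof.
by move=> mg; apply/measurable_EFinP/measurable_funM => //; exact: measurableT_comp.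
Qed.

Let mpre B : measurable B -> measurable (phi @^-1` B).
Proof. by move=> mB; rewrite -[X in measurable X]setTI; exact: mphi. Qed.

Let image (B : set W) := \int[mu]_(x in phi @^-1` B) (w x)%:E.

Let image0 : image set0 = 0.
Proof. by rewrite /image preimage_set0 integral_set0. Qed.

Let image_ge0 B : 0 <= image B.
Proof. by apply: integral_ge0 => x _; rewrite lee_fin. Qed.

Let image_sigma : semi_sigma_additive image.
Proof.
move=> F mF tF mUF; rewrite /image preimage_bigcup ge0_integral_bigcup//=.
- apply: is_cvg_ereal_nneg_natsum_cond => n _ _.
  by apply: integral_ge0 => x _; rewrite lee_fin.
- by move=> n; exact: mpre.
- by apply/measurable_EFinP; exact: measurable_funTS.
- by move=> x _; rewrite lee_fin.
- by apply/trivIsetP => i j _ _ ij; rewrite -preimage_setI;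
    move/trivIsetP : tF => /(_ _ _ Logic.I Logic.I ij) ->; rewrite preimage_set0.
Qed.

Let imageE B : measurable B -> image B = \int[mu]_x (\1_B (phi x) * w x)%:E.
Proof.
move=> mB; rewrite /image integral_mkcond; apply: eq_integral => x _.
by rewrite patchE indicE (_ : (phi x \in B) = (x \in phi @^-1` B)) //;
  case: ifPn; rewrite ?mul1r ?mul0r.
Qed.

HB.instance Definition _ := isMeasure.Build _ _ _ image image0 image_ge0 image_sigma.

Import HBNNSimple.

Let image_nnsfun (f : {nnsfun W >-> R}) :
  \int[image]_x (f x)%:E = \int[mu]_x (f (phi x) * w x)%:E.
Proof.
under [LHS]eq_integral do rewrite fimfunE -fsumEFin//.
rewrite ge0_integral_fsum//; last 2 first.
  - by move=> r; exact/measurable_EFinP/measurableT_comp.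
  - by move=> n x _; rewrite EFinM nnfun_muleindic_ge0.
under [RHS]eq_integral.
  move=> x xD; rewrite fimfunE EFinM -fsumEFin// ge0_mule_fsuml; last first.
    by move=> r; rewrite EFinM nnfun_muleindic_ge0.
  over.
rewrite [RHS]ge0_integral_fsum//; last 2 first.
  - move=> r; under eq_fun do rewrite -EFinM; apply: (mterm (g := fun x => (r * \1_(f @^-1` [set r]) x)%R)).
    exact: measurable_funM.
  - move=> r x _; rewrite mule_ge0 ?lee_fin//.
    by have := nnfun_muleindic_ge0 f r (phi x); rewrite -EFinM lee_fin.
apply: eq_fsbigr => r _; rewrite integralZl_indic_nnsfun// integral_indic// setIT.
rewrite -[Measure.sort _ _]/(image _) imageE//.
have [r0|r0] := leP 0%R r; last first.
  rewrite preimage_nnfun0//; under eq_integral do rewrite indic0 mul0r.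
  under [RHS]eq_integral do rewrite indic0 mulr0 mul0e.
  by rewrite !integral0 mule0.
rewrite -ge0_integralZl//; last 2 first.
- exact: mterm.
- by move=> x _; rewrite lee_fin mulr_ge0.
by apply: eq_integral => x _; rewrite -!EFinM mulrA.
Qed.

Let image_ge0_integral (g : W -> R) : measurable_fun setT g -> (forall x, (0 <= g x)%R) ->
  \int[image]_x (g x)%:E = \int[mu]_x (g (phi x) * w x)%:E.
Proof.
move=> mg g0.
have mEg : measurable_fun setT (EFin \o g) by exact/measurable_EFinP.
have Eg0 x : setT x -> 0 <= (EFin \o g) x by rewrite lee_fin.
pose f_ := nnsfun_approx measurableT mEg.
have cvgf x : f_ n x @[n --> \oo] --> g x.
  by have /fine_cvgP[_] := cvg_nnsfun_approx measurableT mEg Eg0 (x := x) Logic.I.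
transitivity (lim (\int[image]_x (f_ n x)%:E @[n --> \oo])).
  rewrite -monotone_convergence//=.
  - by apply: eq_integral => x _; apply/esym/cvg_lim => //; exact: cvg_nnsfun_approx.
  - by move=> n; exact/measurable_EFinP/measurable_funTS.
  - by move=> n ? _; rewrite lee_fin.
  - by move=> ? _ ? ? mn; rewrite lee_fin; exact/lefP/nd_nnsfun_approx.
transitivity (lim (\int[mu]_x (f_ n (phi x) * w x)%:E @[n --> \oo])).
  by apply: congr_lim; apply/funext => n; exact: image_nnsfun.
rewrite -monotone_convergence//=.
- apply: eq_integral => x _; apply/cvg_lim => //.
  apply: cvg_EFin; first by apply: nearW.
  by apply: cvgMl; exact: cvgf.
- by move=> n; exact: mterm.
- by move=> n x _; rewrite lee_fin mulr_ge0.
- move=> x _ m n mn; rewrite lee_fin ler_wpM2r//.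
  exact/lefP/nd_nnsfun_approx.
Qed.

Lemma weighted_image_exists : exists M : {measure set W -> \bar R},
  forall B, measurable B -> M B = \int[mu]_x (\1_B (phi x) * w x)%:E.
Proof. by exists image; exact: imageE. Qed.

(** Change of variables along [phi] with density [w]; it holds for every set
    function with the right values on measurable sets, and without any
    integrability since the positive and negative parts are transported
    separately. *)
Lemma integral_weighted_image (nu : set W -> \bar R) :
  (forall B, measurable B -> nu B = \int[mu]_x (\1_B (phi x) * w x)%:E) ->
  forall g : W -> R, measurable_fun setT g ->
  \int[nu]_x (g x)%:E = \int[mu]_x (g (phi x) * w x)%:E.
Proof.
move=> nuE g mg; rewrite (@eq_measurable_integral _ _ _ nu image); last first.
  by move=> B mB; rewrite nuE// imageE.
pose M : {measure set W -> \bar R} := image.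
rewrite [LHS](integralE M) [RHS]integralE; congr (_ - _).
- under eq_integral do rewrite funeposE -EFin_max.
  rewrite image_ge0_integral; last 2 first.
  + exact: measurable_maxr.
  + by move=> x; rewrite le_max lexx orbT.
  by apply: eq_integral => x _; rewrite funeposE -EFin_max maxr_pMl// mul0r.
- under eq_integral do rewrite funenegE -EFinN -EFin_max.
  rewrite image_ge0_integral; last 2 first.
  + by apply: measurable_maxr => //; exact: measurableT_comp.
  + by move=> x; rewrite le_max lexx orbT.
  by apply: eq_integral => x _; rewrite funenegE -EFinN -EFin_max maxr_pMl// mul0r mulNr.
Qed.

Lemma integral_weighted_imageR (nu : set W -> \bar R) :
  (forall B, measurable B -> nu B = \int[mu]_x (\1_B (phi x) * w x)%:E) ->
  forall g : W -> R, measurable_fun setT g ->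
  rint nu setT g = rint mu setT (fun x => (g (phi x) * w x)%R).
Proof. by move=> nuE g mg; rewrite /rint integral_weighted_image. Qed.

End weighted_image.

(** * Dominated and bounded integrals *)

Section measurable_waves.
Variable R : realType.

Lemma measurable_cos : measurable_fun setT (@cos R).
Proof. by apply: continuous_measurable_fun => x; exact: continuous_cos. Qed.

Lemma measurable_sin : measurable_fun setT (@sin R).
Proof. by apply: continuous_measurable_fun => x; exact: continuous_sin. Qed.

End measurable_waves.

Lemma indic_le1 (R : numDomainType) (T : Type) (A : set T) (x : T) :
  `|\1_A x| <= 1 :> R.
Proof. by rewrite indicE; case: (_ \in _); rewrite ?normr1 ?normr0. Qed.

Lemma cvg_norm_le (R : realType) (u : nat -> R) (l M : R) :
  u n @[n --> \oo] --> l -> (forall n, `|u n| <= M) -> `|l| <= M.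
Proof.
move=> ul uM.
have cn : `|u n| @[n --> \oo] --> `|l| by exact: cvg_norm.
rewrite -(cvg_lim (@Rhausdorff R) cn); apply: limr_le; first exact: cvgP cn.
by apply: nearW => n; exact: uM.
Qed.

Section real_integrals.
Context (R : realType) (disp : measure_display) (T : measurableType disp).
Variable mu : {measure set T -> \bar R}.
Implicit Types f g : T -> R.

Lemma integral_rint f : mu.-integrable setT (EFin \o f) ->
  (\int[mu]_x (f x)%:E)%E = (rint mu setT f)%:E.
Proof. by move=> fi; rewrite /rint fineK//; exact: (integrable_fin_num measurableT fi). Qed.

Lemma rintD f g : mu.-integrable setT (EFin \o f) -> mu.-integrable setT (EFin \o g) ->
  rint mu setT (fun x => f x + g x) = rint mu setT f + rint mu setT g.
Proof. by move=> fi gi; exact: RintegralD. Qed.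

Lemma rintB f g : mu.-integrable setT (EFin \o f) -> mu.-integrable setT (EFin \o g) ->
  rint mu setT (fun x => f x - g x) = rint mu setT f - rint mu setT g.
Proof. by move=> fi gi; exact: RintegralB. Qed.

Lemma rintZl (k : R) f : mu.-integrable setT (EFin \o f) ->
  rint mu setT (fun x => k * f x) = k * rint mu setT f.
Proof. by move=> fi; exact: RintegralZl. Qed.

Lemma eq_rint f g : f =1 g -> rint mu setT f = rint mu setT g.
Proof. by move=> fg; congr rint; exact/funext. Qed.

Lemma dominated_integrable_real f g : mu.-integrable setT (EFin \o g) ->
  measurable_fun setT f -> (forall x, `|f x| <= g x) ->
  mu.-integrable setT (EFin \o f).
Proof.
move=> gi mf fg; apply: le_integrable gi => //; first exact/measurable_EFinP.
by move=> x _ /=; rewrite lee_fin (le_trans (fg x))// ler_norm.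
Qed.

Lemma integrable_addr f g : mu.-integrable setT (EFin \o f) ->
  mu.-integrable setT (EFin \o g) -> mu.-integrable setT (EFin \o (fun x => f x + g x)).
Proof.
move=> fi gi; rewrite (_ : _ \o _ = (EFin \o f) \+ (EFin \o g))%E//.
exact: integrableD.
Qed.

Lemma integrable_mulr (k : R) f : mu.-integrable setT (EFin \o f) ->
  mu.-integrable setT (EFin \o (fun x => k * f x)).
Proof.
move=> fi; rewrite (_ : _ \o _ = (fun x => k%:E * (f x)%:E)%E)//.
exact: integrableZl.
Qed.

Lemma rint_sum (I : Type) (r : seq I) (F : I -> T -> R) :
  (forall i, mu.-integrable setT (EFin \o F i)) ->
  mu.-integrable setT (EFin \o (fun x => \sum_(i <- r) F i x)) /\
  rint mu setT (fun x => \sum_(i <- r) F i x) = \sum_(i <- r) rint mu setT (F i).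
Proof.
move=> Fi; elim: r => [|i r [IHi IH]].
  have E : (fun x => \sum_(i <- [::]) F i x) = (fun=> 0) by apply/funext => x; rewrite big_nil.
  rewrite E big_nil; split; first exact: integrable0.
  by rewrite /rint integral0.
have E : (fun x => \sum_(j <- i :: r) F j x) = (fun x => F i x + \sum_(j <- r) F j x).
  by apply/funext => x; rewrite big_cons.
by rewrite E big_cons -IH; split; [exact: integrable_addr|exact: rintD].
Qed.

Lemma rint_dominated (f_ : nat -> T -> R) f g : mu.-integrable setT (EFin \o g) ->
  (forall n, measurable_fun setT (f_ n)) ->
  (forall x, f_ n x @[n --> \oo] --> f x) -> (forall n x, `|f_ n x| <= g x) ->
  rint mu setT (f_ n) @[n --> \oo] --> rint mu setT f.
Proof.
move=> gi mf_ f_f f_g.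
have mf : measurable_fun setT f.
  by apply: (measurable_fun_cvg (h := f_)) => // x _; exact: f_f.
have [] := @dominated_convergence _ T R mu setT measurableT
  (fun n x => (f_ n x)%:E) (fun x => (f x)%:E) (EFin \o g).
- by move=> n; exact/measurable_EFinP.
- exact/measurable_EFinP.
- by apply: aeW => x _; apply: cvg_EFin; [exact: nearW|exact: f_f].
- exact: gi.
- by apply: aeW => x n _; rewrite lee_fin.
move=> fi _ cv.
have f_fin : (\int[mu]_x (f x)%:E \is a fin_num)%E by exact: integrable_fin_num.
by apply: fine_cvg; rewrite fineK.
Qed.

End real_integrals.

Section bounded_integrals.
Context (R : realType) (disp : measure_display) (T : measurableType disp).
Variable mu : {finite_measure set T -> \bar R}.

Lemma bounded_integrable (f : T -> R) (M : R) : measurable_fun setT f ->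
  (forall x, `|f x| <= M) -> mu.-integrable setT (EFin \o f).
Proof.
move=> mf fM; apply: measurable_bounded_integrable => //.
  by rewrite ltey_eq fin_num_measure.
by exists M; split => [|N /ltW MN x _]; [exact: num_real|exact: le_trans (fM x) MN].
Qed.

Lemma integrable_cst (k : R) : mu.-integrable setT (EFin \o (fun=> k)).
Proof. by apply: (@bounded_integrable _ `|k|). Qed.

Lemma rint_cst (P : probability T R) (k : R) : rint P setT (fun=> k) = k.
Proof. by rewrite /rint integral_cst//= probability_setT mule1. Qed.

End bounded_integrals.

(** * Complex exponentials and scalar products *)

Section complex_exponential.
Variable R : realType.
Implicit Types (t : R) (w : R[i]).

Definition cis t : R[i] := Complex (cos t) (sin t).

Lemma complex_eq (u v : R[i]) : complex.Re u = complex.Re v ->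
  complex.Im u = complex.Im v -> u = v.
Proof. by case: u v => a b [c e] /= -> ->. Qed.

Lemma ReD (u v : R[i]) : complex.Re (u + v) = complex.Re u + complex.Re v.
Proof. by case: u v => a b [c e]. Qed.

Lemma ImD (u v : R[i]) : complex.Im (u + v) = complex.Im u + complex.Im v.
Proof. by case: u v => a b [c e]. Qed.

Lemma ReM (u v : R[i]) : complex.Re (u * v) =
  complex.Re u * complex.Re v - complex.Im u * complex.Im v.
Proof. by case: u v => a b [c e]. Qed.

Lemma ImM (u v : R[i]) : complex.Im (u * v) =
  complex.Re u * complex.Im v + complex.Im u * complex.Re v.
Proof. by case: u v => a b [c e]. Qed.

Lemma ReN (u : R[i]) : complex.Re (- u) = - complex.Re u.
Proof. by case: u. Qed.

Lemma ImN (u : R[i]) : complex.Im (- u) = - complex.Im u.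
Proof. by case: u. Qed.

Lemma Re_real t : complex.Re (real_complex R t) = t. Proof. by []. Qed.

Lemma Im_real t : complex.Im (real_complex R t) = 0. Proof. by []. Qed.

Definition ReImE := (ReD, ImD, ReN, ImN, ReM, ImM, Re_real, Im_real).

Lemma cisE t : cexp (Complex 0 1 * real_complex R t) = cis t.
Proof.
rewrite /cexp /= mul0r mulr0 subr0 expR0 mul0r add0r mul1r.
by apply: complex_eq; rewrite /= !(mul0r, mul1r, subr0, addr0).
Qed.

Lemma cisD t1 t2 : cis (t1 + t2) = cis t1 * cis t2.
Proof. by apply: complex_eq; rewrite ReImE /= ?cosD ?sinD //= addrC. Qed.

Lemma cis0 : cis 0 = 1.
Proof. by rewrite /cis cos0 sin0. Qed.

Lemma cexpE w : cexp w = real_complex R (expR (complex.Re w)) * cis (complex.Im w).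
Proof. by []. Qed.

Lemma cexpD (u v : R[i]) : cexp (u + v) = cexp u * cexp v.
Proof. by rewrite !cexpE ReD ImD expRD cisD rmorphM /= mulrACA. Qed.

Lemma cexp0 : cexp (0 : R[i]) = 1.
Proof. by rewrite cexpE /= expR0 cis0 mulr1. Qed.

Lemma cexp_sum (I : Type) (s : seq I) (F : I -> R[i]) :
  cexp (\sum_(i <- s) F i) = \prod_(i <- s) cexp (F i).
Proof.
by elim: s => [|i s IH]; rewrite ?big_nil ?cexp0// !big_cons cexpD IH.
Qed.

Lemma cexpMn w n : cexp (w *+ n) = cexp w ^+ n.
Proof.
by elim: n => [|n IH]; rewrite ?mulr0n ?cexp0 ?expr0// mulrS cexpD IH exprS.
Qed.

Lemma cis_bounds t : (`|cos t| <= 1) * (`|sin t| <= 1).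
Proof. by rewrite !ler_norml cos_geN1 cos_le1 sin_geN1 sin_le1. Qed.

End complex_exponential.

Section charfun_real.
Variables (R : realType) (d : nat).
Local Notation V := 'rV[R]_d.

Lemma charfunE (mu : set V -> \bar R) (z : V) : charfun mu z =
  Complex (rint mu setT (fun x => cos (dot z x))) (rint mu setT (fun x => sin (dot z x))).
Proof.
rewrite /charfun /cint; under eq_fun do rewrite [cexp _]cisE.
by congr Complex; congr rint; apply/funext => x; rewrite [cexp _]cisE.
Qed.

Lemma dotDl (x y z : V) : dot (x + y) z = dot x z + dot y z.
Proof. by rewrite /dot -big_split /=; apply: eq_bigr => j _; rewrite mxE mulrDl. Qed.

Lemma dotC (x y : V) : dot x y = dot y x.
Proof. by apply: eq_bigr => j _; rewrite mulrC. Qed.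

Lemma dotDr (x y z : V) : dot z (x + y) = dot z x + dot z y.
Proof. by rewrite dotC dotDl !(dotC _ z). Qed.

Lemma dotZl k (x y : V) : dot (k *: x) y = k * dot x y.
Proof. by rewrite /dot mulr_sumr; apply: eq_bigr => j _; rewrite mxE mulrA. Qed.

Lemma dotZr k (x y : V) : dot x (k *: y) = k * dot x y.
Proof. by rewrite dotC dotZl dotC. Qed.

Lemma dot0l (x : V) : dot 0 x = 0.
Proof. by rewrite -(scale0r (0 : V)) dotZl mul0r. Qed.

Lemma dotNl (x y : V) : dot (- x) y = - dot x y.
Proof. by rewrite -scaleN1r dotZl mulN1r. Qed.

Lemma dotNr (x y : V) : dot x (- y) = - dot x y.
Proof. by rewrite dotC dotNl dotC. Qed.

Lemma measurable_cos_dot (z : V) : measurable_fun setT (fun x : V => cos (dot z x)).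
Proof. by apply: measurableT_comp; [exact: measurable_cos|exact: measurable_dot]. Qed.

Lemma measurable_sin_dot (z : V) : measurable_fun setT (fun x : V => sin (dot z x)).
Proof. by apply: measurableT_comp; [exact: measurable_sin|exact: measurable_dot]. Qed.

End charfun_real.

(** * Characteristic functions determine laws *)

Section indicator_polynomials.
Variable R : realType.

Lemma bernoulli_le (x : R) n : 0 <= x <= 1 -> 1 - n%:R * x <= (1 - x) ^+ n.
Proof.
move=> /andP[x0 x1]; elim: n => [|n IH]; first by rewrite mul0r subr0 expr0.
rewrite exprS; apply: le_trans (ler_wpM2l _ IH); last by rewrite subr_ge0.
have : 0 <= n%:R * x ^+ 2 by rewrite mulr_ge0// sqr_ge0.
rewrite -natr1; lra.
Qed.

Lemma bernoulli_ge (x : R) n : 0 <= x -> 1 + n%:R * x <= (1 + x) ^+ n.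
Proof.
move=> x0; elim: n => [|n IH]; first by rewrite mul0r addr0 expr0.
rewrite exprS; apply: le_trans (ler_wpM2l _ IH); last by rewrite addr_ge0.
have : 0 <= n%:R * x ^+ 2 by rewrite mulr_ge0// sqr_ge0.
rewrite -natr1; lra.
Qed.

(** With [y = (1 - s) / 2] this is [(1 - y ^ n) ^ (2 ^ n)], the polynomials of the
    elementary proof of the Stone-Weierstrass theorem. On [[-1, 1]] they tend to
    the indicator of [0 < s], except at [s = 0] where the limit is [1 / e]. *)
Definition step_poly (n : nat) : {poly R} :=
  (1 - ((1 - 'X) * (2^-1)%:P) ^+ n) ^+ (2 ^ n).

(** These tend to the indicator of [s <> 0], which removes the exceptional point
    of [step_poly]. *)
Definition nonzero_poly (n : nat) : {poly R} := 1 - (1 - 'X ^+ 2) ^+ n.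

Lemma step_poly_bound n (s : R) : -1 <= s <= 1 -> `|(step_poly n).[s]| <= 1.
Proof.
move=> /andP[s1 s2]; rewrite /step_poly !hornerE /=.
set y := (1 - s) * 2^-1; have y0 : 0 <= y by rewrite /y; lra.
have y1 : y <= 1 by rewrite /y; lra.
rewrite ger0_norm ?exprn_ge0 ?exprn_ile1 ?subr_ge0 ?exprn_ile1//.
by rewrite lerBlDr lerDl exprn_ge0.
Qed.

Lemma nonzero_poly_bound n (s : R) : -1 <= s <= 1 -> `|(nonzero_poly n).[s]| <= 1.
Proof.
move=> /andP[s1 s2]; rewrite /nonzero_poly !hornerE /=.
have : 0 <= 1 - s ^+ 2 <= 1 by rewrite expr2; nra.
move=> /andP[y0 y1].
by rewrite ger0_norm ?subr_ge0 ?exprn_ile1// lerBlDr lerDl exprn_ge0.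
Qed.

Lemma cvg_nonzero_poly (s : R) : -1 <= s <= 1 ->
  (nonzero_poly n).[s] @[n --> \oo] --> ((s != 0)%:R : R).
Proof.
move=> /andP[s1 s2]; rewrite /nonzero_poly.
under eq_fun do rewrite !hornerE /=.
have [->|s0] := eqVneq s 0.
  under eq_fun do rewrite expr0n /= subr0 expr1n subrr.
  exact: cvg_cst.
have -> : (~~ false)%:R = 1 - 0 :> R by rewrite subr0.
apply: cvgB; first exact: cvg_cst.
apply: cvg_expr.
have : 0 < s ^+ 2 by rewrite lt_neqAle sqr_ge0 eq_sym expf_neq0.
rewrite ger0_norm; first lra.
by rewrite expr2; nra.
Qed.

(** By the Bernoulli inequality [(1 - y ^ n) ^ (2 ^ n)] is at least
    [1 - (2 y) ^ n], and at most [1 / (1 + (2 y) ^ n)]; this decides the limit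
    on either side of [y = 1/2]. *)
Lemma cvg_step_poly (s : R) : -1 <= s <= 1 -> s != 0 ->
  (step_poly n).[s] @[n --> \oo] --> ((0 < s)%R%:R : R).
Proof.
move=> /andP[s1 s2] s0; rewrite /step_poly.
under eq_fun do rewrite !hornerE /=.
set y := (1 - s) * 2^-1; have y0 : 0 <= y by rewrite /y; lra.
have y1 : y <= 1 by rewrite /y; lra.
have yn n : 0 <= y ^+ n <= 1 by rewrite exprn_ge0// exprn_ile1.
have [sp|sn|] := ltgtP 0 s; last by move/eqP; rewrite eq_sym (negbTE s0).
- apply: (@squeeze_cvgr _ _ _ _ (fun n => 1 - (2 * y) ^+ n) (fun=> 1)).
  + apply: nearW => n; apply/andP; split; last first.
      by rewrite exprn_ile1 ?subr_ge0 ?exprn_ile1// lerBlDr lerDl exprn_ge0.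
    by apply: le_trans (bernoulli_le _ (yn n)); rewrite exprMn natrX.
  + have -> : true%:R = 1 - 0 :> R by rewrite subr0.
    apply: cvgB; first exact: cvg_cst.
    by apply: cvg_expr; rewrite ger0_norm /y; lra.
  + exact: cvg_cst.
- have y2 : 1 < 2 * y by rewrite /y; lra.
  apply: (@squeeze_cvgr _ _ _ _ (fun=> 0) (fun n => ((2 * y)^-1) ^+ n)).
  + apply: nearW => n; apply/andP; split.
      by rewrite exprn_ge0// subr_ge0 exprn_ile1.
    have /andP[yn0 yn1] := yn n.
    have h := bernoulli_ge (2 ^ n) yn0.
    have h0 : (1 - y ^+ n) ^+ (2 ^ n) * (1 + y ^+ n) ^+ (2 ^ n) <= 1.
      rewrite -exprMn; apply: exprn_ile1; first by rewrite mulr_ge0// ?subr_ge0//; lra.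
      by have := sqr_ge0 (y ^+ n); rewrite expr2; nra.
    rewrite exprVn -[leRHS]mul1r ler_pdivlMr ?exprn_gt0//; last by lra.
    apply: le_trans h0; apply: ler_wpM2l; first by rewrite exprn_ge0// subr_ge0.
    by apply: le_trans h; rewrite exprMn natrX lerDr.
  + exact: cvg_cst.
  + apply: cvg_expr; rewrite ger0_norm ?invr_ge0; last by lra.
    by rewrite invf_lt1; lra.
Qed.

End indicator_polynomials.

Section charfun_uniqueness.
Variables (R : realType) (d : nat).
Local Notation V := 'rV[R]_d.
Variables mu nu : probability V R.

(** The bounded functions whose products with all the waves
    [cos (<z, x> + theta)] have the same integrals. Products of two waves being
    sums of waves, the class is stable under multiplication by a wave. *)
Let same (f : V -> R) : Prop :=
  [/\ measurable_fun setT f, exists M : R, forall x, `|f x| <= M &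
    forall z theta, rint mu setT (fun x => f x * cos (dot z x + theta)) =
                    rint nu setT (fun x => f x * cos (dot z x + theta))].

Let wave (z : V) (theta : R) (x : V) := cos (dot z x + theta).

Let measurable_wave z theta : measurable_fun setT (wave z theta).
Proof.
apply: measurableT_comp; first exact: measurable_cos.
by apply: measurable_funD => //; exact: measurable_dot.
Qed.

Let wave_bound z theta x : -1 <= wave z theta x <= 1.
Proof. by rewrite cos_geN1 cos_le1. Qed.

Let int_wave (m : probability V R) (f : V -> R) (M : R) z theta : measurable_fun setT f ->
  (forall x, `|f x| <= M) -> m.-integrable setT (EFin \o (fun x => f x * wave z theta x)).
Proof.
move=> mf fM; apply: (@bounded_integrable _ _ _ m _ M).
  by apply: measurable_funM => //; exact: measurable_wave.
move=> x; rewrite normrM; apply: le_trans (fM x).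
by rewrite ler_piMr// ler_norml wave_bound.
Qed.

Let same_lin f g k : same f -> same g -> same (fun x => f x + k * g x).
Proof.
move=> [mf [M fM] fE] [mg [N gN] gE]; split.
- by apply: measurable_funD => //; exact: measurable_funM.
- exists (M + `|k| * N) => x; rewrite (le_trans (ler_normD _ _))// lerD//.
  by rewrite normrM ler_wpM2l.
move=> z theta.
have E (m : probability V R) :
  rint m setT (fun x => (f x + k * g x) * cos (dot z x + theta)) =
  rint m setT (fun x => f x * wave z theta x) + k * rint m setT (fun x => g x * wave z theta x).
  rewrite -rintZl; last exact: int_wave gN.
  rewrite -rintD; [|exact: int_wave fM|apply: integrable_mulr; exact: int_wave gN].
  by apply: eq_rint => x; rewrite mulrDl mulrA.
by rewrite !E /wave fE gE.
Qed.

(** [2 cos A cos B = cos (A + B) + cos (A - B)]. *)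
Let same_wave f w eta : same f -> same (fun x => f x * wave w eta x).
Proof.
move=> [mf [M fM] fE]; split.
- by apply: measurable_funM => //; exact: measurable_wave.
- exists M => x; rewrite normrM; apply: le_trans (fM x).
  by rewrite ler_piMr// ler_norml wave_bound.
move=> z theta.
have E (m : probability V R) :
  rint m setT (fun x => f x * wave w eta x * cos (dot z x + theta)) =
  2^-1 * rint m setT (fun x => f x * wave (w + z) (eta + theta) x) +
  2^-1 * rint m setT (fun x => f x * wave (w - z) (eta - theta) x).
  rewrite -!rintZl; [|exact: int_wave fM|exact: int_wave fM].
  rewrite -rintD; [|apply: integrable_mulr; exact: int_wave fM..].
  apply: eq_rint => x; rewrite -mulrDr -mulrDr mulrCA -mulrA; congr (_ * _).
  rewrite /wave.
  have -> : dot (w + z) x + (eta + theta) = (dot w x + eta) + (dot z x + theta).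
    rewrite /dot addrACA -big_split /=; congr (_ + _).
    by apply: eq_bigr => j _; rewrite mxE mulrDl.
  have -> : dot (w - z) x + (eta - theta) = (dot w x + eta) - (dot z x + theta).
    rewrite /dot opprD addrACA -sumrB; congr (_ + _).
    by apply: eq_bigr => j _; rewrite !mxE mulrDl mulNr.
  by move: (dot w x + eta) (dot z x + theta) => A B; rewrite cosD cosB; field.
by rewrite !E /wave !fE.
Qed.

Let same_poly f w eta (p : {poly R}) : same f ->
  same (fun x => f x * p.[wave w eta x]).
Proof.
move=> sf; elim/poly_ind: p => [|p c IH].
  under eq_fun do rewrite horner0 mulr0.
  split => //; first by exists 0 => x; rewrite normr0.
  move=> z theta; under [in LHS]eq_fun do rewrite mul0r.
  under [in RHS]eq_fun do rewrite mul0r.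
  by rewrite /rint !integral0.
rewrite (_ : (fun _ => _) = fun x => (f x * p.[wave w eta x]) * wave w eta x + c * f x).
  by apply: same_lin => //; exact: same_wave.
by apply/funext => x; rewrite !hornerE mulrDr mulrA [f x * c]mulrC.
Qed.

Let same_lim (f_ : nat -> V -> R) f (M : R) : (forall n, same (f_ n)) ->
  (forall n x, `|f_ n x| <= M) -> (forall x, f_ n x @[n --> \oo] --> f x) -> same f.
Proof.
move=> sf_ fM cf.
have mf_ n : measurable_fun setT (f_ n) by case: (sf_ n).
have mf : measurable_fun setT f.
  by apply: (measurable_fun_cvg (h := f_)) => // x _; exact: cf.
split=> //.
  by exists M => x; apply: cvg_norm_le (cf x) _ => n; exact: fM.
move=> z theta.
have E (m : probability V R) : rint m setT (fun x => f_ n x * wave z theta x) @[n --> \oo] -->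
   rint m setT (fun x => f x * wave z theta x).
  apply: (@rint_dominated _ _ _ m _ _ (fun=> M)).
  - exact: integrable_cst.
  - by move=> n; apply: measurable_funM => //; exact: measurable_wave.
  - by move=> x; apply: cvgMl; exact: cf.
  - move=> n x; rewrite normrM; apply: le_trans (fM n x).
    by rewrite ler_piMr// ler_norml wave_bound.
have En : (fun n => rint mu setT (fun x => f_ n x * wave z theta x)) =
          (fun n => rint nu setT (fun x => f_ n x * wave z theta x)).
  by apply/funext => n; case: (sf_ n) => _ _ H; exact: H.
by have := E mu; rewrite En => Emu; exact: cvg_unique Emu (E nu).
Qed.

(** Indicators of [0 < cos (<w, x> + eta)] are bounded limits of polynomials in
    the wave. *)
Let same_step f w eta : same f ->
  same (fun x => f x * (0 < wave w eta x)%R%:R).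
Proof.
move=> sf; have [_ [M fM] _] := sf.
have bnd (p : {poly R}) : (forall s, -1 <= s <= 1 -> `|p.[s]| <= 1) -> 
    forall (g : V -> R) x, `|g x| <= M -> `|g x * p.[wave w eta x]| <= M.
  by move=> pb g x gM; rewrite normrM; apply: le_trans gM; rewrite ler_piMr// pb// wave_bound.
have s1 : same (fun x => f x * (wave w eta x != 0)%:R).
  apply: (same_lim (M := M) (fun n => same_poly w eta (nonzero_poly R n) sf)).
    by move=> n x; apply: bnd => // s; exact: nonzero_poly_bound.
  by move=> x; apply: cvgMr; exact: cvg_nonzero_poly (wave_bound _ _ _).
apply: (same_lim (M := M) (fun n => same_poly w eta (step_poly R n) s1)).
  move=> n x; apply: (bnd _ _ (fun x => f x * _)) => [s|]; first exact: step_poly_bound.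
  by case: eqP => _ /=; rewrite ?mulr1// mulr0 normr0 (le_trans _ (fM x)).
move=> x; have [->|w0] := eqVneq (wave w eta x) 0.
  under eq_fun do rewrite /= mulr0 mul0r.
  by rewrite ltxx mulr0; exact: cvg_cst.
under eq_fun do rewrite /= mulr1.
by apply: cvgMr; apply: cvg_step_poly => //; exact: wave_bound.
Qed.

(** For [n] large, depending on [x], the wave [sin ((x_j - c) / (n + 1))] has the
    sign of [x_j - c]. *)
Let same_halfspace f (j : 'I_d) c : same f -> same (fun x => f x * (c < x ord0 j)%R%:R).
Proof.
move=> sf; have [_ [M fM] _] := sf.
pose w n : V := \row_i ((i == j)%:R * n.+1%:R^-1).
pose eta n : R := - (c / n.+1%:R) - pi / 2.
have wE n x : wave (w n) (eta n) x = sin ((x ord0 j - c) / n.+1%:R).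
  rewrite /wave /dot (bigD1 j)//= big1 ?addr0; last first.
    by move=> i /negbTE ij; rewrite mxE ij !mul0r.
  rewrite mxE eqxx mul1r /eta addrA cosB cos_pihalf sin_pihalf mulr0 add0r mulr1.
  by congr sin; field.
apply: (same_lim (M := M) (fun n => same_step (w n) (eta n) sf)).
  by move=> n x; case: ltP => _ /=; rewrite ?mulr1// mulr0 normr0 (le_trans _ (fM x)).
move=> x; apply: cvgMr; apply: cvg_near_cst.
have small : \forall n \near \oo, `|(x ord0 j - c) / n.+1%:R| < pi.
  have : (x ord0 j - c) * harmonic n @[n --> \oo] --> (x ord0 j - c) * 0.
    by apply: cvgMr; exact: cvg_harmonic.
  rewrite mulr0 => /cvgr0_norm_lt; apply; exact: pi_gt0.
near=> n; have : `|(x ord0 j - c) / n.+1%:R| < pi by near: n.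
rewrite wE ltr_norml => /andP[lo hi].
case: (ltgtP c (x ord0 j)) => cx.
- by rewrite sin_gt0_pi// hi divr_gt0// subr_gt0.
- suff -> : (0 < sin ((x ord0 j - c) / n.+1%:R)) = false by [].
  apply/negbTE; rewrite -leNgt -oppr_ge0 -sinN ltW// sin_gt0_pi//.
  by rewrite ltrNl lo andbT oppr_gt0 pmulr_llt0// subr_lt0.
- by rewrite cx subrr mul0r sin0 ltxx.
Unshelve. all: by end_near. Qed.

Hypothesis same_charfun : forall z, charfun mu z = charfun nu z.

Let same_cst : same (fun=> 1).
Proof.
split => //; first by exists 1 => x; rewrite normr1.
move=> z theta.
have E (m : probability V R) : rint m setT (fun x => 1 * cos (dot z x + theta)) =
  cos theta * complex.Re (charfun m z) - sin theta * complex.Im (charfun m z).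
  have i1 : m.-integrable setT (EFin \o (fun x : V => cos (dot z x))).
    apply: (@bounded_integrable _ _ _ m _ 1).
      by apply: measurableT_comp; [exact: measurable_cos|exact: measurable_dot].
    by move=> x; rewrite ler_norml cos_geN1 cos_le1.
  have i2 : m.-integrable setT (EFin \o (fun x : V => sin (dot z x))).
    apply: (@bounded_integrable _ _ _ m _ 1).
      by apply: measurableT_comp; [exact: measurable_sin|exact: measurable_dot].
    by move=> x; rewrite ler_norml sin_geN1 sin_le1.
  rewrite charfunE /= -!rintZl// -rintB; [|exact: integrable_mulr..].
  by apply: eq_rint => x; rewrite mul1r cosD mulrC [sin theta * _]mulrC.
by rewrite !E same_charfun.
Qed.

Let orthant (c : 'I_d -> R) : set V := [set x | forall j, c j < x ord0 j].

Let same_orthant c (s : seq 'I_d) :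
  same (fun x => [forall j in s, c j < x ord0 j]%R%:R).
Proof.
elim: s => [|i s IH].
  rewrite (_ : (fun _ => _) = fun=> 1) //; apply/funext => x.
  by have -> : [forall j in [::], c j < x ord0 j] by apply/forall_inP => j; rewrite in_nil.
suff -> : (fun x : V => [forall j in i :: s, c j < x ord0 j]%R%:R) =
    (fun x => [forall j in s, c j < x ord0 j]%R%:R * (c i < x ord0 i)%R%:R) :> (V -> R).
  exact: same_halfspace.
apply/funext => x; rewrite -natrM mulnb; congr (_%:R : R); congr nat_of_bool.
apply/forall_inP/andP => [h|[/forall_inP h hi] j].
  split; last by apply: h; rewrite mem_head.
  by apply/forall_inP => j js; apply: h; rewrite in_cons js orbT.
by rewrite in_cons => /orP[/eqP->//|]; exact: h.
Qed.

Let measurable_orthant c : measurable (orthant c).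
Proof.
rewrite (_ : orthant c = \bigcap_(j in [set: 'I_d]) [set x : V | c j < x ord0 j]).
  by apply: fin_bigcap_measurable => // j _; apply: measurable_set_lt => //; exact: measurable_coord.
by apply/seteqP; split => [x h j _|x h j]; apply: h.
Qed.

Let eq_orthant c : mu (orthant c) = nu (orthant c).
Proof.
have [_ _ /(_ 0 0)] := same_orthant c (enum 'I_d).
have E (m : probability V R) : (rint m setT (fun x =>
    [forall j in enum 'I_d, c j < x ord0 j]%R%:R * cos (dot 0 x + 0)))%:E = m (orthant c).
  rewrite /rint (eq_integral (fun x => (\1_(orthant c) x)%:E)).
    by rewrite integral_indic// setIT fineK// fin_num_measure.
  move=> x _; rewrite dot0l addr0 cos0 mulr1 indicE; congr (_%:R%:E : \bar R).
  congr nat_of_bool; apply/forall_inP/idP => [h|].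
    by rewrite inE => j; apply: h; rewrite mem_enum.
  by rewrite inE => h j _; exact: h.
by move=> eq_int; rewrite -!E; congr EFin.
Qed.

(** Equality of the characteristic functions puts the constant [1] into the class
    [same]. The class then contains the indicators of half-spaces, and so those
    of the orthants, which form a pi-system generating the Borel sets. *)
Theorem charfun_inj (B : set V) : measurable B -> mu B = nu B.
Proof.
pose G : set (set V) := range orthant.
pose T := g_sigma_algebraType G.
have cover : \bigcup_n orthant (fun=> - n%:R) = setT.
  apply/seteqP; split=> // x _.
  have [n hn] : exists n : nat, forall j, `|x ord0 j| < n%:R.
    exists (Num.truncn (\sum_j `|x ord0 j|)).+1 => j.
    apply: le_lt_trans (truncnS_gt _).
    by rewrite (bigD1 j)//= lerDl sumr_ge0.
  by exists n => // j; have := hn j; rewrite ltr_norml => /andP[].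
apply: (measure_unique G (fun n => orthant (fun=> - n%:R))) => //.
- apply/seteqP; split => [A mA|]; last first.
    apply: smallest_sub; first exact: sigma_algebra_measurable.
    by move=> _ [c _ <-]; exact: measurable_orthant.
  have mid : measurable_fun (setT : set T) (idfun : T -> V).
    apply: measurable_fun_rV => j.
    apply: (measurability _ (RGenOInfty.measurableE R)) => //.
    move=> _ [_ [a ->] <-]; rewrite setTI.
    rewrite (_ : _ @^-1` _ =
      \bigcup_n (orthant (fun i => if i == j then a else - n%:R) : set T)).
      by apply: bigcupT_measurable => n; apply: sub_sigma_algebra; eexists.
    apply/seteqP; split => [x|x [n _ h]]; rewrite /= in_itv /= andbT; last first.
      by have := h j; rewrite eqxx.
    move=> xj; have : (\bigcup_n orthant (fun=> - n%:R)) x by rewrite cover.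
    by move=> [n _ h]; exists n => // i; case: eqP => [->//|_]; exact: h.
  by have := mid measurableT _ mA; rewrite setTI.
- move=> _ _ [c1 _ <-] [c2 _ <-]; exists (fun j => Num.max (c1 j) (c2 j)) => //.
  apply/seteqP; split => [x h|x [h1 h2] j]; last by rewrite gt_max h1 h2.
  by split => j; have := h j; rewrite gt_max => /andP[].
- by move=> n; eexists.
- by move=> _ [c _ <-]; exact: eq_orthant.
- by move=> n; rewrite ltey_eq fin_num_measure.
Qed.

End charfun_uniqueness.

(** * Complex expectations and independence *)

Section complex_integrals.
Context (R : realType) (disp : measure_display) (T : measurableType disp).
Implicit Types F G : T -> R[i].

Definition cmeasurable F :=
  measurable_fun setT (fun x => complex.Re (F x)) /\
  measurable_fun setT (fun x => complex.Im (F x)).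

Definition cbounded F := exists M : R,
  forall x, (`|complex.Re (F x)| <= M) && (`|complex.Im (F x)| <= M).

Lemma cmeasurable_mul F G : cmeasurable F -> cmeasurable G ->
  cmeasurable (fun x => F x * G x).
Proof.
move=> [F1 F2] [G1 G2]; split; under eq_fun do rewrite ?ReM ?ImM.
- by apply: measurable_funB; exact: measurable_funM.
- by apply: measurable_funD; exact: measurable_funM.
Qed.

Lemma cbounded_mul F G : cbounded F -> cbounded G -> cbounded (fun x => F x * G x).
Proof.
move=> [M FM] [N GN]; exists (M * N + M * N) => x.
have /andP[F1 F2] := FM x; have /andP[G1 G2] := GN x.
rewrite ReM ImM; apply/andP; split; apply: le_trans (ler_normD _ _) _;
  by rewrite ?normrN !normrM lerD// ler_pM.
Qed.

Lemma cmeasurable_cst (k : R[i]) : cmeasurable (fun=> k).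
Proof. by split; exact: measurable_cst. Qed.

Lemma cbounded_cst (k : R[i]) : cbounded (fun=> k).
Proof.
exists (Num.max `|complex.Re k| `|complex.Im k|) => x.
by rewrite !le_max !lexx orbT.
Qed.

Lemma cmeasurable_prod (I : Type) (s : seq I) (F : I -> T -> R[i]) :
  (forall i, cmeasurable (F i)) -> cmeasurable (fun x => \prod_(i <- s) F i x).
Proof.
move=> mF; elim: s => [|i s IH].
  by under eq_fun do rewrite big_nil; exact: cmeasurable_cst.
by under eq_fun do rewrite big_cons; exact: cmeasurable_mul.
Qed.

Lemma cbounded_prod (I : Type) (s : seq I) (F : I -> T -> R[i]) :
  (forall i, cbounded (F i)) -> cbounded (fun x => \prod_(i <- s) F i x).
Proof.
move=> mF; elim: s => [|i s IH].
  by under eq_fun do rewrite big_nil; exact: cbounded_cst.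
by under eq_fun do rewrite big_cons; exact: cbounded_mul.
Qed.

Lemma cmeasurable_real (f : T -> R) : measurable_fun setT f ->
  cmeasurable (fun x => real_complex R (f x)).
Proof. by move=> mf; split => //; exact: measurable_cst. Qed.

Lemma cbounded_real (f : T -> R) (M : R) : (forall x, `|f x| <= M) ->
  cbounded (fun x => real_complex R (f x)).
Proof.
by move=> fM; exists M => x /=; rewrite fM normr0 (le_trans _ (fM x)).
Qed.

Lemma cmeasurable_cis (f : T -> R) : measurable_fun setT f ->
  cmeasurable (fun x => cis (f x)).
Proof.
by move=> mf; split; apply: measurableT_comp => //; [exact: measurable_cos|exact: measurable_sin].
Qed.

Lemma cbounded_cis (f : T -> R) : cbounded (fun x => cis (f x)).
Proof. by exists 1 => x; rewrite !cis_bounds. Qed.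

Section on_measure.
Variable mu : {measure set T -> \bar R}.

Definition cintegrable F := mu.-integrable setT (EFin \o (fun x => complex.Re (F x))) /\
  mu.-integrable setT (EFin \o (fun x => complex.Im (F x))).

Lemma cintegrableD F G : cintegrable F -> cintegrable G ->
  cintegrable (fun x => F x + G x).
Proof.
move=> [F1 F2] [G1 G2]; split.
- by under eq_fun do rewrite ReD; exact: integrable_addr.
- by under eq_fun do rewrite ImD; exact: integrable_addr.
Qed.

Lemma cintD F G : cintegrable F -> cintegrable G ->
  cint mu setT (fun x => F x + G x) = cint mu setT F + cint mu setT G.
Proof.
move=> [F1 F2] [G1 G2]; rewrite /cint.
under eq_fun do rewrite ReD; rewrite rintD//.
by under [in X in Complex _ X]eq_fun do rewrite ImD; rewrite rintD.
Qed.

Lemma cintZ (k : R[i]) F : cintegrable F ->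
  cint mu setT (fun x => k * F x) = k * cint mu setT F.
Proof.
move=> [F1 F2]; rewrite /cint; apply: complex_eq; rewrite ?ReM ?ImM /=.
- under eq_fun do rewrite ReM; rewrite rintB ?rintZl//; exact: integrable_mulr.
- under eq_fun do rewrite ImM; rewrite rintD ?rintZl//; exact: integrable_mulr.
Qed.

End on_measure.

Lemma cbounded_integrable (mu : {finite_measure set T -> \bar R}) F :
  cmeasurable F -> cbounded F -> cintegrable mu F.
Proof.
move=> [F1 F2] [M FM]; split; apply: (@bounded_integrable _ _ _ mu _ M) => // x;
  by have /andP[] := FM x.
Qed.

End complex_integrals.

Section independence_products.
Context (R : realType) (disp : measure_display) (T : measurableType disp).
Variable P : probability T R.

(** A random variable [f] whose events satisfy [E[1_A g] = c P(A)] satisfies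
    [E[f g] = c E[f]]: once a constant is added to [g] and [c], both sides are
    integrals against the law of [f] weighted by a nonnegative density. *)
Lemma expectation_factor (f g : T -> R) (c Mf Mg : R) :
  measurable_fun setT f -> (forall x, `|f x| <= Mf) ->
  measurable_fun setT g -> (forall x, `|g x| <= Mg) ->
  (forall B, measurable B -> rint P setT (fun x => \1_(f @^-1` B) x * g x) =
     c * fine (P (f @^-1` B))) ->
  rint P setT (fun x => f x * g x) = c * rint P setT f.
Proof.
move=> mf fM mg gM h; pose K := Mg + `|c|.
have gK x : 0 <= g x + K.
  by have := gM x; rewrite ler_norml => /andP[]; rewrite /K; have := normr_ge0 c; lra.
have cK : 0 <= c + K.
  rewrite /K; have := ler_norm (- c); rewrite normrN.
  by have := le_trans (normr_ge0 _) (gM point); lra.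
have mpre B : measurable B -> measurable (f @^-1` B).
  by move=> mB; rewrite -[X in measurable X]setTI; exact: mf.
have i_f : P.-integrable setT (EFin \o f) by exact: (@bounded_integrable _ _ _ P _ _ mf fM).
have i_g : P.-integrable setT (EFin \o g) by exact: (@bounded_integrable _ _ _ P _ _ mg gM).
have i_fg : P.-integrable setT (EFin \o (fun x => f x * g x)).
  apply: (@bounded_integrable _ _ _ P _ (Mf * Mg)); first exact: measurable_funM.
  by move=> x; rewrite normrM ler_pM.
pose nu (B : set R) := (\int[P]_x (\1_B (f x) * (g x + K))%:E)%E.
have e1 : rint nu setT (fun x => x) = rint P setT (fun x => f x * (g x + K)).
  by apply: integral_weighted_imageR => //; exact: measurable_funD.
have e2 : rint nu setT (fun x => x) = rint P setT (fun x => f x * (c + K)).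
  apply: (integral_weighted_imageR (w := fun=> c + K)) => // B mB; rewrite /nu.
  have i1 : P.-integrable setT (EFin \o (\1_(f @^-1` B) : T -> R)).
    apply: (@bounded_integrable _ _ _ P _ 1); last exact: indic_le1.
    by apply: measurable_indic; exact: mpre.
  have i2 : P.-integrable setT (EFin \o (fun x => \1_(f @^-1` B) x * g x)).
    apply: (@bounded_integrable _ _ _ P _ Mg).
      by apply: measurable_funM => //; apply: measurable_indic; exact: mpre.
    move=> x; rewrite normrM (le_trans _ (gM x))// ler_piMl//.
    exact: indic_le1.
  have key : rint P setT (fun x => \1_B (f x) * (g x + K)) =
      rint P setT (fun x => \1_B (f x) * (c + K)).
    rewrite (eq_rint _ (g := fun x => \1_(f @^-1` B) x * g x + K * \1_(f @^-1` B) x)); last first.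
      by move=> x; rewrite mulrDr (mulrC K).
    rewrite [RHS](eq_rint _ (g := fun x => (c + K) * \1_(f @^-1` B) x)); last first.
      by move=> x; rewrite mulrC.
    rewrite rintD ?rintZl//; last exact: integrable_mulr.
    have -> : rint P setT (\1_(f @^-1` B) : T -> R) = fine (P (f @^-1` B)).
      by rewrite /rint integral_indic ?setIT//; exact: mpre.
    by rewrite [RHS]mulrDl; congr (_ + _); exact: h.
  have fin1 : P.-integrable setT (EFin \o (fun x => \1_B (f x) * (g x + K))).
    suff -> : (fun x => \1_B (f x) * (g x + K)) =
              (fun x => \1_(f @^-1` B) x * g x + K * \1_(f @^-1` B) x).
      by apply: integrable_addr => //; exact: integrable_mulr.
    by apply/funext => x; rewrite mulrDr (mulrC K).
  have fin2 : P.-integrable setT (EFin \o (fun x => \1_B (f x) * (c + K))).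
    suff -> : (fun x => \1_B (f x) * (c + K)) = (fun x => (c + K) * \1_(f @^-1` B) x).
      exact: integrable_mulr.
    by apply/funext => x; rewrite mulrC.
  by rewrite !integral_rint// key.
move: e1; rewrite {}e2.
rewrite (eq_rint _ (g := fun x => (c + K) * f x)); last by move=> x; rewrite mulrC.
rewrite [RHS](eq_rint _ (g := fun x => f x * g x + K * f x)); last first.
  by move=> x; rewrite mulrDr (mulrC K).
rewrite rintZl// rintD// ?rintZl//; last exact: integrable_mulr.
by rewrite mulrDl => /addIr.
Qed.

(** Measurability of both parts with respect to [E], which need not be a
    sigma-algebra: independence is only assumed of systems of events. *)
Definition events_in (E : set (set T)) (F : T -> R[i]) := forall B : set R, measurable B ->
  E ((fun x => complex.Re (F x)) @^-1` B) /\ E ((fun x => complex.Im (F x)) @^-1` B).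

Lemma cexpectation_factor (E : set (set T)) (F G : T -> R[i]) (c : R[i]) :
  events_in E F -> cmeasurable F -> cbounded F -> cmeasurable G -> cbounded G ->
  (forall A, E A -> cint P setT (fun x => real_complex R (\1_A x) * G x) =
     real_complex R (fine (P A)) * c) ->
  cint P setT (fun x => F x * G x) = cint P setT F * c.
Proof.
move=> EF [mF1 mF2] [Mf FM] [mG1 mG2] [Mg GM] h.
have F1 x : `|complex.Re (F x)| <= Mf by have /andP[] := FM x.
have F2 x : `|complex.Im (F x)| <= Mf by have /andP[] := FM x.
have G1 x : `|complex.Re (G x)| <= Mg by have /andP[] := GM x.
have G2 x : `|complex.Im (G x)| <= Mg by have /andP[] := GM x.
have hR A : E A -> rint P setT (fun x => \1_A x * complex.Re (G x)) =
    complex.Re c * fine (P A).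
  move=> EA; have := congr1 (@complex.Re R) (h _ EA); rewrite ReM /= mul0r subr0 mulrC => <-.
  by apply: eq_rint => x; rewrite ReM /= mul0r subr0.
have hI A : E A -> rint P setT (fun x => \1_A x * complex.Im (G x)) =
    complex.Im c * fine (P A).
  move=> EA; have := congr1 (@complex.Im R) (h _ EA); rewrite ImM /= mul0r addr0 mulrC => <-.
  by apply: eq_rint => x; rewrite ImM /= mul0r addr0.
have fac (f g : T -> R) (k : R) : measurable_fun setT f -> (forall x, `|f x| <= Mf) ->
    measurable_fun setT g -> (forall x, `|g x| <= Mg) ->
    (forall B : set R, measurable B -> E (f @^-1` B)) ->
    (forall A, E A -> rint P setT (fun x => \1_A x * g x) = k * fine (P A)) ->
    rint P setT (fun x => f x * g x) = k * rint P setT f.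
  move=> mf fM mg gM Ef hk; apply: (expectation_factor mf fM mg gM) => B mB.
  exact: hk (Ef _ mB).
have int (f g : T -> R) : measurable_fun setT f -> (forall x, `|f x| <= Mf) ->
    measurable_fun setT g -> (forall x, `|g x| <= Mg) ->
    P.-integrable setT (EFin \o (fun x => f x * g x)).
  move=> mf fM mg gM; apply: (@bounded_integrable _ _ _ P _ (Mf * Mg)); first exact: measurable_funM.
  by move=> x; rewrite normrM ler_pM.
rewrite /cint; apply: complex_eq; rewrite ?ReM ?ImM /=.
- under eq_fun do rewrite ReM.
  rewrite rintB; [|exact: int|exact: int].
  rewrite (fac _ _ (complex.Re c))//; last by move=> B /EF[].
  rewrite (fac _ _ (complex.Im c))//; last by move=> B /EF[].
  by rewrite mulrC [complex.Im c * _]mulrC.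
- under eq_fun do rewrite ImM.
  rewrite rintD; [|exact: int|exact: int].
  rewrite (fac _ _ (complex.Im c))//; last by move=> B /EF[].
  rewrite (fac _ _ (complex.Re c))//; last by move=> B /EF[].
  by rewrite mulrC [complex.Re c * _]mulrC.
Qed.

Lemma cint_indic (A : set T) : measurable A ->
  cint P setT (fun x => real_complex R (\1_A x)) = real_complex R (fine (P A)).
Proof.
move=> mA; rewrite /cint /=; congr Complex.
  by rewrite /rint integral_indic// setIT.
by rewrite /rint integral0.
Qed.

(** Events are replaced one at a time by variables: the factorization of
    probabilities is the case where [s] is empty. *)
Lemma independent_expectation_mixed (I : eqType) (E : I -> set (set T)) (F : I -> T -> R[i]) :
  (forall i, E i `<=` measurable) -> independent_systems P E ->
  (forall i, events_in (E i) (F i)) -> (forall i, cmeasurable (F i)) ->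
  (forall i, cbounded (F i)) ->
  forall (s r : seq I) (A : I -> set T), uniq (s ++ r) -> (forall i, i \in r -> E i (A i)) ->
  cint P setT (fun x => real_complex R (\1_(\bigcap_(i in [set` r]) A i) x) *
                        \prod_(i <- s) F i x) =
  (\prod_(i <- s) cint P setT (F i)) *
    real_complex R (\prod_(i <- r) fine (P (A i))).
Proof.
move=> Em indep EF mF bF; elim => [|i s IH] r A.
  move=> ur EA; rewrite big_nil mul1r.
  under eq_fun do rewrite big_nil mulr1.
  have mA : measurable (\bigcap_(i in [set` r]) A i).
    by apply: fin_bigcap_measurable => // i ir; apply: Em; exact: EA.
  rewrite cint_indic// (indep _ _ ur EA); apply: (congr1 (real_complex R)).
  rewrite (@eq_big_seq _ _ _ _ _ _ (fun i => (fine (P (A i)))%:E)); last first.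
    by move=> i ir; rewrite fineK// fin_num_measure//; apply: Em; exact: EA.
  by rewrite prodEFin.
rewrite cat_cons /= mem_cat negb_or => /andP[/andP[nis nir] usr] EA.
rewrite big_cons.
have mA : measurable (\bigcap_(j in [set` r]) A j).
  by apply: fin_bigcap_measurable => // j jr; apply: Em; exact: EA.
pose G x := real_complex R (\1_(\bigcap_(j in [set` r]) A j) x) * \prod_(j <- s) F j x.
have m1 B : measurable B -> measurable_fun setT (\1_B : T -> R).
  by move=> mB; exact: measurable_indic.
rewrite -mulrA -(cexpectation_factor (EF i) (mF i) (bF i) (G := G)).
- by congr cint; apply/funext => x; rewrite big_cons /G mulrCA.
- by apply: cmeasurable_mul; [apply: cmeasurable_real; exact: m1|exact: cmeasurable_prod].
- by apply: cbounded_mul; [apply: (@cbounded_real _ _ _ _ 1); exact: indic_le1|exact: cbounded_prod].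
move=> B EB; pose A' j := if j == i then B else A j.
have A'r j : j \in r -> A' j = A j.
  by move=> jr; rewrite /A'; case: eqP => // ji; rewrite -ji jr in nir.
have usr' : uniq (s ++ i :: r).
  by rewrite -cat1s uniq_catCA /= mem_cat negb_or nis nir.
have := IH (i :: r) A' usr'.
have EA' j : j \in i :: r -> E j (A' j).
  rewrite in_cons /A'; case: eqP => [-> _//|_ /= jr]; exact: EA.
move=> /(_ EA'); rewrite [in X in _ = X -> _]big_cons.
have -> : A' i = B by rewrite /A' eqxx.
rewrite [X in _ = _ * (_ * X)%:C%C -> _](eq_big_seq (fun j => fine (P (A j)))); last by move=> j jr; rewrite A'r.
rewrite rmorphM /= mulrCA => <-.
congr cint; apply/funext => x; rewrite /G mulrA -rmorphM /=; congr (_ * _); apply: (congr1 (real_complex R)).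
suff -> : \bigcap_(j in [set` i :: r]) A' j = B `&` \bigcap_(j in [set` r]) A j.
  by rewrite indicI.
apply/seteqP; split => [y h|y [By rAy] j /=].
  split; first by have := h i; rewrite /A' eqxx; apply; exact: mem_head.
  by move=> j jr; have := h j; rewrite A'r//; apply; rewrite /= in_cons jr orbT.
rewrite in_cons /A'; case: eqP => // _ /= jr; exact: rAy.
Qed.

Lemma independent_expectation (I : eqType) (E : I -> set (set T)) (F : I -> T -> R[i]) :
  (forall i, E i `<=` measurable) -> independent_systems P E ->
  (forall i, events_in (E i) (F i)) -> (forall i, cmeasurable (F i)) ->
  (forall i, cbounded (F i)) -> forall s : seq I, uniq s ->
  cint P setT (fun x => \prod_(i <- s) F i x) = \prod_(i <- s) cint P setT (F i).
Proof.
move=> Em indep EF mF bF s us.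
have := independent_expectation_mixed Em indep EF mF bF (s := s) (r := [::]) (A := fun=> setT).
rewrite cats0 big_nil mulr1 => /(_ us) <- //.
congr cint; apply/funext => x; rewrite (_ : \bigcap_(_ in _) _ = setT) ?indicT ?mul1r//.
by apply/seteqP; split.
Qed.

Lemma events_in_preimage (dW : measure_display) (W : measurableType dW) (X : T -> W)
    (g : W -> R[i]) : cmeasurable g ->
  events_in (g_sigma_algebra_preimage X) (fun x => g (X x)).
Proof.
move=> [g1 g2] B mB; split.
- exists ((fun x => complex.Re (g x)) @^-1` B); last by rewrite setTI.
  by rewrite -[X in measurable X]setTI; exact: g1.
- exists ((fun x => complex.Im (g x)) @^-1` B); last by rewrite setTI.
  by rewrite -[X in measurable X]setTI; exact: g2.
Qed.

Lemma preimage_system_measurable (dW : measure_display) (W : measurableType dW)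
  (X : T -> W) : measurable_fun setT X -> g_sigma_algebra_preimage X `<=` measurable.
Proof. by move=> mX _ [B mB <-]; exact: mX. Qed.

End independence_products.

(** * Trigonometric bounds *)

Section trigonometric_bounds.
Variable R : realType.
Implicit Types a b t : R.

Lemma mean_value_between (f df : R -> R) : (forall x : R, is_derive x 1 f (df x)) ->
  forall t, exists2 c, `|c| <= `|t| & f t - f 0 = df c * t.
Proof.
move=> dfE t.
have cf a b : {within `[a, b], continuous f}.
  apply: continuous_subspaceT => x; apply: differentiable_continuous.
  by apply/derivable1_diffP; exact: ex_derive.
have [t0|/ltW t0] := leP 0 t.
  have [c] := MVT_segment t0 (fun x _ => dfE x) (cf _ _).
  rewrite in_itv /= => /andP[c0 ct]; rewrite subr0 => E; exists c => //.
  by rewrite !ger0_norm.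
have [c] := MVT_segment t0 (fun x _ => dfE x) (cf _ _).
rewrite in_itv /= => /andP[c0 ct] E; exists c; first by rewrite !ler0_norm// lerN2.
by rewrite -[LHS]opprB E sub0r mulrN opprK.
Qed.

Lemma cos_sub1_le t : `|cos t - 1| <= `|t|.
Proof.
have [c _] := mean_value_between (@is_derive_cos R) t.
by rewrite cos0 => ->; rewrite normrM normrN ler_piMl// cis_bounds.
Qed.

Lemma sin_le t : `|sin t| <= `|t|.
Proof.
have [c _] := mean_value_between (@is_derive_sin R) t.
by rewrite sin0 subr0 => ->; rewrite normrM ler_piMl// cis_bounds.
Qed.

Lemma cos_sub1_sq t : `|cos t - 1| <= t ^+ 2.
Proof.
have [c ct] := mean_value_between (@is_derive_cos R) t.
rewrite cos0 => ->; rewrite normrM normrN -real_normK ?num_real// expr2 ler_wpM2r//.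
exact: le_trans (sin_le c) ct.
Qed.

Lemma sin_sub_sq t : `|sin t - t| <= t ^+ 2.
Proof.
have dE (x : R) : is_derive x 1 (fun x => sin x - x) (cos x - 1) by apply: is_deriveB.
have [c ct] := mean_value_between dE t.
rewrite sin0 !subr0 => ->; rewrite normrM -[leRHS]real_normK ?num_real// expr2 ler_wpM2r//.
exact: le_trans (cos_sub1_le c) ct.
Qed.

Lemma cis_lipschitz a b : (`|cos b - cos a| <= 2 * `|b - a|) /\
  (`|sin b - sin a| <= 2 * `|b - a|).
Proof.
have E : b = a + (b - a) by rewrite addrC subrK.
have h x y u v : `|x| <= 1 -> `|y| <= 1 -> `|u| <= `|b - a| -> `|v| <= `|b - a| ->
  `|x * u + y * v| <= 2 * `|b - a|.
  move=> x1 y1 ub vb; rewrite (le_trans (ler_normD _ _))// !normrM.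
  have := ler_pM (normr_ge0 _) (normr_ge0 _) x1 ub.
  by have := ler_pM (normr_ge0 _) (normr_ge0 _) y1 vb; lra.
split.
- rewrite {1}E cosD -addrA [- (_ * _) - _]addrC addrA -[X in _ * _ - X]mulr1 -mulrBr -mulNr.
  by apply: h; rewrite ?normrN ?cis_bounds ?cos_sub1_le ?sin_le.
- rewrite {1}E sinD addrAC -[X in _ * _ - X]mulr1 -mulrBr.
  by apply: h; rewrite ?cis_bounds ?cos_sub1_le ?sin_le.
Qed.

End trigonometric_bounds.

(** * Continuous families of complex roots *)

Section complex_sequences.
Variable R : realType.
Implicit Types (u v : nat -> R[i]) (l : R[i]).

Definition ccvg u l := complex.Re (u n) @[n --> \oo] --> complex.Re l /\
  complex.Im (u n) @[n --> \oo] --> complex.Im l.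

Lemma ccvg_unique u l1 l2 : ccvg u l1 -> ccvg u l2 -> l1 = l2.
Proof.
move=> [r1 i1] [r2 i2]; apply: complex_eq.
- exact: cvg_unique r1 r2.
- exact: cvg_unique i1 i2.
Qed.

Lemma ccvg_mul u v l1 l2 : ccvg u l1 -> ccvg v l2 -> ccvg (fun n => u n * v n) (l1 * l2).
Proof.
move=> [r1 i1] [r2 i2]; split.
- by under eq_fun do rewrite ReM; rewrite ReM; apply: cvgB; exact: cvgM.
- by under eq_fun do rewrite ImM; rewrite ImM; apply: cvgD; exact: cvgM.
Qed.

Lemma ccvg_cst l : ccvg (fun=> l) l.
Proof. by split; exact: cvg_cst. Qed.

Lemma ccvg_cexp u l : ccvg u l -> ccvg (fun n => cexp (u n)) (cexp l).
Proof.
move=> [r1 i1].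
have e1 : expR (complex.Re (u n)) @[n --> \oo] --> expR (complex.Re l).
  by apply: continuous_cvg => //; exact: continuous_expR.
have e2 : cos (complex.Im (u n)) @[n --> \oo] --> cos (complex.Im l).
  by apply: continuous_cvg => //; exact: continuous_cos.
have e3 : sin (complex.Im (u n)) @[n --> \oo] --> sin (complex.Im l).
  by apply: continuous_cvg => //; exact: continuous_sin.
split.
- under eq_fun do rewrite cexpE ReM /= mul0r subr0.
  by rewrite cexpE ReM /= mul0r subr0; exact: cvgM.
- under eq_fun do rewrite cexpE ImM /= mul0r addr0.
  by rewrite cexpE ImM /= mul0r addr0; exact: cvgM.
Qed.

Definition ccontinuous (h : R -> R[i]) :=
  continuous (fun x => complex.Re (h x)) /\ continuous (fun x => complex.Im (h x)).

Lemma ccontinuous_mul g h : ccontinuous g -> ccontinuous h ->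
  ccontinuous (fun x => g x * h x).
Proof.
move=> [r1 i1] [r2 i2]; split => x.
- by under eq_fun do rewrite ReM; apply: cvgB; apply: cvgM;
    [exact: r1|exact: r2|exact: i1|exact: i2].
- by under eq_fun do rewrite ImM; apply: cvgD; apply: cvgM;
    [exact: r1|exact: i2|exact: i1|exact: r2].
Qed.

Lemma ccontinuous_cexp h : ccontinuous h -> ccontinuous (fun x => cexp (h x)).
Proof.
move=> [r1 i1].
have e1 x : expR (complex.Re (h y)) @[y --> x] --> expR (complex.Re (h x)).
  by apply: continuous_cvg; [exact: continuous_expR|exact: r1].
have e2 x : cos (complex.Im (h y)) @[y --> x] --> cos (complex.Im (h x)).
  by apply: continuous_cvg; [exact: continuous_cos|exact: i1].
have e3 x : sin (complex.Im (h y)) @[y --> x] --> sin (complex.Im (h x)).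
  by apply: continuous_cvg; [exact: continuous_sin|exact: i1].
split => x.
- under eq_fun do rewrite cexpE ReM /= mul0r subr0.
  by apply: cvgM; [exact: e1|exact: e2].
- under eq_fun do rewrite cexpE ImM /= mul0r addr0.
  by apply: cvgM; [exact: e1|exact: e3].
Qed.

(** A non-constant continuous function takes infinitely many values, and there
    are only [n] roots of unity of order [n]. *)
Lemma continuous_root_of_unity (h : R -> R[i]) (c : R[i] -> R) n : (0 < n)%N ->
  continuous (fun x => c (h x)) -> (forall x, h x ^+ n = 1) -> c (h 0) = c (h 1).
Proof.
move=> n0 ch hn; apply/eqP/negP => /negP neq.
pose a := Num.min (c (h 0)) (c (h 1)); pose b := Num.max (c (h 0)) (c (h 1)).
have ab : a < b.
  by rewrite /a /b lt_max !gt_min !ltxx /= orbF -neq_lt eq_sym.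
pose v (k : nat) := a + (b - a) * (k%:R / n%:R).
have n0' : 0 < n%:R :> R by rewrite ltr0n.
have vP (k : 'I_n.+1) : exists x, c (h x) = v k.
  have kn : 0 <= (k%:R / n%:R : R) <= 1.
    by rewrite divr_ge0//= ler_pdivrMr// mul1r ler_nat -ltnS.
  have : a <= v k <= b by rewrite /v; move: kn => /andP[k1 k2]; apply/andP; split; nra.
  move=> /(IVT ler01 (continuous_subspaceT ch))[x _ <-]; by exists x.
have [x xP] := choice vP.
have vinj : injective (fun k : 'I_n.+1 => v k).
  move=> k l /addrI /mulfI; rewrite subr_eq0 (gt_eqF ab) => /(_ isT).
  move=> /mulIf; rewrite invr_eq0 (gt_eqF n0') => /(_ isT) /eqP.
  by rewrite eqr_nat => /eqP/val_inj.
pose rs := [seq h (x k) | k <- enum 'I_n.+1].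
have := @max_poly_roots _ ('X^n - 1) rs.
rewrite size_map size_enum_ord size_Xn_sub_1// ltnn => ab1.
suff : false by []; apply: ab1.
- by rewrite -size_poly_eq0 size_Xn_sub_1.
- apply/allP => _ /mapP[k _ ->].
  by rewrite /root !hornerE hn subrr.
- rewrite map_inj_uniq ?enum_uniq// => k l kl; apply: vinj.
  by rewrite -!xP kl.
Qed.

(** The quotient of the two sides is a continuous family of [n]-th roots of unity,
    hence constant. *)
Lemma continuous_root_unique (f chi : R -> R[i]) n : (0 < n)%N ->
  ccontinuous f -> ccontinuous chi -> f 0 = cexp (chi 0) ->
  (forall x, f x ^+ n = cexp (chi x) ^+ n) -> f 1 = cexp (chi 1).
Proof.
move=> n0 cf cchi f0 fn; pose h x := f x * cexp (- chi x).
have inv x : cexp (chi x) * cexp (- chi x) = 1 by rewrite -cexpD subrr cexp0.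
have ch : ccontinuous h.
  apply: ccontinuous_mul => //; apply: ccontinuous_cexp.
  case: cchi => c1 c2; split => x.
  - by under eq_fun do rewrite ReN; apply: cvgN; exact: c1.
  - by under eq_fun do rewrite ImN; apply: cvgN; exact: c2.
have hn x : h x ^+ n = 1 by rewrite exprMn fn -exprMn inv expr1n.
have h01 : h 0 = h 1.
  by apply: complex_eq; apply: continuous_root_of_unity hn => //; case: ch.
have := h01; rewrite /h f0 inv => /(congr1 (fun z => z * cexp (chi 1))).
by rewrite mul1r -mulrA [cexp (- _) * _]mulrC inv mulr1 => ->.
Qed.

End complex_sequences.

(** * Characteristic functions of random vectors *)

Section euclidean_norm.
Variables (R : realType) (d : nat).
Local Notation V := 'rV[R]_d.

Lemma coord_le_enorm (x : V) j : `|x ord0 j| <= enorm x.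
Proof.
rewrite /enorm -sqrtr_sqr ler_sqrt ?sqr_ge0//; last first.
  by rewrite /dot sumr_ge0// => i _; rewrite -expr2 sqr_ge0.
rewrite /dot (bigD1 j)//= -expr2 lerDl sumr_ge0// => i _.
by rewrite -expr2 sqr_ge0.
Qed.

Lemma enorm_ge0 (x : V) : 0 <= enorm x.
Proof. exact: sqrtr_ge0. Qed.

Lemma enormZ k (x : V) : enorm (k *: x) = `|k| * enorm x.
Proof.
by rewrite /enorm dotZl dotZr mulrA -expr2 sqrtrM ?sqr_ge0// sqrtr_sqr.
Qed.

Definition norm1 (z : V) : R := \sum_j `|z ord0 j|.

Lemma norm1_ge0 (z : V) : 0 <= norm1 z.
Proof. exact: sumr_ge0. Qed.

Lemma dot_le (z x : V) : `|dot z x| <= norm1 z * enorm x.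
Proof.
rewrite /dot /norm1 mulr_suml (le_trans (ler_norm_sum _ _ _))//.
by apply: ler_sum => j _; rewrite normrM ler_wpM2l// coord_le_enorm.
Qed.

End euclidean_norm.

Section characteristic_functions.
Context (R : realType) (disp : measure_display) (T : measurableType disp).
Variables (P : probability T R) (d : nat).
Local Notation V := 'rV[R]_d.

Definition cfun (X : T -> V) (z : V) : R[i] := cint P setT (fun w => cis (dot z (X w))).

Lemma measurable_dotl (z : V) (X : T -> V) : measurable_fun setT X ->
  measurable_fun setT (fun w => dot z (X w)).
Proof. by move=> mX; exact: measurable_dot. Qed.

Lemma charfun_law (nu : set V -> \bar R) (X : T -> V) z : measurable_fun setT X ->
  (forall B, measurable B -> nu B = P (X @^-1` B)) -> charfun nu z = cfun X z.
Proof.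
move=> mX nuX; rewrite charfunE /cfun /cint /=.
have nuE B : measurable B -> nu B = (\int[P]_x (\1_B (X x) * 1)%:E)%E.
  move=> mB; under eq_integral do rewrite mulr1.
  transitivity (\int[P]_x (\1_(X @^-1` B) x)%:E)%E; last by [].
  rewrite integral_indic ?setIT//; first exact: nuX.
  by rewrite -[X in measurable X]setTI; exact: mX.
congr Complex; rewrite (integral_weighted_imageR mX _ _ nuE)//.
- by apply: eq_rint => x; rewrite mulr1.
- exact: measurable_cos_dot.
- by apply: eq_rint => x; rewrite mulr1.
- exact: measurable_sin_dot.
Qed.

Lemma cfun_eq_law (X Y : T -> V) z : measurable_fun setT X -> measurable_fun setT Y ->
  (forall B, measurable B -> P (X @^-1` B) = P (Y @^-1` B)) -> cfun X z = cfun Y z.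
Proof.
move=> mX mY XY; pose nu B := P (Y @^-1` B).
by rewrite -(@charfun_law nu _ z mX) -?(@charfun_law nu _ z mY)// => B /XY.
Qed.

Let integrable_wave (f : R -> R) (X : T -> V) (z : V) : measurable_fun setT f ->
  (forall t, `|f t| <= 1) -> measurable_fun setT X ->
  P.-integrable setT (EFin \o (fun w => f (dot z (X w)))).
Proof.
move=> mf f1 mX; apply: (@bounded_integrable _ _ _ P _ 1) => //.
by apply: measurableT_comp => //; exact: measurable_dotl.
Qed.

(** Waves are bounded by [1] and Lipschitz, so the distance between the
    characteristic functions is at most [2 c k + 2 P(|X_n - X| > k)] for every
    [k > 0], where [c] is the [l^1]-norm of [z]. *)
Lemma cfun_cvg_probability (X_ : nat -> T -> V) (X : T -> V) z :
  (forall n, measurable_fun setT (X_ n)) -> measurable_fun setT X ->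
  (forall e : R, 0 < e ->
     \forall n \near \oo, (P [set w | e < enorm (X_ n w - X w)]%R <= e%:E)%E) ->
  ccvg (fun n => cfun (X_ n) z) (cfun X z).
Proof.
move=> mX_ mX cP; set c := norm1 z.
have c0 : 0 <= c by exact: norm1_ge0.
have main (f : R -> R) : measurable_fun setT f -> (forall t, `|f t| <= 1) ->
    (forall a b, `|f b - f a| <= 2 * `|b - a|) ->
    rint P setT (fun w => f (dot z (X_ n w))) @[n --> \oo] -->
    rint P setT (fun w => f (dot z (X w))).
  move=> mf f1 lf; apply/cvgrPdist_le => e e0.
  pose k := e / (2 * c + 2).
  have k0 : 0 < k by rewrite /k divr_gt0//; lra.
  have ke : 2 * c * k + 2 * k = e by rewrite /k; field; lra.
  near=> n.
  have Pn : (P [set w | k < enorm (X_ n w - X w)]%R <= k%:E)%E by near: n; exact: cP.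
  set D := [set w | _] in Pn.
  have mD : measurable D.
    by apply: measurable_set_lt => //; apply: measurable_enorm; exact: measurable_vecB.
  have i1 := integrable_wave z mf f1 mX.
  have i2 := integrable_wave z mf f1 (mX_ n).
  rewrite -rintB//; set g := fun w => _ - _.
  have ig : P.-integrable setT (EFin \o g).
    rewrite /g; under eq_fun do rewrite -mulN1r.
    by apply: integrable_addr => //; exact: integrable_mulr.
  have iD : P.-integrable setT (EFin \o (\1_D : T -> R)).
    by apply: (@bounded_integrable _ _ _ P _ 1); [exact: measurable_indic|exact: indic_le1].
  apply: (le_trans (le_normr_Rintegral measurableT ig)).
  apply: (@le_trans _ _ (rint P setT (fun w => 2 * c * k + 2 * \1_D w))).
    apply: le_Rintegral => //.
    - exact: integrable_norm.
    - by apply: integrable_addr; [exact: integrable_cst|exact: integrable_mulr].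
    move=> w _; rewrite /g; have [Dw|Dw] := pselect (D w).
      rewrite indicE mem_set// mulr1 (le_trans (ler_normB _ _))//.
      have := f1 (dot z (X w)); have := f1 (dot z (X_ n w)).
      have : 0 <= 2 * c * k by apply: mulr_ge0; [exact: mulr_ge0|exact: ltW].
      lra.
    rewrite indicE memNset// mulr0 addr0 (le_trans (lf _ _))// -mulrA ler_wpM2l//.
    rewrite -dotNr -dotDr (le_trans (dot_le _ _))// ler_wpM2l//.
    by rewrite leNgt; apply/negP => kX; apply: Dw; rewrite /D /= -opprB -scaleN1r enormZ normrN1 mul1r.
  rewrite rintD; [|exact: integrable_cst|exact: integrable_mulr].
  rewrite [X in _ + X]rintZl//.
  rewrite rint_cst.
  have -> : rint P setT (\1_D : T -> R) = fine (P D) by rewrite /rint integral_indic// setIT.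
  rewrite -[leRHS]ke lerD2l ler_wpM2l// -lee_fin fineK//.
  exact: fin_num_measure.
split; rewrite /cfun /cint /=; apply: main.
- exact: measurable_cos.
- by move=> t; rewrite cis_bounds.
- by move=> a b; case: (cis_lipschitz a b).
- exact: measurable_sin.
- by move=> t; rewrite cis_bounds.
- by move=> a b; case: (cis_lipschitz a b).
Unshelve. all: by end_near. Qed.

Lemma cfun_ccontinuous (X : T -> V) (z : V) : measurable_fun setT X ->
  ccontinuous (fun r => cfun X (r *: z)).
Proof.
move=> mX.
have main (f : R -> R) : measurable_fun setT f -> (forall t, `|f t| <= 1) ->
    continuous f -> continuous (fun r : R => rint P setT (fun w => f (dot (r *: z) (X w)))).
  move=> mf f1 cf r.
  have := @continuity_under_integral R _ _ P (fun r w => f (dot (r *: z) (X w))) setT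
    measurableT (r - 1) (r + 1) _ _ (fun=> 1) _ _ r.
  apply.
  - by move=> x _; exact: integrable_wave.
  - apply: aeW => w _ x _.
    under eq_fun do rewrite dotZl.
    apply: (@continuous_comp _ _ _ (fun x : R => x * dot z (X w)) f); last exact: cf.
    by apply: cvgMl; exact: cvg_id.
  - exact: integrable_cst.
  - by move=> x _; apply: aeW => w _; exact: f1.
  - by rewrite inE /= in_itv /=; apply/andP; split; lra.
split; apply: main.
- exact: measurable_cos.
- by move=> t; rewrite cis_bounds.
- exact: continuous_cos.
- exact: measurable_sin.
- by move=> t; rewrite cis_bounds.
- exact: continuous_sin.
Qed.
End characteristic_functions.

(** * Levy processes and stochastic integrals *)

Section levy_characteristic_functions.
Context (R : realType) (disp : measure_display) (T : measurableType disp).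
Variables (P : probability T R) (d : nat).
Local Notation V := 'rV[R]_d.
Variable Z : R -> {RV P >-> V}.
Hypothesis levyZ : is_levy Z.

Lemma cis_sum (I : Type) (s : seq I) (F : I -> R) :
  cis (\sum_(i <- s) F i) = \prod_(i <- s) cis (F i).
Proof. by elim: s => [|i s IH]; rewrite ?big_nil ?cis0// !big_cons cisD IH. Qed.

Lemma cfun_increment s t z : 0 <= s -> s <= t ->
  cfun P (fun w => Z t w - Z s w) z = cfun P (Z (t - s)) z.
Proof.
move=> s0 st; apply: cfun_eq_law => // [|B mB]; first exact: measurable_vecB.
have := levy_station levyZ s0 _ mB; rewrite -subr_ge0 in st => /(_ _ st).
by rewrite addrC subrK.
Qed.

Lemma levy_increments_cfun (s : nat -> R) (z : nat -> V) n : 0 <= s 0%N ->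
  {homo s : i j / (i <= j)%N >-> i <= j} ->
  cint P setT (fun w => cis (\sum_(k < n) dot (z k) (Z (s k.+1) w - Z (s k) w))) =
  \prod_(k < n) cfun P (Z (s k.+1 - s k)) (z k).
Proof.
move=> s0 ns; under eq_fun do rewrite cis_sum.
have inc k : measurable_fun setT (fun w => Z (s k.+1) w - Z (s k) w) by exact: measurable_vecB.
pose F (k : 'I_n) w := cis (dot (z k) (Z (s k.+1) w - Z (s k) w)).
rewrite (independent_expectation (F := F) _ (levy_indep levyZ (n := n) s0 ns)).
- by apply: eq_bigr => k _; rewrite -cfun_increment// ?ns// (le_trans s0)// ns.
- by move=> k; apply: preimage_system_measurable; exact: inc.
- move=> k; have mg : cmeasurable (fun x : V => cis (dot (z k) x)).
    by apply: cmeasurable_cis; exact: measurable_dot.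
  exact: (events_in_preimage _ mg).
- by move=> k; apply: cmeasurable_cis; exact: measurable_dotl.
- by move=> k; exact: cbounded_cis.
- exact: index_enum_uniq.
Qed.

(** The [n] increments over consecutive intervals of length [t] are independent
    with the law of [Z_t], and their sum telescopes. *)
Lemma levy_cfunM n t z : 0 <= t -> cfun P (Z (n%:R * t)) z = cfun P (Z t) z ^+ n.
Proof.
move=> t0; have nt0 k : 0 <= k%:R * t by exact: mulr_ge0.
rewrite -[n%:R * t]subr0 -cfun_increment//.
have s0 : 0 <= (0%N)%:R * t by rewrite mul0r.
have ns : {homo (fun k : nat => k%:R * t) : i j / (i <= j)%N >-> i <= j}.
  by move=> i j ij; rewrite ler_wpM2r// ler_nat.
have := levy_increments_cfun (fun=> z) n s0 ns.
rewrite (eq_bigr (fun=> cfun P (Z t) z)); last first.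
  by move=> k _; rewrite -mulrBl -natrB// subSnn mul1r.
rewrite prodr_const card_ord => <-; rewrite /cfun; congr cint.
apply/funext => w; congr cis.
transitivity (dot z (\sum_(k < n) (Z (k.+1%:R * t) w - Z (k%:R * t) w))).
  rewrite -(big_mkord predT (fun k => Z (k.+1%:R * t) w - Z (k%:R * t) w)).
  by rewrite (telescope_sumr (fun k => Z (k%:R * t) w))// mul0r.
rewrite [RHS](eq_bigr (fun k : 'I_n => dot z (Z (k.+1%:R * t) w - Z (k%:R * t) w)))//.
by elim/big_ind2 : _ => //= [|x1 x2 y1 y2 <- <-]; rewrite ?dotDr// dotC dot0l.
Qed.

Lemma levy_cfun_cvg (t_ : nat -> R) (t : R) z : (forall n, 0 <= t_ n) -> 0 <= t ->
  t_ n @[n --> \oo] --> t -> ccvg (fun n => cfun P (Z (t_ n)) z) (cfun P (Z t) z).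
Proof.
move=> t_0 t0 ct; apply: cfun_cvg_probability => // e e0.
have := levy_stoch_cont levyZ t0 e0.
have cw : t_ n @[n --> \oo] --> within [set s | 0 <= s] (nbhs t).
  move=> A wA; have nA : \forall n \near \oo, 0 <= t_ n -> A (t_ n) := ct _ wA.
  by apply: filterS nA => n /(_ (t_0 n)).
move=> /(cvg_comp _ _ cw) h.
have : \forall n \near \oo, (P [set w | e < enorm (Z (t_ n) w - Z t w)]%R < e%:E)%E.
  apply: (h [set x | (x < e%:E)%E]); apply: open_nbhs_nbhs; split; last by rewrite /= lte_fin.
  exact: open_ereal_lt_ereal.
by apply: filterS => n /ltW.
Qed.

Lemma cfun_at0 (X : T -> V) : cfun P X 0 = 1.
Proof.
rewrite /cfun; under eq_fun do rewrite dot0l cis0.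
by rewrite /cint /= !rint_cst.
Qed.

(** The characteristic functions of a Levy process form a semigroup in time,
    continuous by stochastic continuity; the branch of the logarithm is fixed
    by continuity in the frequency. *)
Lemma levy_cfun_exponent (psi : V -> R[i]) : psi 0 = 0 ->
  (forall z, ccontinuous (fun r => psi (r *: z))) ->
  (forall z, cfun P (Z 1) z = cexp (psi z)) ->
  forall t z, 0 <= t -> cfun P (Z t) z = cexp (real_complex R t * psi z).
Proof.
move=> psi0 cpsi Z1.
have ratio n z : cfun P (Z n.+1%:R^-1) z = cexp (real_complex R n.+1%:R^-1 * psi z).
  have := @continuous_root_unique R (fun r => cfun P (Z n.+1%:R^-1) (r *: z))
    (fun r => real_complex R n.+1%:R^-1 * psi (r *: z)) n.+1 isT.
  rewrite !scale1r; apply.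
  - exact: cfun_ccontinuous.
  - apply: (ccontinuous_mul (g := fun=> real_complex R n.+1%:R^-1)); last exact: cpsi.
    by split => x; exact: cvg_cst.
  - by rewrite !scale0r psi0 mulr0 cexp0 cfun_at0.
  - move=> r; rewrite -levy_cfunM// mulfV// Z1 -cexpMn; congr cexp.
    rewrite -mulrnAl -rmorphMn /= -[_ *+ n.+1]mulr_natl mulfV//.
    by rewrite rmorph1 mul1r.
move=> t z t0.
pose t_ n := (Num.truncn (n.+1%:R * t))%:R * n.+1%:R^-1 : R.
have t_0 n : 0 <= t_ n by rewrite mulr_ge0.
have ct : t_ n @[n --> \oo] --> t.
  have low : t - harmonic n @[n --> \oo] --> t.
    rewrite -[X in _ --> X]subr0; apply: cvgB; [exact: cvg_cst|exact: cvg_harmonic].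
  apply: (squeeze_cvgr _ low (cvg_cst t)); apply: nearW => n.
  have n0 : 0 < n.+1%:R :> R by [].
  have := truncn_itv (mulr_ge0 (ltW n0) t0) => /andP[t1 t2].
  rewrite /t_ ler_pdivrMr// [t * _]mulrC t1 andbT /harmonic lerBlDr.
  rewrite -[X in _ + X]mul1r -mulrDl ler_pdivlMr// [t * _]mulrC.
  by rewrite natr1; exact: ltW.
have c1 := levy_cfun_cvg z t_0 t0 ct.
apply: (ccvg_unique c1); under eq_fun do rewrite /t_ levy_cfunM// ratio -cexpMn.
apply: ccvg_cexp; under eq_fun do rewrite -mulrnAl -rmorphMn /= -[_ *+ Num.truncn _]mulr_natl.
apply: ccvg_mul; last exact: ccvg_cst.
by split => //=; exact: cvg_cst.
Qed.

(** The sums that define the stochastic integral converge in probability. Their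
    increments are independent, so their characteristic functions are
    exponentials of Riemann sums of [psi (f s *: z)]. *)
Lemma stochastic_integral_cfun (psi : V -> R[i]) (f : R -> R) (t : R) (I : T -> V) J z :
  psi 0 = 0 -> (forall z, ccontinuous (fun r => psi (r *: z))) ->
  (forall z, cfun P (Z 1) z = cexp (psi z)) ->
  measurable_fun setT I -> 0 < t -> is_stoch_integral f Z 0 t I ->
  ccvg (fun n => \sum_(k < n.+1) real_complex R (t / n.+1%:R) *
          psi (f (k%:R * (t / n.+1%:R)) *: z)) J ->
  cfun P I z = cexp J.
Proof.
move=> psi0 cpsi Z1 mI t0 hI cJ.
pose s n (k : nat) := k%:R * (t / n.+1%:R).
have h0 n : 0 < t / n.+1%:R by rewrite divr_gt0.
pose S n w := \sum_(k < n.+1) f (s n k) *: (Z (s n k.+1) w - Z (s n k) w).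
have mS n : measurable_fun setT (S n).
  apply: measurable_vec_sum => k.
  by apply: measurable_vecZ => //; exact: measurable_vecB.
have cS : ccvg (fun n => cfun P (S n) z) (cfun P I z).
  apply: cfun_cvg_probability => // e e0.
  have [delta d0 hd] := hI e e0.
  have : t * harmonic n @[n --> \oo] --> t * 0 by apply: cvgMr; exact: cvg_harmonic.
  rewrite mulr0 => /cvgr0_norm_lt /(_ _ d0); apply: filterS => n.
  rewrite gtr0_norm; last exact: h0.
  move=> hn; apply: (hd n.+1 (s n)) => [||k _].
  - by rewrite /s mul0r.
  - by rewrite /s mulrC divfK.
  - have -> : s n k.+1 = s n k + t / n.+1%:R by rewrite /s -[k.+1%:R]natr1 mulrDl mul1r.
    by rewrite lerDl ltrD2l hn (ltW (h0 n)).
apply: (ccvg_unique cS).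
under eq_fun => n.
  rewrite (_ : cfun P (S n) z = cexp (\sum_(k < n.+1) real_complex R (t / n.+1%:R) *
          psi (f (k%:R * (t / n.+1%:R)) *: z))); first over.
  have s0 : 0 <= s n 0%N by rewrite /s mul0r.
  have ns : {homo s n : i j / (i <= j)%N >-> i <= j}.
    by move=> i j ij; rewrite ler_wpM2r ?ler_nat// ltW.
  have := levy_increments_cfun (fun k => f (s n k) *: z) n.+1 s0 ns.
  rewrite cexp_sum (eq_bigr (fun k : 'I_n.+1 => cexp (real_complex R (t / n.+1%:R) *
          psi (f (k%:R * (t / n.+1%:R)) *: z)))).
    move=> <-; rewrite /cfun; congr cint; apply/funext => w; congr cis.
    rewrite /S; elim/big_ind2 : _ => [||k _]; first by rewrite dotC dot0l.
      by move=> x1 x2 y1 y2 <- <-; rewrite dotDr.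
    by rewrite dotZr dotZl.
  move=> k _; rewrite (levy_cfun_exponent psi0)//.
    by rewrite /s -mulrBl -natrB// subSnn mul1r.
  by rewrite subr_ge0 ns.
exact: ccvg_cexp.
Qed.

End levy_characteristic_functions.

(** * Measures on the half-line and the exponential flow *)

Section positive_half_line.
Variable R : realType.
Local Notation leb := (@lebesgue_measure R).

(** The intervals [ ]a, b] ] with [0 < a] and the measurable subsets of
    [ ]-oo, 0] ] form a pi-system that generates the Borel sets and exhausts the
    line by sets of finite measure. *)
Lemma positive_measure_unique (m1 m2 : {measure set R -> \bar R}) :
  m1 [set u : R | u <= 0] = 0%E -> m2 [set u : R | u <= 0] = 0%E ->
  (forall a b : R, 0 < a -> a <= b -> m1 `]a, b]%classic = m2 `]a, b]%classic) ->
  (forall a b : R, 0 < a -> a <= b -> (m1 `]a, b]%classic < +oo)%E) ->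
  forall A, measurable A -> m1 A = m2 A.
Proof.
move=> m10 m20 m12 m1oo A mA.
pose N : set R := [set u | u <= 0].
have mN : measurable N by apply: measurable_set_le.
pose G : set (set R) := [set B : set R | (exists a b : R, 0 < a /\ B = `]a, b]%classic) \/
                                 (measurable B /\ B `<=` N)].
pose g (n : nat) : set R := if n is k.+1 then `]k.+1%:R^-1, k.+1%:R]%classic else N.
have Gm : G `<=` measurable by move=> B [[a [b [_ ->]]]|[]].
have n0 k : 0 < k.+1%:R^-1 :> R by rewrite invr_gt0.
have itv_empty (a b : R) : b <= a -> `]a, b]%classic = set0 :> set R.
  by move=> ba; rewrite set_itv_ge// bnd_simp -leNgt.
have kle k : k.+1%:R^-1 <= k.+1%:R :> R.
  by rewrite (@le_trans _ _ 1)// ?invf_le1// ler1n.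
have eqN B : measurable B -> B `<=` N -> m1 B = 0%E /\ m2 B = 0%E.
  move=> mB BN; split; apply/eqP; rewrite eq_le measure_ge0 andbT.
  - by rewrite -m10; apply: le_measure; rewrite ?inE.
  - by rewrite -m20; apply: le_measure; rewrite ?inE.
apply: (measure_unique G g) => //.
- apply/seteqP; split; last by apply: smallest_sub => //; exact: sigma_algebra_measurable.
  apply: smallest_sub; first exact: smallest_sigma_algebra.
  move=> _ [[a b] _ <-] /=.
  rewrite (_ : `]a, b]%classic = (`]a, b]%classic `&` N) `|`
      \bigcup_k `]Num.max a k.+1%:R^-1, b]%classic).
    have [sU0 _ sUb] := smallest_sigma_algebra setT G.
    rewrite -bigcup2E; refine (sUb _ _) => -[|[|k]] /=.
    + apply: sub_sigma_algebra; right; split; [exact: measurableI|by move=> x []].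
    + refine (sUb _ _) => k; apply: sub_sigma_algebra; left; exists (Num.max a k.+1%:R^-1), b.
      by rewrite lt_max n0 orbT.
    + exact: sU0.
  apply/seteqP; split => [x|x [[]//|[k _]]]; rewrite /= !in_itv /=.
    move=> /andP[ax xb]; have [x0|x0] := leP x 0; [left|right].
      by rewrite ax xb.
    have [k kx] : exists k : nat, k.+1%:R^-1 < x.
      by have [k _ /(_ k (leqnn k))] := near_infty_natSinv_lt (PosNum x0); exists k.
    by exists k => //; rewrite /= in_itv /= gt_max ax kx.
  by rewrite gt_max => /andP[/andP[-> _] ->].
- move=> B C [[a [b [a0 ->]]]|[mB BN]] [[c [e [c0 ->]]]|[mC CN]].
  + left; exists (Num.max a c), (Num.min b e); split; first by rewrite lt_max a0.
    apply/seteqP; split => x /=; rewrite !in_itv /= gt_max le_min.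
      by move=> [/andP[-> ->] /andP[-> ->]].
    by move=> /andP[/andP[-> ->] /andP[-> ->]].
  + right; split; first exact: measurableI.
    by move=> x [_ /CN].
  + right; split; first exact: measurableI.
    by move=> x [/BN].
  + right; split; first exact: measurableI.
    by move=> x [/BN].
- move=> [|k] /=; first by right; split.
  by left; exists k.+1%:R^-1, k.+1%:R; rewrite n0.
- apply/seteqP; split=> // x _; have [x0|x0] := leP x 0; first by exists 0%N.
  have [k kx] : exists k : nat, k.+1%:R^-1 < x.
    by have [k _ /(_ k (leqnn k))] := near_infty_natSinv_lt (PosNum x0); exists k.
  pose j := maxn k (Num.truncn x); exists j.+1 => //; rewrite /= in_itv /=; apply/andP; split.
    by apply: le_lt_trans kx; rewrite lef_pV2 ?posrE// ler_nat ltnS leq_maxl.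
  by apply: ltW; apply: lt_le_trans (truncnS_gt x) _; rewrite ler_nat ltnS leq_maxr.
- move=> B [[a [b [a0 ->]]]|[mB BN]]; last by have [-> ->] := eqN B mB BN.
  have [ab|/ltW ba] := leP a b; first exact: m12.
  by rewrite itv_empty// !measure0.
- move=> [|k] /=; first by rewrite m10.
  exact: m1oo.
Qed.

End positive_half_line.

Section logarithmic_scale.
Variable R : realType.
Local Notation leb := (@lebesgue_measure R).

Lemma integral_powRN1 (a b : R) : 0 < a -> a <= b ->
  (\int[leb]_(v in `]a, b]) (v `^ (-1))%:E = (ln b - ln a)%:E)%E.
Proof.
move=> a0; rewrite le_eqVlt => /predU1P[->|ab].
  by rewrite set_itvoc0 integral_set0 subrr.
have pos v : v \in `]a, b[ -> 0 < v by rewrite in_itv /= => /andP[/(lt_trans a0)].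
rewrite integral_itv_obnd_cbnd; last first.
  by apply/measurable_EFinP; apply: measurable_funTS; exact: measurable_powR.
have cln x : 0 < x -> {for x, continuous (@ln R)} by move=> x0; exact: continuous_ln.
rewrite (@continuous_FTC2 _ _ (@ln R)) ?EFinB//.
- apply: derivable_within_continuous => x; rewrite in_itv /= => /andP[/(lt_le_trans a0) x0 _].
  by apply: derivable_powR; rewrite in_itv /= x0.
- split.
  + by move=> x /pos x0; apply: ex_derive; exact: is_derive1_ln.
  + by apply: cvg_at_right_filter; apply: cln.
  + by apply: cvg_at_left_filter; apply: cln; exact: lt_trans ab.
- move=> x /pos x0; rewrite derive1E; have [_ ->] := is_derive1_ln x0.
  by rewrite powR_inv1// ltW.
Qed.

(** In logarithmic scale the flow is an affine map with slope [lambda], so both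
    sides give [ln b - ln a] to an interval [ ]a, b] ]. *)
Lemma exponential_flow_measure (u lambda t : R) : 0 < u -> 0 < lambda ->
  forall B : set R, measurable B ->
  (\int[leb]_s (\1_B (u * expR (- (lambda * (t - s)))) * lambda)%:E =
   \int[leb]_v (\1_B v * (v `^ (-1) * (0 < v)%R%:R))%:E)%E.
Proof.
move=> u0 l0 B mB; pose phi s := u * expR (- (lambda * (t - s))).
have mphi : measurable_fun setT phi.
  apply: measurable_funM => //; apply: measurableT_comp => //.
  apply: measurableT_comp => //; apply: measurable_funM => //.
  by apply: measurable_funB.
have mw : measurable_fun setT (fun v : R => v `^ (-1) * (0 < v)%R%:R).
  apply: measurable_funM; first exact: measurable_powR.
  by apply: measurableT_comp => //; exact: measurable_fun_ltr.
have [m1 m1E] := weighted_image_exists leb (w := fun=> lambda) mphi (measurable_cst _) (fun=> ltW l0).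
have w0 (v : R) : 0 <= v `^ (-1) * (0 < v)%R%:R by rewrite mulr_ge0// powR_ge0.
have [m2 m2E] := weighted_image_exists leb (@measurable_id _ R setT) mw w0.
rewrite -m1E// -[RHS]m2E//.
have phi0 s : 0 < phi s by rewrite mulr_gt0// expR_gt0.
have v1 (a b : R) : 0 < a -> a <= b -> m1 `]a, b]%classic = (ln b - ln a)%:E.
  move=> a0 ab; rewrite m1E//.
  have b0 := lt_le_trans a0 ab.
  have E s : \1_(`]a, b]%classic) (phi s) =
      \1_(`](t + (ln a - ln u) / lambda), (t + (ln b - ln u) / lambda)]%classic) s :> R.
    rewrite !indicE; congr (_%:R); congr nat_of_bool.
    rewrite !mem_setE !in_itv /= -[a in LHS]lnK ?posrE// -[b in LHS]lnK ?posrE// /phi.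
    rewrite -[u in LHS]lnK ?posrE// -expRD ltr_expR ler_expR.
    congr andb.
      by rewrite -ltrBrDl ltr_pdivrMr//; apply/idP/idP; lra.
    by rewrite -lerBlDl ler_pdivlMr//; apply/idP/idP; lra.
  under eq_integral do rewrite E EFinM muleC.
  rewrite ge0_integralZl//; last 2 first.
  - by apply/measurable_EFinP; exact: measurable_indic.
  - by rewrite lee_fin ltW.
  rewrite integral_indic// setIT.
  rewrite [X in (_ * X)%E](_ : _ = ((ln b - ln a) / lambda)%:E).
    by rewrite -EFinM; congr EFin; field; rewrite gt_eqF.
  rewrite [LHS](lebesgue_measure_itv `]_, _]) /= lte_fin.
  case: ltP => [_|].
    by rewrite -EFinB; congr EFin; ring.
  rewrite lerD2l ler_pM2r ?invr_gt0// lerD2r ler_ln ?posrE// => ba.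
  by have -> : b = a; [apply/le_anti; rewrite ab ba|rewrite subrr mul0r].
apply: positive_measure_unique => //.
- rewrite m1E; last exact: measurable_set_le.
  apply: integral0_eq => s _; rewrite indicE memNset ?mul0r//.
  by rewrite /= leNgt phi0.
- rewrite m2E; last exact: measurable_set_le.
  apply: integral0_eq => v _; rewrite indicE; have [v0|v0] := leP v 0.
    by rewrite !mulr0.
  by rewrite memNset ?mul0r//= leNgt v0.
- move=> a b a0 ab; rewrite v1// m2E// -integral_powRN1// [in LHS]integral_mkcond.
  apply: eq_integral => v _; rewrite patchE indicE; case: ifPn => vab; last by rewrite mul0r.
  move: vab; rewrite mem_setE in_itv /= => /andP[av _].
  by rewrite (lt_trans a0 av) mul1r mulr1.
- by move=> a b a0 ab; rewrite v1// ltry.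
Qed.

End logarithmic_scale.

(** * The radial quantile *)

Section quantile.
Variables (R : realType) (d : nat) (alpha : R).
Local Notation V := 'rV[R]_d.
Local Notation leb := (@lebesgue_measure R).
Variable q : V -> R -> R.
Hypothesis alpha0 : 0 < alpha.
Hypothesis q_borel : measurable_fun (sphere `*` `]0, +oo[ : set (V * R))
  (fun p : V * R => q p.1 p.2).
Hypothesis q01 : forall xi u, sphere xi -> 0 < u -> 0 <= q xi u <= 1.
Hypothesis q_nonincr : forall xi u v, sphere xi -> 0 < u -> u <= v -> q xi v <= q xi u.

Definition polar_set : set (V * R) := sphere `*` `]0, +oo[.

Lemma polar_setE (p : V * R) : polar_set p <-> sphere p.1 /\ 0 < p.2.
Proof. by rewrite /polar_set /= in_itv /= andbT. Qed.

Lemma measurable_polar_set : measurable polar_set.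
Proof. by apply: measurableX => //; exact: measurable_sphere. Qed.

Lemma measurable_polar_restrict (f : V * R -> R) :
  measurable_fun polar_set f -> measurable_fun setT (f \_ polar_set).
Proof. by move=> mf; apply/(measurable_restrictT _ measurable_polar_set). Qed.

(** The mass that the radial part [d rho(xi, .)] of the Levy measure of the
    background driving process leaves beyond [v]. *)
Definition tail (xi : V) (v : R) : R := v `^ (- alpha) * q xi v.

Lemma tail_ge0 xi v : sphere xi -> 0 < v -> 0 <= tail xi v.
Proof. by move=> sxi v0; rewrite mulr_ge0 ?powR_ge0//; case/andP: (q01 sxi v0). Qed.

Lemma tail_le xi v : sphere xi -> 0 < v -> tail xi v <= v `^ (- alpha).
Proof. by move=> sxi v0; rewrite ler_piMr ?powR_ge0//; case/andP: (q01 sxi v0). Qed.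

Lemma powRN_nonincr (r v w : R) : 0 <= r -> 0 < v -> v <= w -> w `^ (- r) <= v `^ (- r).
Proof.
move=> r0 v0 vw; have w0 := lt_le_trans v0 vw.
by rewrite !powRN lef_pV2 ?posrE ?powR_gt0// ge0_ler_powR// nnegrE ltW.
Qed.

Lemma tail_nonincr xi v w : sphere xi -> 0 < v -> v <= w -> tail xi w <= tail xi v.
Proof.
move=> sxi v0 vw; have w0 := lt_le_trans v0 vw.
apply: ler_pM; rewrite ?powR_ge0//; first by case/andP: (q01 sxi w0).
- exact: powRN_nonincr (ltW alpha0) v0 vw.
- exact: q_nonincr.
Qed.

(** The generalized inverse of the tail. Where [x] exceeds the whole mass the set
    is empty and its supremum is [0] by convention; these levels [x] produce no
    jump and are discarded later by the weight [0 < radius]. *)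
Definition quantile (xi : V) (x : R) : R := sup [set v | 0 < v /\ x < tail xi v].

Let tail_ub xi x v : sphere xi -> 0 < x -> 0 < v -> x < tail xi v ->
  v <= x `^ (- alpha^-1).
Proof.
move=> sxi x0 v0 xv; have xv' := lt_le_trans xv (tail_le sxi v0).
have := powRN_nonincr (r := alpha^-1) _ x0 (ltW xv').
rewrite -powRrM mulrNN mulfV ?gt_eqF// powRr1 ?(ltW v0)//.
by apply; rewrite invr_ge0 ltW.
Qed.

(** The tail need be neither continuous nor strictly decreasing, so the
    comparison with [v] is only decided beyond [v]. *)
Lemma quantile_gtP xi x v : sphere xi -> 0 < x -> 0 <= v ->
  v < quantile xi x <-> exists2 w, v < w & x < tail xi w.
Proof.
move=> sxi x0 v0; split=> [vq|[w vw xw]].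
  have [w [w0 xw] vw] : exists2 w, [set v | 0 < v /\ x < tail xi v] w & v < w.
    apply/sup_gt => //; apply/set0P/negP => /eqP E.
    by move: vq; rewrite /quantile E sup0 ltNge v0.
  by exists w.
have w0 := le_lt_trans v0 vw.
apply: (lt_le_trans vw); apply: ub_le_sup; last by split.
by exists (x `^ (- alpha^-1)) => u [u0 xu]; exact: tail_ub xu.
Qed.

Lemma quantile_ge0 xi x : sphere xi -> 0 < x -> 0 <= quantile xi x.
Proof.
move=> sxi x0; rewrite leNgt; apply/negP => neg.
have [E|/set0P[v [v0 xv]]] := eqVneq [set v | 0 < v /\ x < tail xi v] set0.
  by move: neg; rewrite /quantile E sup0 ltxx.
have : v <= quantile xi x.
  apply: ub_le_sup; last by split.
  by exists (x `^ (- alpha^-1)) => u [u0 xu]; exact: tail_ub xu.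
by move=> /(lt_le_trans v0)/ltW; rewrite leNgt neg.
Qed.

Lemma quantile_le xi x : sphere xi -> 0 < x -> quantile xi x <= x `^ (- alpha^-1).
Proof.
move=> sxi x0; rewrite leNgt; apply/negP => lt.
have [w lw xw] := (quantile_gtP sxi x0 (powR_ge0 _ _)).1 lt.
have := tail_ub sxi x0 (le_lt_trans (powR_ge0 _ _) lw) xw; by rewrite leNgt lw.
Qed.

Lemma lt_quantile xi x v : sphere xi -> 0 < x -> 0 < v -> v < quantile xi x ->
  x < tail xi v.
Proof.
move=> sxi x0 v0 /(quantile_gtP sxi x0 (ltW v0))[w vw xw].
exact: lt_le_trans xw (tail_nonincr sxi v0 (ltW vw)).
Qed.

Lemma quantile_le_tail xi x v : sphere xi -> 0 < x -> 0 < v -> quantile xi x < v ->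
  tail xi v <= x.
Proof.
move=> sxi x0 v0 qv; rewrite leNgt; apply/negP => xv.
have : v <= quantile xi x.
  apply: ub_le_sup; last by split.
  by exists (x `^ (- alpha^-1)) => u [u0 xu]; exact: tail_ub xu.
by rewrite leNgt qv.
Qed.

(** Extended by [0], so that integrals over the polar parameters can be taken over
    the whole product space. *)
Definition radius : V * R -> R := (fun p => quantile p.1 p.2) \_ polar_set.

Lemma radiusE p : polar_set p -> radius p = quantile p.1 p.2.
Proof. by move=> Sp; rewrite /radius patchE mem_set. Qed.

Lemma radius_out p : ~ polar_set p -> radius p = 0.
Proof. by move=> Sp; rewrite /radius patchE memNset. Qed.

Lemma radius_ge0 p : 0 <= radius p.
Proof.
have [Sp|Sp] := pselect (polar_set p); last by rewrite radius_out.
by rewrite radiusE//; have [s1 p2] := (polar_setE p).1 Sp; exact: quantile_ge0.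
Qed.

Definition tail0 : V * R -> R := (fun p => tail p.1 p.2) \_ polar_set.

Lemma tail0E xi v : sphere xi -> 0 < v -> tail0 (xi, v) = tail xi v.
Proof. by move=> sxi v0; rewrite /tail0 patchE mem_set//; apply/polar_setE. Qed.

Lemma measurable_tail0 : measurable_fun setT tail0.
Proof.
apply: measurable_polar_restrict; apply: measurable_funM => //.
apply: (measurableT_comp (f := fun v => v `^ (- alpha))); first exact: measurable_powR.
by apply: measurable_funTS; exact: measurable_snd.
Qed.

(** The tail is nonincreasing, so the radius exceeds [v] as soon as [x] is below
    the tail at some [v + 1 / (n + 1)]: a countable union. *)
Lemma measurable_radius : measurable_fun setT radius.
Proof.
apply: (measurability _ (RGenOInfty.measurableE R)) => //.
move=> _ [_ [v ->] <-]; rewrite setTI.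
have [v0|v0] := leP 0 v; last first.
  rewrite (_ : _ @^-1` _ = setT)//; apply/seteqP; split => // p _.
  by rewrite /= in_itv /= andbT (lt_le_trans v0)// radius_ge0.
pose c n : R := v + n.+1%:R^-1.
have c0 n : 0 < c n by rewrite ltr_wpDl// invr_gt0.
rewrite (_ : _ @^-1` _ =
    \bigcup_n (polar_set `&` [set p | p.2 < tail0 (p.1, c n)])).
  apply: bigcupT_measurable => n; apply: measurableI; first exact: measurable_polar_set.
  apply: measurable_set_lt; first exact: measurable_snd.
  apply: (measurableT_comp measurable_tail0).
  by apply: measurable_fun_pair; [exact: measurable_fst|exact: measurable_cst].
apply/seteqP; split => [p|p [n _ [Sp]]]; rewrite /= in_itv /= andbT.
  have [Sp|Sp] := pselect (polar_set p); last by rewrite radius_out// ltNge v0.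
  have [s1 p2] := (polar_setE p).1 Sp.
  rewrite radiusE// => /(quantile_gtP s1 p2 v0)[w vw xw].
  have [n nw] : exists n : nat, n.+1%:R^-1 < w - v.
    have wv : 0 < w - v by rewrite subr_gt0.
    by have [k _ /(_ k (leqnn k))] := near_infty_natSinv_lt (PosNum wv); exists k.
  exists n => //; split => //=; rewrite tail0E//.
  apply: lt_le_trans xw (tail_nonincr s1 (c0 n) _).
  by rewrite /c -lerBrDl ltW.
have [s1 p2] := (polar_setE p).1 Sp.
rewrite tail0E// radiusE// => xc; apply/(quantile_gtP s1 p2 v0).
by exists (c n) => //; rewrite ltrDl invr_gt0.
Qed.

(** The generalized inverse of the tail transports Lebesgue measure to the
    radial Stieltjes measure. *)
Lemma stieltjes_quantile xi : sphere xi -> forall A, measurable A ->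
  stieltjes (rho alpha q xi) A =
  (\int[lebesgue_measure]_x (\1_A (radius (xi, x)) * (0 < radius (xi, x))%R%:R)%:E)%E.
Proof.
move=> sxi A mA.
have mr : measurable_fun setT (fun x => radius (xi, x)).
  by apply: (measurableT_comp measurable_radius); exact: measurable_fun_pair.
have mw : measurable_fun setT (fun x => (0 < radius (xi, x))%R%:R : R).
  by apply: measurableT_comp => //; exact: measurable_fun_ltr.
have [m mE] := weighted_image_exists (@lebesgue_measure R) mr mw (fun x => ler0n _ _).
(* The right limit of the tail at [a]. *)
pose R_ (a : R) : R := sup (tail xi @` `]a, +oo[%classic).
have ub (a : R) : 0 < a -> has_ubound (tail xi @` `]a, +oo[%classic).
  move=> a0; exists (tail xi a) => _ [w + <-]; rewrite /= in_itv /= andbT => aw.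
  exact: tail_nonincr sxi a0 (ltW aw).
have R_P (a x : R) : 0 < a -> x < R_ a <-> exists2 w, a < w & x < tail xi w.
  move=> a0; split => [xR|[w aw xw]].
    have [_ [w + <-] xw] : exists2 y, (tail xi @` `]a, +oo[%classic) y & x < y.
      apply: sup_gt => //; exists (tail xi (a + 1)), (a + 1) => //.
      by rewrite /= in_itv /= andbT ltrDl.
    by rewrite /= in_itv /= andbT => aw; exists w.
  apply: lt_le_trans xw _; apply: ub_le_sup; first exact: ub.
  by exists w => //; rewrite /= in_itv /= aw.
have R_0 (a : R) : 0 < a -> 0 <= R_ a.
  move=> a0; apply: le_trans (tail_ge0 sxi (ltr_pwDr ltr01 (ltW a0))) _.
  apply: ub_le_sup; first exact: ub.
  by exists (a + 1) => //; rewrite /= in_itv /= andbT ltrDl.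
have limR (a : R) : 0 < a -> lim (rho alpha q xi u @[u --> a^'+]) = - R_ a.
  move=> a0; apply/cvg_lim => //; apply: cvgN.
  apply: (@nonincreasing_at_right_cvgr _ (tail xi) a +oo%O) => //.
    move=> x y; rewrite !in_itv /= !andbT => ax ay xy.
    exact: tail_nonincr sxi (lt_trans a0 ax) xy.
  exact: ub.
have spec_m : stieltjes_spec (rho alpha q xi) m.
  split.
    rewrite mE; last exact: measurable_set_le.
    apply: integral0_eq => x _; rewrite indicE; case: ltP => r0; last by rewrite mulr0.
    by rewrite memNset ?mul0r//= leNgt r0.
  move=> a b a0 ab; have b0 := lt_le_trans a0 ab.
  rewrite mE// !limR// opprK addrC.
  (* The levels whose quantile lies in [ ]a, b] ]: only positive levels count, hence
     an interval open on the left when [R_ b = 0]. *)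
  pose I := Interval (BSide (0 < R_ b)%R (R_ b)) (BLeft (R_ a)).
  transitivity (\int[leb]_x (\1_[set` I] x)%:E)%E.
    apply: eq_integral => x _; congr EFin; rewrite !indicE !mem_setE.
    have [x0|x0] := ltP 0 x; last first.
      rewrite radius_out; last by move/polar_setE => -[_ /=]; rewrite ltNge x0.
      rewrite ltxx mulr0; suff -> : (x \in I) = false by [].
      apply/negbTE/negP; rewrite itv_boundlr => /andP[+ _].
      by have [Rb0|Rb0] := ltP 0 (R_ b); rewrite bnd_simp; [lra|have := R_0 _ b0; lra].
    have Sx : polar_set (xi, x) by apply/polar_setE.
    rewrite radiusE//=.
    have E (c : R) : 0 < c -> (c < quantile xi x) = (x < R_ c).
      move=> c0; apply/idP/idP => [/(quantile_gtP sxi x0 (ltW c0))/(R_P _ _ c0)//|].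
      by move=> /(R_P _ _ c0)/(quantile_gtP sxi x0 (ltW c0)).
    rewrite [quantile xi x \in _]in_itv /= E// [quantile xi x <= b]leNgt E// itv_boundlr.
    have -> : (BSide (0 < R_ b)%R (R_ b) <= BLeft x)%O = ~~ (x < R_ b).
      by have [Rb0|Rb0] := ltP 0 (R_ b); rewrite bnd_simp -?leNgt//; have := R_0 _ b0; lra.
    rewrite bnd_simp andbC; have [xRa|xRa] := ltP x (R_ a); last by rewrite andbF mul0r.
    rewrite (lt_trans a0) ?mulr1// E//.
  have RbRa : R_ b <= R_ a.
    rewrite leNgt; apply/negP => /(R_P _ _ b0)[w bw].
    apply/negP; rewrite -leNgt; apply: ub_le_sup; first exact: ub.
    by exists w => //; rewrite /= in_itv /= (le_lt_trans ab bw).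
  rewrite integral_indic// setIT /I.
  have len (c : bool) :
      leb [set` Interval (BSide c (R_ b)) (BLeft (R_ a))] = (R_ a - R_ b)%:E.
    rewrite lebesgue_measure_itv /= lte_fin.
    case: ltP => [_|RaRb]; first by rewrite EFinB.
    by have -> : R_ a = R_ b; [apply/le_anti; rewrite RaRb|rewrite subrr].
  exact: len.
(* The measure chosen by [stieltjes] satisfies the same specification. *)
rewrite -mE//; rewrite /stieltjes; case: pselect => [ex|]; last by case; exists m.
case: cid => m' spec' /=; case: spec_m spec' => [m0 mI] [m'0 m'I].
apply: positive_measure_unique => //.
- by move=> a b a0 ab; rewrite mI// m'I.
- by move=> a b a0 ab; rewrite m'I// ltry.
Qed.

End quantile.

(** * Polar coordinates *)

Section product_measure.
Context (d1 d2 : measure_display) (T1 : measurableType d1) (T2 : measurableType d2).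
Variable R : realType.
Variable m1 : {sigma_finite_measure set T1 -> \bar R}.
Variable m2 : {sigma_finite_measure set T2 -> \bar R}.
Let product : {measure set (T1 * T2) -> \bar R} := (m1 \x m2)%E.

Let product_sigma_finite : sigma_finite setT product.
Proof.
have /sigma_finiteP[F [TF ndF Foo]] := sigma_finiteT m1.
have /sigma_finiteP[G [TG ndG Goo]] := sigma_finiteT m2.
exists (fun n => F n `*` G n).
  rewrite -setXTT TF TG predeqE => -[x y]; split.
    move=> [/= [n _ Fnx] [k _ Gky]]; exists (maxn n k) => //; split.
    - by move: x Fnx; exact/subsetPset/ndF/leq_maxl.
    - by move: y Gky; exact/subsetPset/ndG/leq_maxr.
  by move=> [n _ []/= ? ?]; split; exists n.
move=> k; have [? ?] := Foo k; have [? ?] := Goo k.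
split; first exact: measurableX.
have -> : product (F k `*` G k) = (m1 (F k) * m2 (G k))%E by exact: product_measure1E.
by rewrite lte_mul_pinfty// ge0_fin_numE.
Qed.

(** The product packaged as a sigma-finite measure, so that products iterate. *)
Definition sf_product : {sigma_finite_measure set (T1 * T2)%type -> \bar R} :=
  let H := Measure_isSigmaFinite.Build _ _ _ product product_sigma_finite in
  HB.pack (Measure.sort product) H.

Variable f : T1 * T2 -> R.
Hypothesis mf : measurable_fun setT f.

Lemma sf_tonelli : (forall p, 0 <= f p) ->
  (\int[sf_product]_p (f p)%:E = \int[m1]_x \int[m2]_y (f (x, y))%:E)%E.
Proof.
move=> f0; apply: (fubini_tonelli1 (m1 := m1) (m2 := m2)).
- exact/measurable_EFinP.
- by move=> p; rewrite lee_fin.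
Qed.

Lemma sf_tonelli_swap : (forall p, 0 <= f p) ->
  (\int[m1]_x \int[m2]_y (f (x, y))%:E = \int[m2]_y \int[m1]_x (f (x, y))%:E)%E.
Proof.
move=> f0; apply: (fubini_tonelli (m1 := m1) (m2 := m2) (fun p => (f p)%:E)).
- exact/measurable_EFinP.
- by move=> p; rewrite lee_fin.
Qed.

Lemma sf_tonelli_measurable : (forall p, 0 <= f p) ->
  measurable_fun setT (fun x => \int[m2]_y (f (x, y))%:E)%E.
Proof.
move=> f0; apply: (measurable_fun_fubini_tonelli_F (m2 := m2) (fun p => (f p)%:E)).
- exact/measurable_EFinP.
- by move=> p; rewrite lee_fin.
Qed.

Hypothesis fi : sf_product.-integrable setT (EFin \o f).

Lemma sf_fubini_integrable1 : m1.-integrable setT (fun x => \int[m2]_y (f (x, y))%:E)%E.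
Proof. exact: (integrable_fubini_F (m1 := m1) (m2 := m2) (f := fun p => (f p)%:E)). Qed.

Lemma sf_fubini1 : (\int[sf_product]_p (f p)%:E = \int[m1]_x \int[m2]_y (f (x, y))%:E)%E.
Proof.
by apply/esym; apply: (integral12_prod_meas1 (m1 := m1) (m2 := m2) (f := fun p => (f p)%:E)).
Qed.

Lemma sf_fubini2 : (\int[sf_product]_p (f p)%:E = \int[m2]_y \int[m1]_x (f (x, y))%:E)%E.
Proof.
by apply/esym; apply: (integral21_prod_meas1 (m1 := m1) (m2 := m2) (f := fun p => (f p)%:E)).
Qed.

End product_measure.

Section polar_coordinates.
Variables (R : realType) (d : nat) (alpha : R).
Local Notation V := 'rV[R]_d.
Local Notation leb := (@lebesgue_measure R).
Variable sigma : {finite_measure set V -> \bar R}.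
Variable q : V -> R -> R.
Hypothesis alpha0 : 0 < alpha.
Hypothesis q_borel : measurable_fun (sphere `*` `]0, +oo[ : set (V * R))
  (fun p : V * R => q p.1 p.2).
Hypothesis q01 : forall xi u, sphere xi -> 0 < u -> 0 <= q xi u <= 1.
Hypothesis q_nonincr : forall xi u v, sphere xi -> 0 < u -> u <= v -> q xi v <= q xi u.
Local Notation polar_set := (@polar_set R d).

(** Lebesgue measure on the second factor is taken on the whole line; densities
    and radii vanish off the set of genuine polar coordinates. *)
Definition polar_measure := sf_product sigma leb.
Local Notation mu := polar_measure.
Local Notation radius := (radius alpha q).

Lemma polar_tonelli (f : V * R -> R) : measurable_fun setT f -> (forall p, 0 <= f p) ->
  (\int[mu]_p (f p)%:E = \int[sigma]_xi \int[leb]_u (f (xi, u))%:E)%E.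
Proof. by move=> mf f0; apply: (@sf_tonelli _ _ _ _ R sigma leb f). Qed.

Lemma polar_integral (f : V * R -> R) : measurable_fun polar_set f ->
  (forall p, polar_set p -> 0 <= f p) ->
  (\int[sigma]_(xi in sphere) \int[leb]_(u in `]0%R, +oo[) (f (xi, u))%:E =
   \int[mu]_p ((f \_ polar_set) p)%:E)%E.
Proof.
move=> mf f0; rewrite polar_tonelli; last 2 first.
- exact: measurable_polar_restrict.
- by move=> p; rewrite patchE; case: ifPn => // /set_mem; exact: f0.
rewrite [LHS]integral_mkcond; apply: eq_integral => xi _.
rewrite patchE; case: ifPn => [/set_mem sxi|xiS].
  rewrite [LHS]integral_mkcond; apply: eq_integral => u _.
  rewrite !patchE; case: ifPn => [/set_mem u0|u0].
    by rewrite mem_set.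
  rewrite memNset// => -[_ /=] u0'; move: u0; rewrite mem_setE => /negP; exact.
rewrite integral0_eq// => u _; rewrite patchE memNset//; move=> -[sxi _].
by move: xiS; rewrite mem_set.
Qed.

Definition polar_point (p : V * R) : V := p.2 *: p.1.

Lemma measurable_polar_point : measurable_fun setT polar_point.
Proof. by apply: measurable_vecZ; [exact: measurable_snd|exact: measurable_fst]. Qed.

Definition ts_density : V * R -> R :=
  (fun p => p.2 `^ (- 1 - alpha) * q p.1 p.2) \_ polar_set.

Lemma measurable_powR_snd (r : R) : measurable_fun polar_set (fun p : V * R => p.2 `^ r).
Proof.
apply: (measurableT_comp (f := fun v : R => v `^ r)); first exact: measurable_powR.
by apply: measurable_funTS; exact: measurable_snd.
Qed.

Lemma measurable_ts_density : measurable_fun setT ts_density.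
Proof.
apply: measurable_polar_restrict; apply: measurable_funM => //.
exact: measurable_powR_snd.
Qed.

Lemma ts_density_ge0 p : 0 <= ts_density p.
Proof.
rewrite /ts_density patchE; case: ifPn => // /set_mem/polar_setE[s1 p2].
by rewrite mulr_ge0 ?powR_ge0//; case/andP: (q01 s1 p2).
Qed.

Lemma TS_levyE B : measurable B -> TS_levy alpha sigma q B =
  (\int[mu]_p (\1_B (polar_point p) * ts_density p)%:E)%E.
Proof.
move=> mB; rewrite /TS_levy.
rewrite (polar_integral (f := fun p =>
  \1_B (polar_point p) * (p.2 `^ (- 1 - alpha) * q p.1 p.2))).
- apply: eq_integral => p _; congr EFin; rewrite /ts_density !patchE.
  by case: ifPn => //; rewrite mulr0.
- apply: measurable_funM; last first.
    by apply: measurable_funM => //; exact: measurable_powR_snd.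
  apply: measurable_funTS; apply: measurableT_comp measurable_polar_point.
  exact: measurable_indic.
- move=> p /polar_setE[s1 p2]; rewrite !mulr_ge0 ?powR_ge0//.
  by case/andP: (q01 s1 p2).
Qed.

Section jumps.
Variables (lambda t : R).
Hypothesis lambda0 : 0 < lambda.
Hypothesis t0 : 0 < t.
Local Notation T := (lambda * t).
Local Notation q_drop := (q_drop q lambda t).

Definition jump_density : V * R -> R :=
  (fun p => q_drop p.1 p.2 * p.2 `^ (- 1 - alpha)) \_ polar_set.

Let expT1 : 1 <= expR T.
Proof. by rewrite -expR0 ler_expR mulr_ge0// ltW. Qed.

Let dilate (p : V * R) : V * R := (p.1, p.2 * expR T).

Let dilate_polar p : polar_set p -> polar_set (dilate p).
Proof. by move=> /polar_setE[s1 p2]; apply/polar_setE; rewrite /= mulr_gt0 ?expR_gt0. Qed.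

Lemma measurable_q_dilate :
  measurable_fun polar_set (fun p : V * R => q p.1 (p.2 * expR T)).
Proof.
apply: (measurable_comp (F := polar_set) (f := fun p => q p.1 p.2) (g := dilate)) => //.
- exact: measurable_polar_set.
- by move=> _ [p Sp <-]; exact: dilate_polar.
- apply: measurable_funTS; apply: measurable_fun_pair; first exact: measurable_fst.
  by apply: measurable_funM; [exact: measurable_snd|exact: measurable_cst].
Qed.

Lemma measurable_q_drop : measurable_fun polar_set (fun p : V * R => q_drop p.1 p.2).
Proof. by apply: measurable_funB => //; exact: measurable_q_dilate. Qed.

Lemma measurable_jump_density : measurable_fun setT jump_density.
Proof.
apply: measurable_polar_restrict; apply: measurable_funM; first exact: measurable_q_drop.
exact: measurable_powR_snd.
Qed.

Lemma q_drop_ge0 xi u : sphere xi -> 0 < u -> 0 <= q_drop xi u.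
Proof. by move=> sxi u0; rewrite subr_ge0 q_nonincr// ler_peMr// ltW. Qed.

Lemma jump_density_ge0 p : 0 <= jump_density p.
Proof.
rewrite /jump_density patchE; case: ifPn => // /set_mem/polar_setE[s1 p2].
by rewrite mulr_ge0 ?powR_ge0// q_drop_ge0.
Qed.

Lemma jump_massE : jump_mass alpha sigma q lambda t = (\int[mu]_p (jump_density p)%:E)%E.
Proof.
rewrite /jump_mass (polar_integral (f := fun p => q_drop p.1 p.2 * p.2 `^ (- 1 - alpha)))//.
- by apply: measurable_funM; [exact: measurable_q_drop|exact: measurable_powR_snd].
- by move=> p /polar_setE[s1 p2]; rewrite mulr_ge0 ?powR_ge0// q_drop_ge0.
Qed.

Lemma jump_lawE B : measurable B -> jump_law alpha sigma q lambda t B =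
  ((fine (jump_mass alpha sigma q lambda t))^-1%:E *
   \int[mu]_p (\1_B (polar_point p) * jump_density p)%:E)%E.
Proof.
move=> mB; rewrite /jump_law /jump_polar_law; congr (_ * _)%E.
rewrite (polar_integral (f := fun p =>
  \1_B (polar_point p) * (q_drop p.1 p.2 * p.2 `^ (- 1 - alpha)))).
- apply: eq_integral => p _; congr EFin; rewrite /jump_density !patchE.
  by case: ifPn => //; rewrite mulr0.
- apply: measurable_funM; last first.
    by apply: measurable_funM; [exact: measurable_q_drop|exact: measurable_powR_snd].
  apply: measurable_funTS; apply: measurableT_comp measurable_polar_point.
  exact: measurable_indic.
- move=> p /polar_setE[s1 p2]; rewrite !mulr_ge0 ?powR_ge0//.
  exact: q_drop_ge0.
Qed.

End jumps.

(** Here the second coordinate of [p] is not a distance but a level of the tail,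
    which [stieltjes_quantile] turns into a distance. *)
Definition bdlp_point (p : V * R) : V := radius p *: p.1.

Lemma measurable_bdlp_point : measurable_fun setT bdlp_point.
Proof.
by apply: measurable_vecZ; [exact: measurable_radius|exact: measurable_fst].
Qed.

Definition bdlp_weight (p : V * R) : R := (0 < radius p)%R%:R.

Lemma measurable_bdlp_weight : measurable_fun setT bdlp_weight.
Proof.
apply: measurableT_comp => //; apply: measurable_fun_ltr => //.
exact: measurable_radius.
Qed.

Lemma bdlp_weight_ge0 p : 0 <= bdlp_weight p. Proof. exact: ler0n. Qed.

(** Apply [stieltjes_quantile] in each direction: the level [x] is distributed
    according to Lebesgue measure whatever the direction, which replaces the
    family of Stieltjes measures by one product measure. *)
Lemma bdlp_levyE B : measurable B -> bdlp_levy alpha sigma q B =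
  (\int[mu]_p (\1_B (bdlp_point p) * bdlp_weight p)%:E)%E.
Proof.
move=> mB; rewrite (polar_tonelli (f := fun p => \1_B (bdlp_point p) * bdlp_weight p)); last 2 first.
- apply: measurable_funM; last exact: measurable_bdlp_weight.
  by apply: measurableT_comp measurable_bdlp_point; exact: measurable_indic.
- by move=> p; rewrite mulr_ge0// bdlp_weight_ge0.
rewrite /bdlp_levy [LHS]integral_mkcond; apply: eq_integral => xi _.
rewrite patchE; case: ifPn => [/set_mem sxi|xiS]; last first.
  rewrite integral0_eq// => x _; rewrite /bdlp_weight radius_out ?ltxx ?mulr0//.
  by move=> [sxi _]; move: xiS; rewrite mem_set.
have mA : measurable [set u : R | B (u *: xi)].
  have : measurable_fun setT (fun u : R => u *: xi).
    by apply: measurable_vecZ; [exact: measurable_id|exact: measurable_cst].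
  by move/(_ measurableT B mB); rewrite setTI.
have -> : (\int[stieltjes (rho alpha q xi)]_(u in `]0%R, +oo[) (\1_B (u *: xi))%:E)%E =
    stieltjes (rho alpha q xi) ([set u : R | B (u *: xi)] `&` `]0, +oo[%classic).
  by rewrite -integral_indic.
rewrite stieltjes_quantile//; last exact: measurableI.
apply: eq_integral => x _; congr EFin; rewrite /bdlp_point /bdlp_weight /=.
have [r0|] := ltP 0 (radius (xi, x)); last by rewrite !mulr0.
congr (_ * _); rewrite !indicE; congr (_ %:R); congr nat_of_bool.
apply/idP/idP => /set_mem => [[Br _]|Br]; apply/mem_set => //.
by split => //; rewrite /= in_itv /= r0.
Qed.

End polar_coordinates.

(** * The Levy measure moved along the flow *)

Section lebesgue_points.
Variable R : realType.
Local Notation leb := (@lebesgue_measure R).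

Lemma eq_integral_off_two_points (f g : R -> R) (a b : R) :
  measurable_fun setT f -> measurable_fun setT g ->
  (forall v, v != a -> v != b -> f v = g v) ->
  (\int[leb]_v (f v)%:E = \int[leb]_v (g v)%:E)%E.
Proof.
move=> mf mg fg; apply: ae_eq_integral => //; try exact/measurable_EFinP.
exists ([set a] `|` [set b]); split.
- by apply: measurableU; exact: measurable_set1.
- apply/eqP; rewrite eq_le measure_ge0 andbT.
  apply: le_trans (measureU2 _ _ _) _; try exact: measurable_set1.
  by rewrite -[leRHS]adde0; apply: leeD; rewrite le_eqVlt; apply/orP; left; apply/eqP;
    exact: lebesgue_measure_set1.
- move=> v /=; apply: contra_notP => /not_orP[/eqP va /eqP vb] _.
  by rewrite fg.
Qed.

Lemma integral_set_lt_le (a b c : R) : 0 <= a -> a <= b ->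
  (\int[leb]_x (c * ((0 < x) && (a <= x < b))%R%:R)%:E = (c * (b - a))%:E)%E.
Proof.
move=> a0 ab; pose I := Interval (BSide (0 < a)%R a) (BLeft b).
have E (x : R) : ((0 < x) && (a <= x < b)) = (x \in I).
  rewrite itv_boundlr bnd_simp; have [a1|a1] := ltP 0 a; rewrite bnd_simp.
    by have [ax|] := leP a x; rewrite ?andbF//= (lt_le_trans a1 ax).
  have -> : a = 0 by apply/le_anti; rewrite a1 a0.
  by have [x0|//] := ltP 0 x; rewrite (ltW x0).
transitivity (\int[leb]_(x in [set` I]) c%:E)%E.
  rewrite [RHS]integral_mkcond; apply: eq_integral => x _.
  by rewrite patchE mem_setE E; case: (x \in _); rewrite ?mulr1 ?mulr0.
rewrite integral_cst// /I.
have len (e : bool) : leb [set` Interval (BSide e a) (BLeft b)] = (b - a)%:E.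
  rewrite lebesgue_measure_itv /= lte_fin.
  case: ltP => [_|ba]; first by rewrite EFinB.
  by have -> : b = a; [apply/le_anti; rewrite ba|rewrite subrr].
by rewrite EFinM; congr (_ * _)%E; exact: len.
Qed.

End lebesgue_points.

Section flow.
Variables (R : realType) (d : nat) (alpha : R).
Local Notation V := 'rV[R]_d.
Local Notation leb := (@lebesgue_measure R).
Variable sigma : {finite_measure set V -> \bar R}.
Variable q : V -> R -> R.
Hypothesis alpha0 : 0 < alpha.
Hypothesis q_borel : measurable_fun (sphere `*` `]0, +oo[ : set (V * R))
  (fun p : V * R => q p.1 p.2).
Hypothesis q01 : forall xi u, sphere xi -> 0 < u -> 0 <= q xi u <= 1.
Hypothesis q_nonincr : forall xi u v, sphere xi -> 0 < u -> u <= v -> q xi v <= q xi u.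
Variables (lambda t : R).
Hypothesis lambda0 : 0 < lambda.
Hypothesis t0 : 0 < t.
Local Notation polar_set := (@polar_set R d).
Local Notation mu := (polar_measure sigma).
Local Notation radius := (radius alpha q).
Local Notation T := (lambda * t).
Local Notation tail0 := (tail0 alpha q).

(** Parameters [(xi, x, s)]: direction and level of a jump of the driving process,
    and the time at which it occurs. *)
Definition flow_measure := sf_product mu leb.

(** A jump made at time [s] contributes to the increment up to time [t] after
    contraction by [e^(- lambda (t - s))]. *)
Definition flow_point (p : V * R * R) : V :=
  expR (- (lambda * (t - p.2))) *: bdlp_point alpha q p.1.

Definition flow_weight (p : V * R * R) : R :=
  lambda * bdlp_weight alpha q p.1 * (0 <= p.2 < t)%R%:R.

(** Density, in polar coordinates, of the Levy measure of the increment. *)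
Definition trans_density : V * R -> R :=
  (fun p => p.2 `^ (- 1) * (tail alpha q p.1 p.2 - tail alpha q p.1 (p.2 * expR T))) \_ polar_set.

Lemma measurable_flow_point : measurable_fun setT flow_point.
Proof.
apply: measurable_vecZ; last first.
  by apply: measurableT_comp; [exact: measurable_bdlp_point|exact: measurable_fst].
apply: measurableT_comp => //; apply: measurableT_comp => //.
apply: measurable_funM => //; apply: measurable_funB => //; exact: measurable_snd.
Qed.

Lemma measurable_flow_weight : measurable_fun setT flow_weight.
Proof.
apply: measurable_funM.
  apply: measurable_funM => //; apply: measurableT_comp; last exact: measurable_fst.
  exact: measurable_bdlp_weight.
apply: measurableT_comp => //; apply: measurable_and.
  by apply: measurable_fun_ler => //; exact: measurable_snd.
by apply: measurable_fun_ltr => //; exact: measurable_snd.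
Qed.

Lemma flow_weight_ge0 p : 0 <= flow_weight p.
Proof. by rewrite !mulr_ge0// ltW. Qed.

Let eT0 : 0 < expR T. Proof. exact: expR_gt0. Qed.
Let expT1 : 1 <= expR T.
Proof. by rewrite -expR0 ler_expR mulr_ge0// ltW. Qed.

Lemma measurable_tail0_dilate : measurable_fun setT (fun p : V * R => tail0 (p.1, p.2 * expR T)).
Proof.
apply: (measurableT_comp (measurable_tail0 alpha q_borel)).
apply: measurable_fun_pair; first exact: measurable_fst.
by apply: measurable_funM; [exact: measurable_snd|exact: measurable_cst].
Qed.

Lemma trans_densityE0 : trans_density =
  (fun p => p.2 `^ (- 1) * (tail0 p - tail0 (p.1, p.2 * expR T))) \_ polar_set.
Proof.
apply/funext => -[xi u]; rewrite /trans_density !patchE; case: ifPn => //.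
move=> /set_mem/polar_setE[/= s1 p2]; rewrite !tail0E//.
by rewrite mulr_gt0.
Qed.

Lemma measurable_trans_density : measurable_fun setT trans_density.
Proof.
rewrite trans_densityE0; apply: measurable_polar_restrict; apply: measurable_funM.
  exact: measurable_powR_snd.
apply: measurable_funTS; apply: measurable_funB; last exact: measurable_tail0_dilate.
exact: measurable_tail0.
Qed.

Lemma trans_density_ge0 p : 0 <= trans_density p.
Proof.
rewrite /trans_density patchE; case: ifPn => // /set_mem/polar_setE[s1 p2].
rewrite mulr_ge0 ?powR_ge0// subr_ge0; apply: (tail_nonincr alpha0 q01 q_nonincr) => //.
by rewrite ler_peMr// ltW.
Qed.

(** A jump is found at distance [v] at time [t] when its original size lies between
    [v] and [v e^(lambda t)], an event of mass [tail v - tail (v e^(lambda t))].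
    Substituting [v = u e^(- lambda (t - s))] for the time [s] turns
    [lambda ds] into [dv / v], and Tonelli integrates the level [x] for fixed
    [v]. *)
Lemma flow_image B : measurable B ->
  (\int[flow_measure]_p (\1_B (flow_point p) * flow_weight p)%:E =
   \int[mu]_p (\1_B (polar_point p) * trans_density p)%:E)%E.
Proof.
move=> mB.
have mB1 : measurable_fun setT (\1_B : V -> R) by exact: measurable_indic.
rewrite (@sf_tonelli _ _ _ _ R mu leb (fun p => \1_B (flow_point p) * flow_weight p)); last 2 first.
- apply: measurable_funM; last exact: measurable_flow_weight.
  by apply: measurableT_comp measurable_flow_point.
- by move=> p; rewrite mulr_ge0// flow_weight_ge0.
(* The density after substitution: the radius of level [x] lies between [v] and
   [v e^T] when [x] lies between the two values of the tail. *)
pose h (p : V * R * R) : R := \1_B (p.2 *: p.1.1) * (p.2 `^ (-1) * (0 < p.2)%R%:R) *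
  ((0 < p.1.2) && (tail0 (p.1.1, p.2 * expR T) <= p.1.2 < tail0 (p.1.1, p.2)))%R%:R.
have mxi : measurable_fun setT (fun p : V * R * R => p.1.1).
  by apply: measurableT_comp; exact: measurable_fst.
have mx : measurable_fun setT (fun p : V * R * R => p.1.2).
  by apply: measurableT_comp; [exact: measurable_snd|exact: measurable_fst].
have mv : measurable_fun setT (fun p : V * R * R => p.2) by exact: measurable_snd.
have mh : measurable_fun setT h.
  apply: measurable_funM; first apply: measurable_funM.
  - by apply: measurableT_comp => //; exact: measurable_vecZ.
  - apply: measurable_funM.
      by apply: (measurableT_comp (f := fun v : R => v `^ (-1))) => //; exact: measurable_powR.
    by apply: measurableT_comp => //; exact: measurable_fun_ltr.
  - apply: measurableT_comp => //; apply: measurable_and.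
      exact: measurable_fun_ltr.
    apply: measurable_and.
      apply: measurable_fun_ler => //.
      apply: (measurableT_comp (measurable_tail0_dilate) (g := fun p : V * R * R => (p.1.1, p.2))).
      exact: measurable_fun_pair.
    apply: measurable_fun_ltr => //.
    apply: (measurableT_comp (measurable_tail0 alpha q_borel) (g := fun p : V * R * R => (p.1.1, p.2))).
    exact: measurable_fun_pair.
have h0 p : 0 <= h p by rewrite !mulr_ge0// powR_ge0.
transitivity (\int[mu]_p \int[leb]_v (h (p, v))%:E)%E.
  apply: eq_integral => -[xi x] _.
  have [u0|u0] := ltP 0 (radius (xi, x)); last first.
    rewrite [LHS]integral0_eq; last first.
      by move=> s _; rewrite /flow_weight /bdlp_weight ltNge u0/= mulr0 mul0r mulr0.
    rewrite [RHS]integral0_eq// => v _; rewrite /h /=.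
    have [v0|v0] := ltP 0 v; last by rewrite !mulr0 mul0r.
    have [x0|x0] := ltP 0 x; last by rewrite mulr0.
    suff tx : (x < tail0 (xi, v)) = false by rewrite tx !andbF mulr0.
    rewrite ltNge; apply/negbF.
    have [sxi|sxi] := pselect (sphere xi); last first.
      by rewrite /tail0 patchE memNset ?(ltW x0)//; case.
    rewrite tail0E//; apply: (quantile_le_tail alpha0 q01 sxi x0 v0).
    by move: u0; rewrite radiusE; [move/le_lt_trans; apply|apply/polar_setE].
  set u := radius (xi, x) in u0 *.
  pose B' : set R := [set v | B (v *: xi)] `&` `[u * expR (- T), u[%classic.
  have mB' : measurable B'.
    apply: measurableI => //.
    have : measurable_fun setT (fun u : R => u *: xi).
      by apply: measurable_vecZ; [exact: measurable_id|exact: measurable_cst].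
    by move/(_ measurableT B mB); rewrite setTI.
  transitivity (\int[leb]_s (\1_B' (u * expR (- (lambda * (t - s)))) * lambda)%:E)%E.
    apply: eq_integral => s _; congr EFin; rewrite /flow_weight /bdlp_weight /= -/u u0 mulr1.
    rewrite (mulrC lambda) mulrA; congr (_ * _); rewrite !indicE -natrM mulnb; congr (_%:R).
    congr nat_of_bool; rewrite /flow_point /bdlp_point /= -/u scalerA in_setI mulrC; congr andb.
    rewrite mem_setE in_itv /= ler_pM2l// ler_expR lerN2 gtr_pMr// -expR0 ltr_expR.
    rewrite oppr_lt0 pmulr_rgt0// subr_gt0 ler_pM2l//; congr andb.
    by apply/idP/idP; lra.
  rewrite exponential_flow_measure//.
  have [x0 sxi] : 0 < x /\ sphere xi.
    have [/polar_setE[]//|Sx] := pselect (polar_set (xi, x)).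
    by move: u0; rewrite /u radius_out// ltxx.
  have uE : u = quantile alpha q xi x by rewrite /u radiusE//; apply/polar_setE.
  (* Where the tail jumps or is flat, [quantile] and [tail] invert each other only
     up to the endpoints of the range of [v]. *)
  apply: (@eq_integral_off_two_points _ _ _ u (u * expR (- T))).
  - apply: measurable_funM; first exact: measurable_indic.
    apply: measurable_funM; first exact: measurable_powR.
    by apply: measurableT_comp => //; exact: measurable_fun_ltr.
  - apply: (measurableT_comp mh (g := fun v => (xi, x, v))).
    by apply: measurable_fun_pair => //; exact: measurable_cst.
  move=> v vu vuT; rewrite /h /= x0 /=.
  have [v0|v0] := ltP 0 v; last by rewrite !mulr0 mul0r.
  rewrite !mulr1 [RHS]mulrAC; congr (_ * _); rewrite !indicE -natrM mulnb; congr (_%:R).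
  congr nat_of_bool; rewrite in_setI; congr andb.
  rewrite mem_setE in_itv /= andbC expRN ler_pdivrMr// [LHS]andbC !tail0E ?mulr_gt0//.
  rewrite expRN in vuT.
  have vuT' : v * expR T != u.
    by apply/negP => /eqP E; move: vuT; rewrite -E mulfK ?eqxx// gt_eqF.
  have vT0 : 0 < v * expR T by rewrite mulr_gt0.
  congr andb.
    have [uv|] := leP u (v * expR T).
      apply/esym; apply: (quantile_le_tail alpha0 q01 sxi x0 vT0).
      by rewrite -uE lt_neqAle eq_sym vuT'.
    by rewrite uE => /(lt_quantile alpha0 q01 q_nonincr sxi x0 vT0); case: leP.
  have [uv|] := ltP v u.
    by apply/esym; apply: (lt_quantile alpha0 q01 q_nonincr sxi x0 v0); rewrite -uE.
  rewrite le_eqVlt eq_sym (negbTE vu) /= uE.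
  by move=> /(quantile_le_tail alpha0 q01 sxi x0 v0); case: leP.
transitivity (\int[sigma]_xi \int[leb]_x \int[leb]_v (h (xi, x, v))%:E)%E.
  apply: (fubini_tonelli1 (m1 := sigma) (m2 := leb) (fun p => \int[leb]_v (h (p, v))%:E)%E).
  - exact: (@sf_tonelli_measurable _ _ _ _ R leb h mh h0).
  - by move=> p; apply: integral_ge0 => v _; rewrite lee_fin.
rewrite (@polar_tonelli _ _ sigma (fun p => \1_B (polar_point p) * trans_density p)); last 2 first.
- apply: measurable_funM; last exact: measurable_trans_density.
  by apply: measurableT_comp => //; exact: measurable_polar_point.
- by move=> p; rewrite mulr_ge0// trans_density_ge0.
apply: eq_integral => xi _.
rewrite (@sf_tonelli_swap _ _ _ _ R leb leb (fun p => h (xi, p.1, p.2))); last 2 first.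
- apply: (measurableT_comp mh (g := fun p : R * R => (xi, p.1, p.2))).
  apply: measurable_fun_pair; last exact: measurable_snd.
  by apply: measurable_fun_pair; [exact: measurable_cst|exact: measurable_fst].
- by [].
apply: eq_integral => v _; rewrite /h /=.
have [[sxi v0]|Sv] := pselect (sphere xi /\ 0 < v); last first.
  rewrite integral0_eq.
    by rewrite /trans_density patchE memNset ?mulr0// => /polar_setE.
  move=> x _; have [v0|v0] := ltP 0 v; last by rewrite !mulr0 mul0r.
  have [x0|x0] := ltP 0 x; last by rewrite mulr0.
  suff tx : (x < tail0 (xi, v)) = false by rewrite tx !andbF mulr0.
  rewrite ltNge; apply/negbF; rewrite /tail0 patchE memNset ?(ltW x0)//.
  by move/polar_setE => [sxi _]; apply: Sv.
rewrite integral_set_lt_le !tail0E ?mulr_gt0//; last 2 first.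
- by apply: tail_ge0 => //; rewrite mulr_gt0.
- by apply: (tail_nonincr alpha0 q01 q_nonincr) => //; rewrite ler_peMr// ltW.
rewrite v0 mulr1 -mulrA; congr (_ * _)%:E.
by rewrite /trans_density patchE mem_set//; apply/polar_setE.
Qed.

End flow.

(** * Integrability of the Levy-Khintchine kernel *)

Section power_integrals.
Variable R : realType.
Local Notation leb := (@lebesgue_measure R).

Lemma powRN_cvg0 (c : R) : 0 < c -> x `^ (- c) @[x --> +oo] --> (0 : R).
Proof.
move=> c0; apply/cvgrPdist_le => e e0; near=> x.
have x1 : 1 <= x by near: x; exact: nbhs_pinfty_ge.
have x0 : 0 < x by exact: lt_le_trans x1.
rewrite sub0r normrN ger0_norm ?powR_ge0//.
have ex : e `^ (- c^-1) <= x by near: x; apply: nbhs_pinfty_ge; exact: num_real.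
have := powRN_nonincr (ltW c0) (powR_gt0 (- c^-1) e0) ex.
by rewrite -powRrM mulrNN mulVf ?gt_eqF// powRr1// ltW.
Unshelve. all: by end_near. Qed.

Lemma integral_powR_tail (b : R) : 1 < b ->
  (\int[leb]_(x in `[1%R, +oo[) (x `^ (- b))%:E < +oo)%E.
Proof.
move=> b1; have b0 : 0 < b - 1 by rewrite subr_gt0.
pose F (x : R) := - (b - 1)^-1 * x `^ (- (b - 1)).
have dF (x : R) : 1 < x -> is_derive x 1 F (x `^ (- b)).
  move=> x1; have x0 : x \in `]0, +oo[ by rewrite in_itv /= andbT (lt_trans _ x1).
  have dp : is_derive x 1 (@powR R ^~ (- (b - 1))) (- (b - 1) * x `^ (- (b - 1) - 1)).
    by apply: DeriveDef; [exact: derivable_powR|rewrite -derive1E powR_derive1].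
  rewrite (_ : x `^ (- b) = - (b - 1)^-1 *: (- (b - 1) * x `^ (- (b - 1) - 1))).
    exact: is_deriveZ.
  rewrite [RHS]mulrA mulrNN mulVf ?gt_eqF// mul1r; congr (_ `^ _); lra.
have cpow (r x : R) : 0 < x -> {for x, continuous (@powR R ^~ r)}.
  move=> x0; apply/differentiable_continuous/derivable1_diffP.
  by apply: derivable_powR; rewrite in_itv /= x0.
rewrite (@ge0_continuous_FTC2y _ _ F 1 0) ?ltry//.
- by move=> x _; rewrite powR_ge0.
- apply: continuous_in_subspaceT => x /set_mem; rewrite /= in_itv /= andbT => x1.
  by apply: cpow; exact: lt_le_trans x1.
- rewrite -(mulr0 (- (b - 1)^-1)); apply: cvgMr; exact: powRN_cvg0.
- by move=> x x1; have [] := dF x x1.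
- apply: cvg_at_right_filter; apply: cvgMr; exact: cpow.
- by move=> x; rewrite in_itv /= andbT => x1; rewrite derive1E; have [_ ->] := dF x x1.
Qed.

(** The singularity at the origin is turned into one at infinity by integrating
    over the level sets. *)
Lemma integral_powR_head (a : R) : 0 <= a -> a < 1 ->
  (\int[leb]_(x in `]0%R, 1%R]) (x `^ (- a))%:E < +oo)%E.
Proof.
rewrite le_eqVlt => /predU1P[<- _|a0 a1].
  under eq_integral do rewrite oppr0 powRr0.
  by rewrite integral_cst//= lebesgue_measure_itv/= lte_fin ltr01 mul1e ltry.
(* The region under the graph; read along the other axis its sections have
   length [1] below height [1] and [y^(- 1 / a)] above. *)
pose f (p : R * R) : R := ((0 < p.1 <= 1) && (0 <= p.2 <= p.1 `^ (- a)))%R%:R.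
have mf : measurable_fun setT f.
  apply: measurableT_comp => //; apply: measurable_and; apply: measurable_and.
  - by apply: measurable_fun_ltr => //; exact: measurable_fst.
  - by apply: measurable_fun_ler => //; exact: measurable_fst.
  - by apply: measurable_fun_ler => //; exact: measurable_snd.
  - apply: measurable_fun_ler; first exact: measurable_snd.
    apply: (measurableT_comp (f := fun v : R => v `^ (- a))); first exact: measurable_powR.
    exact: measurable_fst.
have f0 p : 0 <= f p by [].
have -> : (\int[leb]_(x in `]0%R, 1%R]) (x `^ (- a))%:E =
    \int[leb]_x \int[leb]_y (f (x, y))%:E)%E.
  rewrite [LHS]integral_mkcond; apply: eq_integral => x _.
  rewrite patchE mem_setE in_itv /= /f /=; case: ifPn => x01; last first.
    by rewrite integral0_eq.
  transitivity (\int[leb]_y (\1_(`[0%R, x `^ (- a)]%classic) y)%:E)%E.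
    rewrite integral_indic// setIT [RHS](lebesgue_measure_itv `[_, _]) /= lte_fin.
    by rewrite powR_gt0 ?oppr0 ?adde0//; case/andP: x01.
  by apply: eq_integral => y _; rewrite indicE mem_setE in_itv.
rewrite (@sf_tonelli_swap _ _ _ _ R leb leb f)//.
pose g (y : R) : R := \1_(`[0%R, 1%R]%classic) y + \1_(`[1%R, +oo[%classic) y * y `^ (- a^-1).
have mg : measurable_fun setT g.
  apply: measurable_funD; first exact: measurable_indic.
  by apply: measurable_funM; [exact: measurable_indic|exact: measurable_powR].
apply: (@le_lt_trans _ _ (\int[leb]_y (g y)%:E)%E).
  apply: ge0_le_integral => //.
  - by move=> y _; apply: integral_ge0 => x _; rewrite lee_fin.
  - pose f' (p : R * R) := f (p.2, p.1).
    apply: (@sf_tonelli_measurable _ _ _ _ R leb f') => //.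
    by apply: (measurableT_comp mf); apply: measurable_fun_pair;
      [exact: measurable_snd|exact: measurable_fst].
  - exact/measurable_EFinP.
  move=> y _; pose c : R := if y < 0 then 0 else if y <= 1 then 1 else y `^ (- a^-1).
  have c0 : 0 <= c by rewrite /c; case: ifP => // _; case: ifP => // _; exact: powR_ge0.
  apply: (@le_trans _ _ c%:E).
    apply: (@le_trans _ _ (\int[leb]_x (\1_(`[0%R, c]%classic) x)%:E)%E).
      apply: ge0_le_integral => //; try by move=> x _; rewrite lee_fin.
      - apply/measurable_EFinP; apply: (measurableT_comp mf).
        by apply: measurable_fun_pair => //; exact: measurable_cst.
      - by apply/measurable_EFinP; exact: measurable_indic.
      move=> x _; rewrite lee_fin /f /= indicE mem_setE in_itv /=.
      have [/andP[/andP[x0 x1] /andP[y0 yx]]|] := boolP ((0 < x <= 1) && _); last by [].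
      rewrite (ltW x0) /c ltNge y0 /=; case: ifPn => [_|]; first by rewrite x1.
      rewrite -ltNge => y1; have y0' := lt_trans ltr01 y1.
      have := powRN_nonincr (r := a^-1) _ y0' yx.
      rewrite -powRrM mulrNN mulfV ?gt_eqF// powRr1 ?(ltW x0)// => -> //.
      by rewrite invr_ge0 ltW.
    rewrite integral_indic// setIT [X in (X <= _)%E](lebesgue_measure_itv `[_, _]) /= lte_fin.
    by case: ifPn => _; rewrite ?oppr0 ?adde0// lee_fin.
  rewrite lee_fin /c /g !indicE !mem_setE !in_itv /= andbT.
  have [y0|y0] := ltP y 0; first by rewrite addr_ge0 ?mulr_ge0 ?powR_ge0.
  have [y1|y1] := leP y 1; first by rewrite lerDl mulr_ge0 ?powR_ge0.
  by rewrite (ltW y1) mul1r add0r.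
under eq_integral do rewrite EFinD.
rewrite ge0_integralD//; last 3 first.
- by apply/measurable_EFinP; exact: measurable_indic.
- by move=> y _; rewrite lee_fin mulr_ge0 ?powR_ge0.
- apply/measurable_EFinP/measurable_funM; first exact: measurable_indic.
  exact: measurable_powR.
apply: lte_add_pinfty.
  rewrite integral_indic// setIT [X in (X < _)%E](lebesgue_measure_itv `[_, _]) /= lte_fin.
  by rewrite ltr01 oppr0 adde0 ltry.
have : 1 < a^-1 by rewrite invf_gt1.
move=> /integral_powR_tail; apply: le_lt_trans.
rewrite le_eqVlt; apply/orP; left; apply/eqP; rewrite [RHS]integral_mkcond.
apply: eq_integral => y _; rewrite patchE indicE.
by case: (_ \in _); rewrite ?mul1r ?mul0r.
Qed.

End power_integrals.

Section gauge.
Variables (R : realType) (alpha : R).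
Local Notation leb := (@lebesgue_measure R).
Hypothesis alpha0 : 0 < alpha.
Hypothesis alpha2 : alpha < 2.

(** The size of the integrand of the Levy-Khintchine exponent at distance [u],
    for the truncation that goes with [alpha]. *)
Definition levy_gauge (u : R) : R :=
  if alpha < 1 then Num.min 1 u
  else if alpha == 1 then Num.min 1 (u ^+ 2)
  else Num.min u (u ^+ 2).

Let min_mono (a b a' b' : R) : a <= a' -> b <= b' -> Num.min a b <= Num.min a' b'.
Proof. by move=> aa bb; rewrite le_min !ge_min aa bb orbT. Qed.

Lemma levy_gauge_ge0 u : 0 <= u -> 0 <= levy_gauge u.
Proof.
by move=> u0; rewrite /levy_gauge; case: ifP => _; [|case: ifP => _]; rewrite le_min ?ler01 ?u0 ?sqr_ge0.
Qed.

Lemma levy_gauge_eq1 u : alpha = 1 -> 1 <= u -> levy_gauge u = 1.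
Proof.
by move=> a1 u1; rewrite /levy_gauge a1 ltxx eqxx; apply/min_idPl; rewrite exprn_ege1.
Qed.

Lemma levy_gauge_mono u v : 0 <= u -> u <= v -> levy_gauge u <= levy_gauge v.
Proof.
move=> u0 uv; have uv2 : u ^+ 2 <= v ^+ 2.
  by rewrite ler_pXn2r// nnegrE// (le_trans u0).
by rewrite /levy_gauge; case: ifP => _; [|case: ifP => _]; apply: min_mono.
Qed.

Lemma measurable_levy_gauge : measurable_fun setT levy_gauge.
Proof.
have m2 : measurable_fun setT (fun u : R => u ^+ 2) by apply: measurable_funX.
rewrite /levy_gauge; have [a1|a1] := ltP alpha 1; first exact: measurable_minr.
by have [a1'|a1'] := eqVneq alpha 1; exact: measurable_minr.
Qed.

(** The gauge vanishes at the origin like [u] when [alpha < 1] and like [u^2]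
    otherwise, which gives the exponents [1 / alpha] and [2 / alpha], above [1],
    for large [x]. For small [x] it is bounded when [alpha <= 1] and at most
    [u = x^(- 1 / alpha)], with [1 / alpha < 1], when [alpha > 1]. *)
Lemma levy_gauge_power : exists a b : R, [/\ 0 <= a, a < 1, 1 < b & forall x, 0 < x ->
  levy_gauge (x `^ (- alpha^-1)) <=
    \1_(`]0%R, 1%R]%classic) x * x `^ (- a) + \1_(`[1%R, +oo[%classic) x * x `^ (- b)].
Proof.
have ai0 : 0 < alpha^-1 by rewrite invr_gt0.
have sqrE (x : R) : (x `^ (- alpha^-1)) ^+ 2 = x `^ (- (2 * alpha^-1)).
  by rewrite -powR_mulrn ?powR_ge0// -powRrM; congr (_ `^ _); ring.
have split (a b x : R) : 0 < x -> levy_gauge (x `^ (- alpha^-1)) <= x `^ (- a) ->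
    levy_gauge (x `^ (- alpha^-1)) <= x `^ (- b) ->
    levy_gauge (x `^ (- alpha^-1)) <=
    \1_(`]0%R, 1%R]%classic) x * x `^ (- a) + \1_(`[1%R, +oo[%classic) x * x `^ (- b).
  move=> x0 xa xb; rewrite !indicE !mem_setE !in_itv /= andbT x0 /=.
  have [x1|x1] := leP x 1.
    by rewrite mul1r; apply: le_trans xa _; rewrite lerDl mulr_ge0 ?powR_ge0.
  by rewrite mul0r add0r (ltW x1) mul1r.
have [a1|a1] := ltP alpha 1; [|have [a1'|a1'] := eqVneq alpha 1].
- exists 0, alpha^-1; split; rewrite ?ler01 ?ltr01 ?invf_gt1//.
  move=> x x0; apply: split => //; rewrite /levy_gauge a1 ge_min ?lexx ?orbT//.
  by rewrite oppr0 powRr0 lexx.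
- exists 0, (2 * alpha^-1); split; rewrite ?ler01 ?ltr01//.
    by rewrite a1' invr1 mulr1 ltr1n.
  move=> x x0; have gE : levy_gauge (x `^ (- alpha^-1)) =
      Num.min 1 (x `^ (- (2 * alpha^-1))).
    by rewrite /levy_gauge ltNge a1 /= (introT eqP a1') sqrE.
  by apply: split => //; rewrite gE ge_min ?oppr0 ?powRr0 lexx ?orbT.
- have {}a1 : 1 < alpha by rewrite lt_neqAle eq_sym a1'.
  exists alpha^-1, (2 * alpha^-1); split; rewrite ?(ltW ai0)//.
  + by rewrite invf_lt1.
  + by rewrite ltr_pdivlMr// mul1r.
  move=> x x0; have gE : levy_gauge (x `^ (- alpha^-1)) =
      Num.min (x `^ (- alpha^-1)) (x `^ (- (2 * alpha^-1))).
    by rewrite /levy_gauge ltNge (ltW a1) (negbTE a1') sqrE.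
  by apply: split => //; rewrite gE ge_min lexx ?orbT.
Qed.

Lemma levy_gauge_integral :
  (\int[leb]_x (levy_gauge (x `^ (- alpha^-1)) * (0 < x)%R%:R)%:E < +oo)%E.
Proof.
have [a [b [a0 a1 b1 le]]] := levy_gauge_power.
have mp (r : R) : measurable_fun setT (fun x : R => x `^ r) by exact: measurable_powR.
apply: (@le_lt_trans _ _ (\int[leb]_x ((\1_(`]0%R, 1%R]%classic) x * x `^ (- a))%:E +
    (\1_(`[1%R, +oo[%classic) x * x `^ (- b))%:E))%E).
  apply: ge0_le_integral => //.
  - by move=> x _; rewrite lee_fin mulr_ge0// levy_gauge_ge0// powR_ge0.
  - apply/measurable_EFinP/measurable_funM.
      by apply: measurableT_comp => //; exact: measurable_levy_gauge.
    by apply: measurableT_comp => //; exact: measurable_fun_ltr.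
  - by apply: emeasurable_funD; apply/measurable_EFinP/measurable_funM.
  move=> x _; rewrite -EFinD lee_fin; have [x0|x0] := ltP 0 x.
    by rewrite mulr1 le.
  by rewrite mulr0 addr_ge0// mulr_ge0 ?powR_ge0.
rewrite ge0_integralD//; last 4 first.
- by move=> y _; rewrite lee_fin mulr_ge0 ?powR_ge0.
- by apply/measurable_EFinP/measurable_funM.
- by move=> y _; rewrite lee_fin mulr_ge0 ?powR_ge0.
- by apply/measurable_EFinP/measurable_funM.
have E (A : set R) (r : R) : (\int[leb]_x (\1_A x * x `^ r)%:E =
    \int[leb]_(x in A) (x `^ r)%:E)%E.
  rewrite [RHS]integral_mkcond; apply: eq_integral => y _; rewrite patchE indicE.
  by case: (_ \in _); rewrite ?mul1r ?mul0r.
rewrite !E; apply: lte_add_pinfty; [exact: integral_powR_head|exact: integral_powR_tail].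
Qed.

End gauge.

Section kernel.
Variables (R : realType) (d : nat) (alpha : R).
Local Notation V := 'rV[R]_d.
Hypothesis alpha0 : 0 < alpha.
Hypothesis alpha2 : alpha < 2.

Definition kernel_re (z x : V) : R := cos (dot z x) - 1.
Definition kernel_im (z x : V) : R := sin (dot z x) - dot z x * trunc alpha x.

Lemma measurable_trunc : measurable_fun setT (@trunc R d alpha).
Proof.
rewrite /trunc; have [a1|a1] := ltP alpha 1; first exact: measurable_cst.
have [a1'|a1'] := eqVneq alpha 1; last exact: measurable_cst.
apply: measurable_fun_if => //.
by apply: measurable_fun_ler => //; exact: measurable_enorm.
Qed.

Lemma measurable_kernel_re z : measurable_fun setT (kernel_re z).
Proof. by apply: measurable_funB => //; exact: measurable_cos_dot. Qed.

Lemma measurable_kernel_im z : measurable_fun setT (kernel_im z).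
Proof.
apply: measurable_funB; first exact: measurable_sin_dot.
by apply: measurable_funM; [exact: measurable_dot|exact: measurable_trunc].
Qed.

(** Large enough for all the elementary bounds of the kernel, those linear and
    those quadratic in [c], at once. *)
Definition kernel_const (c : R) : R := 2 + 2 * c + c ^+ 2.

Lemma kernel_const_ge0 c : 0 <= c -> 0 <= kernel_const c.
Proof. by move=> c0; rewrite !addr_ge0 ?mulr_ge0 ?sqr_ge0. Qed.

Let trunc_radius (u : R) : R :=
  if alpha < 1 then 0
  else if alpha == 1 then (if u <= 1 then 1 else 0)
  else 1.

Let kernel_bound_aux (c u th : R) : 0 <= c -> 0 <= u -> `|th| <= c * u ->
  `|cos th - 1| <= kernel_const c * levy_gauge alpha u /\
  `|sin th - th * trunc_radius u| <= kernel_const c * levy_gauge alpha u.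
Proof.
move=> c0 u0 thu.
have cu0 : 0 <= c * u by rewrite mulr_ge0.
have c20 : 0 <= c ^+ 2 by rewrite sqr_ge0.
have th2 : th ^+ 2 <= c ^+ 2 * u ^+ 2.
  by rewrite -exprMn -(real_normK (num_real th)) ler_pXn2r ?nnegrE.
have u20 : 0 <= u ^+ 2 by rewrite sqr_ge0.
have cs1 := (cos_sub1_le th). have cs2 := (cos_sub1_sq th).
have sn1 := (sin_le th). have sn2 := (sin_sub_sq th).
have [cb sb] := cis_bounds th.
have cb2 : `|cos th - 1| <= 2.
  by apply: le_trans (ler_normB _ _) _; rewrite normr1; lra.
have sn3 : `|sin th - th| <= 2 * (c * u).
  by apply: le_trans (ler_normB _ _) _; lra.
rewrite /kernel_const /levy_gauge /trunc_radius.
have [a1|a1] := ltP alpha 1; [|have [a1'|a1'] := eqVneq alpha 1].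
- rewrite mulr0 subr0; case: (leP 1 u) => u1; split; nra.
- case: (leP 1 (u ^+ 2)) => u1.
    case: (leP u 1) => u1'.
      split; first nra.
      rewrite !mulr1; have cu : c * u <= c by nra.
      by nra.
    rewrite mulr0 subr0; split; nra.
  have u1' : u <= 1 by nra.
  by rewrite u1' mulr1; split; nra.
- rewrite mulr1.
  by case: (leP u (u ^+ 2)) => u1; split; nra.
Qed.

(** Near the origin the kernel is of first order, or of second order once the
    linear term is subtracted; far from it the kernel is bounded, or of first
    order if the linear term is subtracted there as well. The gauge is the
    smaller of the two. *)
Lemma kernel_bound (c : R) (z x : V) : norm1 z <= c ->
  `|kernel_re z x| <= kernel_const c * levy_gauge alpha (enorm x) /\
  `|kernel_im z x| <= kernel_const c * levy_gauge alpha (enorm x).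
Proof.
move=> zc; have c0 : 0 <= c by apply: le_trans zc; exact: norm1_ge0.
apply: (@kernel_bound_aux c (enorm x) (dot z x)) => //; first exact: enorm_ge0.
by apply: le_trans (dot_le z x) _; rewrite ler_wpM2r// enorm_ge0.
Qed.

(** With no Gaussian part the exponent consists of the drift and of the integrals
    of the two kernels, which are transported to the parameter space. *)
Lemma ID_exponentE (disp : measure_display) (T : measurableType disp)
    (mu : {measure set T -> \bar R}) (phi : T -> V) (w : T -> R)
    (M : set V -> \bar R) (b z : V) :
  measurable_fun setT phi -> measurable_fun setT w -> (forall p, 0 <= w p) ->
  (forall B, measurable B -> M B = \int[mu]_p (\1_B (phi p) * w p)%:E)%E ->
  ID_exponent 0 M b (trunc alpha) z =
  Complex (rint mu setT (fun p => kernel_re z (phi p) * w p))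
          (dot b z + rint mu setT (fun p => kernel_im z (phi p) * w p)).
Proof.
move=> mphi mw w0 ME; rewrite /ID_exponent trmx0 mulmx0.
have -> : dot z 0 = 0 by rewrite dotC dot0l.
have algebra (a b' c : R) :
    Complex a b' - 1 - Complex 0 1 * Complex c 0 = Complex (a - 1) (b' - c).
  apply: complex_eq.
    by transitivity (a - 1 - (0 * c - 1 * 0) : R); last by transitivity (a - 1 : R); [ring|].
  by transitivity (b' - 0 - (0 * 0 + 1 * c) : R); last by transitivity (b' - c : R); [ring|].
have algebra' (a c k l : R) : - Complex a 0 + Complex 0 1 * Complex c 0 +
    Complex k l = Complex (- a + k) (c + l).
  apply: complex_eq.
    by transitivity (- a + (0 * c - 1 * 0) + k : R); last by transitivity (- a + k : R); [ring|].
  by transitivity (- 0 + (0 * 0 + 1 * c) + l : R); last by transitivity (c + l : R); [ring|].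
have kE x : cexp (Complex 0 1 * real_complex R (dot z x)) - 1 -
    Complex 0 1 * real_complex R (dot z x * trunc alpha x) =
    Complex (kernel_re z x) (kernel_im z x).
  rewrite cisE; exact: algebra.
rewrite mulr0 /cint algebra' oppr0 add0r; congr Complex; last congr (_ + _).
  rewrite -(integral_weighted_imageR mphi mw w0 ME); last exact: measurable_kernel_re.
  by congr rint; apply/funext => x; rewrite kE.
rewrite -(integral_weighted_imageR mphi mw w0 ME); last exact: measurable_kernel_im.
by congr rint; apply/funext => x; rewrite kE.
Qed.

End kernel.

Section gauge_integrability.
Variables (R : realType) (d : nat) (alpha : R).
Local Notation V := 'rV[R]_d.
Local Notation leb := (@lebesgue_measure R).
Hypothesis alpha0 : 0 < alpha.
Hypothesis alpha2 : alpha < 2.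
Variable sigma : {finite_measure set V -> \bar R}.
Variable q : V -> R -> R.
Hypothesis q_borel : measurable_fun (sphere `*` `]0, +oo[ : set (V * R))
  (fun p : V * R => q p.1 p.2).
Hypothesis q01 : forall xi u, sphere xi -> 0 < u -> 0 <= q xi u <= 1.
Hypothesis q_nonincr : forall xi u v, sphere xi -> 0 < u -> u <= v -> q xi v <= q xi u.
Variables (lambda t : R).
Hypothesis lambda0 : 0 < lambda.
Hypothesis t0 : 0 < t.
Local Notation polar_set := (@polar_set R d).
Local Notation mu := (polar_measure sigma).
Local Notation radius := (radius alpha q).
Local Notation bdlp_point := (@bdlp_point R d alpha q).
Local Notation bdlp_weight := (@bdlp_weight R d alpha q).
Local Notation flow := (flow_measure sigma).
Local Notation flow_point := (@flow_point R d alpha q lambda t).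
Local Notation flow_weight := (@flow_weight R d alpha q lambda t).
Local Notation trans_density := (@trans_density R d alpha q lambda t).
Local Notation T := (lambda * t).

Lemma enorm_bdlp_point p : enorm (bdlp_point p) = radius p.
Proof.
rewrite enormZ ger0_norm; last exact: radius_ge0.
have [/polar_setE[s1 _]|Sp] := pselect (polar_set p); first by rewrite s1 mulr1.
by rewrite radius_out// mul0r.
Qed.

Let mbp : measurable_fun setT bdlp_point.
Proof. exact: measurable_bdlp_point. Qed.

Let mbw : measurable_fun setT bdlp_weight.
Proof. exact: measurable_bdlp_weight. Qed.

Let mfp : measurable_fun setT flow_point.
Proof. exact: measurable_flow_point. Qed.

Let mfw : measurable_fun setT flow_weight.
Proof. exact: measurable_flow_weight. Qed.

Let fw0 p : 0 <= flow_weight p.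
Proof. exact: flow_weight_ge0. Qed.

Let mtd : measurable_fun setT trans_density.
Proof. exact: measurable_trans_density. Qed.

Let td0 p : 0 <= trans_density p.
Proof. exact: trans_density_ge0. Qed.

Let gauge_radius0 p : 0 <= levy_gauge alpha (radius p).
Proof. by apply: levy_gauge_ge0; exact: radius_ge0. Qed.

Let mgauge_radius : measurable_fun setT (fun p => levy_gauge alpha (radius p)).
Proof.
apply: measurableT_comp; first exact: measurable_levy_gauge.
exact: measurable_radius.
Qed.

(** As [q <= 1], the radius at level [x] is at most [x^(- 1 / alpha)], so the
    integral is bounded by that of the untempered stable case. *)
Lemma bdlp_gauge_integrable :
  mu.-integrable setT (EFin \o (fun p => levy_gauge alpha (radius p) * bdlp_weight p)).
Proof.
apply/integrableP; split; first exact/measurable_EFinP/measurable_funM.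
pose h (p : V * R) : R := levy_gauge alpha (p.2 `^ (- alpha^-1)) * (0 < p.2)%R%:R.
have mh : measurable_fun setT h.
  apply: measurable_funM.
    apply: measurableT_comp; first exact: measurable_levy_gauge.
    apply: (measurableT_comp (f := fun v : R => v `^ (- alpha^-1))).
      exact: measurable_powR.
    exact: measurable_snd.
  by apply: measurableT_comp => //; apply: measurable_fun_ltr => //; exact: measurable_snd.
have h0 p : 0 <= h p by rewrite mulr_ge0// levy_gauge_ge0// powR_ge0.
apply: (@le_lt_trans _ _ (\int[mu]_p (h p)%:E)%E).
  apply: ge0_le_integral => //.
  - by apply/measurable_EFinP; apply: measurableT_comp => //; exact: measurable_funM.
  - exact/measurable_EFinP.
  move=> p _; rewrite /= lee_fin ger0_norm ?mulr_ge0//.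
  have [Sp|Sp] := pselect (polar_set p); last first.
    by rewrite /bdlp_weight radius_out// ltxx mulr0.
  have [s1 p2] := (polar_setE p).1 Sp.
  apply: ler_pM => //.
    apply: levy_gauge_mono; first exact: radius_ge0.
    by rewrite radiusE//; exact: quantile_le.
  by rewrite /bdlp_weight p2 ler_nat; case: (0 < _).
rewrite (@polar_tonelli _ _ sigma h)//.
rewrite (eq_integral (fun=> \int[leb]_x (levy_gauge alpha (x `^ (- alpha^-1)) *
  (0 < x)%R%:R)%:E)%E)//.
rewrite integral_cst//; apply: lte_mul_pinfty.
- by apply: integral_ge0 => x _; rewrite lee_fin mulr_ge0// levy_gauge_ge0// powR_ge0.
- rewrite ge0_fin_numE; first exact: levy_gauge_integral.
  by apply: integral_ge0 => x _; rewrite lee_fin mulr_ge0// levy_gauge_ge0// powR_ge0.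
- by rewrite ltey_eq fin_num_measure.
Qed.

Lemma bdlp_integrable (H : V * R -> R) (C : R) : measurable_fun setT H ->
  (forall p, `|H p| <= C * levy_gauge alpha (radius p)) ->
  mu.-integrable setT (EFin \o (fun p => H p * bdlp_weight p)).
Proof.
move=> mH HC; apply: (dominated_integrable_real (integrable_mulr C bdlp_gauge_integrable)).
  exact: measurable_funM.
by move=> p; rewrite normrM mulrA (ger0_norm (bdlp_weight_ge0 _ _ _)) ler_wpM2r// bdlp_weight_ge0.
Qed.

Let expT_le (s : R) : s < t -> 0 <= expR (- (lambda * (t - s))) <= 1.
Proof.
by move=> st; rewrite expR_ge0 -expR0 ler_expR oppr_le0 mulr_ge0 ?subr_ge0// ltW.
Qed.

Lemma flow_integrable (H : V * R * R -> R) (C : R) : 0 <= C -> measurable_fun setT H ->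
  (forall p, 0 <= p.2 < t -> `|H p| <= C * levy_gauge alpha (radius p.1)) ->
  flow.-integrable setT (EFin \o (fun p => H p * flow_weight p)).
Proof.
move=> C0 mH HC.
pose h (p : V * R * R) : R := C * levy_gauge alpha (radius p.1) * flow_weight p.
have mh : measurable_fun setT h.
  apply: measurable_funM => //; apply: measurable_funM => //.
  exact: (measurableT_comp mgauge_radius measurable_fst).
have h0 p : 0 <= h p by rewrite mulr_ge0// mulr_ge0.
have hi : flow.-integrable setT (EFin \o h).
  apply/integrableP; split; first exact/measurable_EFinP.
  under eq_integral do rewrite /= ger0_norm//.
  rewrite (@sf_tonelli _ _ _ _ R mu leb h)//.
  have -> : (\int[mu]_p \int[leb]_s (h (p, s))%:E =
      \int[mu]_p (C * lambda * t * (levy_gauge alpha (radius p) * bdlp_weight p))%:E)%E.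
    apply: eq_integral => p _.
    pose c := C * levy_gauge alpha (radius p) * (lambda * bdlp_weight p).
    transitivity (\int[leb]_s (c * (\1_(`[0%R, t[%classic) s))%:E)%E.
      apply: eq_integral => s _; congr EFin; rewrite /h /flow_weight /= indicE mem_setE in_itv /=.
      by rewrite /c; ring.
    under eq_integral do rewrite EFinM.
    rewrite ge0_integralZl//; last 2 first.
    - by apply/measurable_EFinP; exact: measurable_indic.
    - by rewrite lee_fin /c mulr_ge0 ?mulr_ge0// ?bdlp_weight_ge0// ltW.
    rewrite integral_indic// setIT.
    have len : lebesgue_measure `[0%R, t[%classic = t%:E :> \bar R.
      by rewrite lebesgue_measure_itv /= lte_fin t0 oppr0 adde0.
    transitivity (c%:E * t%:E)%E; first by congr (_ * _)%E.
    by rewrite -EFinM /c; congr EFin; ring.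
  have /integrableP[_] := integrable_mulr (C * lambda * t) bdlp_gauge_integrable.
  apply: le_lt_trans; rewrite le_eqVlt; apply/orP; left; apply/eqP; apply: eq_integral => p _.
  by rewrite /= ger0_norm// !mulr_ge0// ltW.
apply: (dominated_integrable_real hi); first exact: measurable_funM.
move=> p; rewrite normrM (ger0_norm (fw0 p)) /h.
have [st|st] := boolP (0 <= p.2 < t); first by rewrite ler_wpM2r// HC.
by rewrite /flow_weight (negbTE st) !mulr0.
Qed.

Lemma enorm_flow_point p : enorm (flow_point p) =
  expR (- (lambda * (t - p.2))) * radius p.1.
Proof. by rewrite enormZ enorm_bdlp_point ger0_norm ?expR_ge0. Qed.

Lemma flow_gauge_le p : 0 <= p.2 < t ->
  levy_gauge alpha (enorm (flow_point p)) <= levy_gauge alpha (radius p.1).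
Proof.
move=> /andP[_ st]; have /andP[e0 e1] := expT_le st.
apply: levy_gauge_mono; first exact: enorm_ge0.
by rewrite enorm_flow_point ler_piMl// radius_ge0.
Qed.

(** Both sides integrate [G] against the same measure, by [flow_image]. *)
Lemma flow_integral (G : V -> R) : measurable_fun setT G ->
  (\int[flow]_p (G (flow_point p) * flow_weight p)%:E =
   \int[mu]_p (G (polar_point p) * trans_density p)%:E)%E.
Proof.
move=> mG.
have [nu nuE] := weighted_image_exists flow mfp mfw fw0.
have <- := @integral_weighted_image _ _ _ _ _ flow flow_point flow_weight mfp mfw fw0 nu nuE G mG.
have nuE' B : measurable B ->
    nu B = (\int[mu]_p (\1_B (polar_point p) * trans_density p)%:E)%E.
  by move=> mB; rewrite nuE//; exact: flow_image.
exact: (@integral_weighted_image _ _ _ _ _ mu (@polar_point R d) trans_density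
  (@measurable_polar_point R d) mtd td0 nu nuE' G mG).
Qed.

(** Contraction decreases the gauge, so integrability comes from the driving
    process. *)
Lemma trans_integrable (G : V -> R) (C : R) : 0 <= C -> measurable_fun setT G ->
  (forall v, `|G v| <= C * levy_gauge alpha (enorm v)) ->
  mu.-integrable setT (EFin \o (fun p => G (polar_point p) * trans_density p)).
Proof.
move=> C0 mG GC; apply/integrableP; split.
  apply/measurable_EFinP/measurable_funM => //.
  by apply: measurableT_comp => //; exact: measurable_polar_point.
under eq_integral do rewrite /= normrM (ger0_norm (td0 _)).
rewrite -(flow_integral (G := fun v => `|G v|)); last exact: measurableT_comp.
have /integrableP[_] : flow.-integrable setT (EFin \o (fun p => G (flow_point p) * flow_weight p)).
  apply: (flow_integrable C0); first exact: measurableT_comp.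
  move=> p st; apply: le_trans (GC _) _; rewrite ler_wpM2l//; exact: flow_gauge_le.
apply: le_lt_trans; rewrite le_eqVlt; apply/orP; left; apply/eqP; apply: eq_integral => p _.
by rewrite /= normrM (ger0_norm (fw0 _)).
Qed.

(** Since [(v e^(lambda t))^(- alpha) = e^(- alpha lambda t) v^(- alpha)], adding
    and subtracting [e^(- alpha lambda t) q v^(- 1 - alpha)] separates a multiple
    of the tempered stable density from the drop of [q]. *)
Lemma trans_density_split p : trans_density p =
  (1 - expR (- (alpha * lambda * t))) * ts_density alpha q p +
  expR (- (alpha * lambda * t)) * jump_density alpha q lambda t p.
Proof.
rewrite /trans_density /ts_density /jump_density !patchE; case: ifPn => [|_].
  move=> /set_mem/polar_setE[s1 p2]; rewrite /tail /q_drop.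
  have -> : (p.2 * expR T) `^ (- alpha) = p.2 `^ (- alpha) * expR (- (alpha * lambda * t)).
    rewrite powRM ?expR_ge0 ?(ltW p2)//; congr (_ * _).
    by rewrite -expRM; congr expR; ring.
  have -> : p.2 `^ (- 1 - alpha) = p.2 `^ (- 1) * p.2 `^ (- alpha).
    by rewrite powRD// (gt_eqF p2) implybT.
  by ring.
by rewrite !mulr0 addr0.
Qed.

Let eaT : 0 < expR (- (alpha * lambda * t)) < 1.
Proof. by rewrite expR_gt0 -expR0 ltr_expR oppr_lt0 !mulr_gt0. Qed.

(** The two summands of [trans_density] are nonnegative, so integrability against
    their sum passes to each of them, even when the total mass of the jump part
    is infinite. *)
Lemma ts_integrable (G : V -> R) (C : R) : 0 <= C -> measurable_fun setT G ->
  (forall v, `|G v| <= C * levy_gauge alpha (enorm v)) ->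
  mu.-integrable setT (EFin \o (fun p => G (polar_point p) *
    ((1 - expR (- (alpha * lambda * t))) * ts_density alpha q p))).
Proof.
move=> C0 mG GC; have /andP[e0 e1] := eaT.
have ts0 p : 0 <= (1 - expR (- (alpha * lambda * t))) * ts_density alpha q p.
  by rewrite mulr_ge0 ?subr_ge0 ?(ltW e1)// ts_density_ge0.
have Gi : mu.-integrable setT (EFin \o (fun p => `|G (polar_point p)| * trans_density p)).
  apply: (trans_integrable (G := fun v => `|G v|) C0); first exact: measurableT_comp.
  by move=> v; rewrite normr_id.
apply: (dominated_integrable_real Gi).
- apply: measurable_funM; last by apply: measurable_funM => //; exact: measurable_ts_density.
  by apply: measurableT_comp => //; exact: measurable_polar_point.
move=> p; rewrite normrM ler_wpM2l// ger0_norm// trans_density_split lerDl mulr_ge0 ?expR_ge0//.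
exact: jump_density_ge0.
Qed.

Lemma jump_integrable (G : V -> R) (C : R) : 0 <= C -> measurable_fun setT G ->
  (forall v, `|G v| <= C * levy_gauge alpha (enorm v)) ->
  mu.-integrable setT (EFin \o (fun p => G (polar_point p) *
    (expR (- (alpha * lambda * t)) * jump_density alpha q lambda t p))).
Proof.
move=> C0 mG GC; have /andP[e0 e1] := eaT.
have j0 p : 0 <= expR (- (alpha * lambda * t)) * jump_density alpha q lambda t p.
  by rewrite mulr_ge0 ?expR_ge0// jump_density_ge0.
have Gi : mu.-integrable setT (EFin \o (fun p => `|G (polar_point p)| * trans_density p)).
  apply: (trans_integrable (G := fun v => `|G v|) C0); first exact: measurableT_comp.
  by move=> v; rewrite normr_id.
apply: (dominated_integrable_real Gi).
- apply: measurable_funM; last first.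
    by apply: measurable_funM => //; exact: measurable_jump_density.
  by apply: measurableT_comp => //; exact: measurable_polar_point.
move=> p; rewrite normrM ler_wpM2l// ger0_norm// trans_density_split lerDr.
by rewrite mulr_ge0 ?subr_ge0 ?(ltW e1)// ts_density_ge0.
Qed.

(** Integrating over time last shows the time integral of the exponent of the
    driving process. *)
Lemma flow_rint (H : V * R * R -> R) (C : R) : 0 <= C -> measurable_fun setT H ->
  (forall p, 0 <= p.2 < t -> `|H p| <= C * levy_gauge alpha (radius p.1)) ->
  rint flow setT (fun p => H p * flow_weight p) =
  rint leb setT (fun s => lambda * rint mu setT (fun p => H (p, s) * bdlp_weight p) *
                          (0 <= s < t)%R%:R).
Proof.
move=> C0 mH HC; have fi := flow_integrable C0 mH HC.
rewrite /rint (@sf_fubini2 _ _ _ _ R mu leb (fun p => H p * flow_weight p))//.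
congr fine; apply: eq_integral => s _.
have [st|st] := boolP (0 <= s < t); last first.
  rewrite mulr0 integral0_eq// => p _; by rewrite /flow_weight /= (negbTE st) !mulr0.
have Hs : mu.-integrable setT (EFin \o (fun p => H (p, s) * bdlp_weight p)).
  apply: (bdlp_integrable (H := fun p => H (p, s)) (C := C)).
    by apply: (measurableT_comp mH); apply: measurable_fun_pair.
  by move=> p; exact: HC.
rewrite mulr1 EFinM fineK; last exact: (integrable_fin_num measurableT Hs).
rewrite -integralZl//; apply: eq_integral => p _; rewrite -EFinM; congr EFin.
by rewrite /flow_weight /= st mulr1; ring.
Qed.

End gauge_integrability.

(** * Riemann sums *)

Section riemann_sums.
Variable R : realType.
Local Notation leb := (@lebesgue_measure R).

Lemma integrable_indic_itv (a b : R) :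
  leb.-integrable setT (EFin \o (\1_(`[a, b[%classic) : R -> R)).
Proof.
apply/integrableP; split; first by apply/measurable_EFinP; exact: measurable_indic.
under eq_integral do rewrite /= ger0_norm//.
rewrite integral_indic// setIT [X in (X < _)%E](lebesgue_measure_itv `[_, _[) /=.
by case: ifP => _; rewrite -?EFinB ltry.
Qed.

Lemma rint_indic_itv (a b : R) : a <= b -> rint leb setT \1_(`[a, b[%classic) = b - a.
Proof.
move=> ab; rewrite /rint integral_indic// setIT.
suff len : lebesgue_measure `[a, b[%classic = (b - a)%:E :> \bar R.
  by transitivity (fine (b - a)%:E); [congr fine|].
rewrite lebesgue_measure_itv /= lte_fin; case: ltP => // ba.
by have -> : b = a; [apply/le_anti; rewrite ab ba|rewrite subrr].
Qed.

Lemma integrable_on_window (phi : R -> R) (t : R) : 0 < t -> continuous phi ->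
  exists M, (forall s, 0 <= s <= t -> `|phi s| <= M) /\
  leb.-integrable setT (EFin \o (fun s => phi s * (0 <= s < t)%R%:R)).
Proof.
move=> t0 cphi.
have cn : {within `[0, t], continuous (fun s => `|phi s|)}.
  apply: continuous_subspaceT => s; apply: continuous_comp; first exact: cphi.
  exact: norm_continuous.
have [c _ Mc] := EVT_max (ltW t0) cn.
exists `|phi c|; split=> [s st|]; first by apply: Mc; rewrite in_itv.
apply: (dominated_integrable_real (integrable_mulr `|phi c| (integrable_indic_itv 0 t))).
  apply: measurable_funM; first exact: continuous_measurable_fun.
  apply: measurableT_comp => //; apply: measurable_and; last exact: measurable_fun_ltr.
  exact: measurable_fun_ler.
move=> s; rewrite indicE mem_setE in_itv /=.
have [/andP[s0 st]|_] := boolP (0 <= s < t); last by rewrite !mulr0 normr0.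
by rewrite !mulr1 Mc// in_itv /= s0 ltW.
Qed.

(** A Riemann sum is the Lebesgue integral of a step function; the step functions
    converge pointwise and are bounded by the maximum of [|phi|]
    on [[0, t]]. *)
Lemma riemann_sum_cvg (phi : R -> R) (t : R) : 0 < t -> continuous phi ->
  (\sum_(k < n.+1) t / n.+1%:R * phi (k%:R * (t / n.+1%:R))) @[n --> \oo] -->
  rint leb setT (fun s => phi s * (0 <= s < t)%R%:R).
Proof.
move=> t0 cphi; pose h (n : nat) : R := t / n.+1%:R.
have h0 n : 0 < h n by rewrite divr_gt0.
have hn n : n.+1%:R * h n = t by rewrite mulrC mulfVK// gt_eqF.
pose F (n k : nat) (s : R) : R :=
  phi (k%:R * h n) * \1_(`[k%:R * h n, k.+1%:R * h n[%classic) s.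
pose step (n : nat) (s : R) := \sum_(k < n.+1) F n k s.
have Fi n k : leb.-integrable setT (EFin \o F n k).
  exact: integrable_mulr (integrable_indic_itv _ _).
have -> : (fun n => \sum_(k < n.+1) t / n.+1%:R * phi (k%:R * (t / n.+1%:R))) =
    (fun n => rint leb setT (step n)).
  apply/funext => n; rewrite (rint_sum (index_enum _) (fun k : 'I_n.+1 => Fi n k)).2; apply: eq_bigr => k _.
  rewrite rintZl; last exact: integrable_indic_itv.
  rewrite rint_indic_itv; last by rewrite ler_pM2r// ler_nat.
  by rewrite -mulrBl -natrB// subSnn mul1r mulrC.
have step_in n s : 0 <= s < t ->
    exists2 c, (0 <= c <= t) && (`|s - c| <= h n) & step n s = phi c.
  move=> /andP[s0 st]; have sh0 : 0 <= s / h n by rewrite divr_ge0// ltW.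
  pose k := Num.truncn (s / h n).
  have [k1 k2] : k%:R * h n <= s /\ s < k.+1%:R * h n.
    have /andP[l u] := truncn_itv sh0.
    by rewrite -ler_pdivlMr// -ltr_pdivrMr.
  have kn : (k < n.+1)%N.
    by rewrite -(ltr_nat R) -(ltr_pM2r (h0 n)) hn (le_lt_trans k1).
  exists (k%:R * h n).
    rewrite mulr_ge0 ?(ltW (h0 n))//= (le_trans k1 (ltW st))/= ger0_norm ?subr_ge0//.
    by rewrite lerBlDl -[k%:R * _ + _]/(k%:R * h n + h n) -[X in _ + X]mul1r -mulrDl natr1 ltW.
  rewrite /step (bigD1 (Ordinal kn))//= big1 ?addr0; last first.
    move=> i ik; rewrite /F indicE mem_setE in_itv /=.
    suff -> : (i%:R * h n <= s < i.+1%:R * h n) = false by rewrite mulr0.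
    apply/negP => /andP[i1 i2]; move: ik; rewrite -val_eqE /= => /negP; apply.
    have ik : (i < k.+1)%N by rewrite -(ltr_nat R) -(ltr_pM2r (h0 n)) (le_lt_trans i1 k2).
    have ki : (k < i.+1)%N by rewrite -(ltr_nat R) -(ltr_pM2r (h0 n)) (le_lt_trans k1 i2).
    by rewrite eqn_leq -ltnS ik -ltnS ki.
  by rewrite /F indicE mem_setE in_itv /= k1 k2 mulr1.
have step_out n s : ~~ (0 <= s < t) -> step n s = 0.
  move=> st; rewrite /step big1// => k _; rewrite /F indicE mem_setE in_itv /=.
  suff -> : (k%:R * h n <= s < k.+1%:R * h n) = false by rewrite mulr0.
  apply/negP => /andP[i1 i2]; move/negP: st; apply; apply/andP; split.
    by apply: le_trans i1; rewrite mulr_ge0// ltW.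
  by apply: lt_le_trans i2 _; rewrite -(hn n) ler_pM2r// ler_nat.
have [M [MM _]] := integrable_on_window t0 cphi.
apply: (rint_dominated (integrable_mulr M (integrable_indic_itv 0 t))).
- move=> n; apply/measurable_EFinP; have [/measurable_int] := rint_sum (index_enum _) (fun k : 'I_n.+1 => Fi n k).
  exact.
- move=> s; have [st|st] := boolP (0 <= s < t); last first.
    under eq_fun do rewrite step_out//; rewrite mulr0; exact: cvg_cst.
  rewrite mulr1; apply/cvgrPdist_le => e e0.
  have /cvgrPdist_le/(_ e e0)[d /= d0 dP] := cphi s.
  have hd : \forall n \near \oo, h n < d.
    have td : 0 < d / t by rewrite divr_gt0.
    have := near_infty_natSinv_lt (PosNum td); apply: filterS => n /=.
    by rewrite ltr_pdivlMr// mulrC.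
  near=> n; have [c /andP[_ ch] ->] := step_in n s st.
  apply: dP; apply: le_lt_trans ch _; near: n; exact: hd.
- move=> n s; rewrite indicE mem_setE in_itv /=.
  have [st|st] := boolP (0 <= s < t); last by rewrite step_out// normr0 mulr0.
  by have [c /andP[cI _] ->] := step_in n s st; rewrite mulr1 MM.
Unshelve. all: by end_near. Qed.

(** Substituting [v = e^(- lambda (t - s))]. *)
Lemma exponential_time_integral (lambda t b : R) : 0 < lambda -> 0 < t ->
  expR (- (lambda * t)) <= b -> b <= 1 ->
  (\int[leb]_s (expR (- (lambda * (t - s))) *
     ((0 <= s < t) && (expR (- (lambda * (t - s))) <= b))%R%:R * lambda)%:E =
   (b - expR (- (lambda * t)))%:E)%E.
Proof.
move=> l0 t0 ab b1; set a := expR _ in ab *.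
have a0 : 0 < a by exact: expR_gt0.
pose f (s : R) := expR (- (lambda * (t - s))).
have mf : measurable_fun setT f.
  apply: measurableT_comp => //; apply: measurableT_comp => //; apply: measurable_funM => //.
  exact: measurable_funB.
have [nu nuE] := weighted_image_exists leb (w := fun=> lambda) mf (measurable_cst _) (fun=> ltW l0).
pose g (v : R) : R := v * ((a <= v < 1) && (v <= b))%R%:R.
have mg : measurable_fun setT g.
  apply: measurable_funM => //; apply: measurableT_comp => //; apply: measurable_and.
    by apply: measurable_and; [exact: measurable_fun_ler|exact: measurable_fun_ltr].
  exact: measurable_fun_ler.
have E1 := @integral_weighted_image _ _ _ _ _ leb f (fun=> lambda) mf
  (measurable_cst _) (fun=> ltW l0) nu nuE g mg.
have w0 (v : R) : 0 <= v `^ (-1) * (0 < v)%R%:R by rewrite mulr_ge0// powR_ge0.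
have mw : measurable_fun setT (fun v : R => v `^ (-1) * (0 < v)%R%:R).
  apply: measurable_funM; first exact: measurable_powR.
  by apply: measurableT_comp => //; exact: measurable_fun_ltr.
have nuE' B : measurable B ->
    nu B = (\int[leb]_v (\1_B v * (v `^ (-1) * (0 < v)%R%:R))%:E)%E.
  move=> mB; rewrite nuE// -(exponential_flow_measure t ltr01 l0)//.
  by apply: eq_integral => s _; rewrite mul1r.
have E2 := @integral_weighted_image _ _ _ _ _ leb (@id R) (fun v : R => v `^ (-1) * (0 < v)%R%:R)
  (@measurable_id _ _ _) mw w0 nu nuE' g mg.
transitivity (\int[leb]_s (g (f s) * lambda)%:E)%E.
  apply: eq_integral => s _; congr EFin; rewrite /g /f; congr (_ * _%:R * _); congr nat_of_bool.
  rewrite /a ler_expR lerN2 ler_pM2l// -expR0 ltr_expR oppr_lt0 pmulr_rgt0// subr_gt0.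
  by congr (_ && _ && _); apply/idP/idP; lra.
rewrite -E1 E2.
transitivity (\int[leb]_v (1 * ((0 < v) && (a <= v < b))%R%:R)%:E)%E; last first.
  by rewrite integral_set_lt_le ?mul1r// ltW.
apply: (@eq_integral_off_two_points _ _ _ b b).
- exact: measurable_funM.
- apply: measurable_funM => //; apply: measurableT_comp => //; apply: measurable_and.
    exact: measurable_fun_ltr.
  by apply: measurable_and; [exact: measurable_fun_ler|exact: measurable_fun_ltr].
move=> v vb _; rewrite /g mul1r.
have [v0|v0] := ltP 0 v; last by rewrite /= !mulr0.
rewrite mulr1 powR_inv1 ?(ltW v0)// mulrAC mulfV ?gt_eqF// mul1r; congr (_%:R); congr nat_of_bool.
rewrite -andbA /=; congr andb; rewrite le_eqVlt (negbTE vb) /= andbC.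
by have [vb'|//] := ltP v b; rewrite (lt_le_trans vb' b1).
Qed.

End riemann_sums.

(** * The exponent of an Ornstein-Uhlenbeck increment *)

Section vector_integrals.
Context (R : realType) (d : nat) (disp : measure_display) (T : measurableType disp).
Local Notation V := 'rV[R]_d.
Variables (mu : {measure set T -> \bar R}) (phi : T -> V) (w : T -> R).
Hypothesis mphi : measurable_fun setT phi.
Hypothesis mw : measurable_fun setT w.
Hypothesis w0 : forall x, (0 <= w x)%R.

Lemma dot_vint_image (M : set V -> \bar R) (D : set V) (F : V -> V) (z : V) :
  (forall B, measurable B -> M B = \int[mu]_p (\1_B (phi p) * w p)%:E)%E ->
  measurable D -> measurable_fun setT F ->
  (forall j, mu.-integrable setT
     (EFin \o (fun p => F (phi p) ord0 j * \1_D (phi p) * w p))) ->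
  dot z (vint M D F) =
  rint mu setT (fun p => dot z (F (phi p)) * \1_D (phi p) * w p).
Proof.
move=> ME mD mF Fi; rewrite /dot /vint.
pose G j p := z ord0 j * (F (phi p) ord0 j * \1_D (phi p) * w p).
have Gi j : mu.-integrable setT (EFin \o G j) by exact: integrable_mulr.
transitivity (\sum_j rint mu setT (G j)).
  apply: eq_bigr => j _; rewrite mxE rintZl//; congr (_ * _).
  rewrite -(integral_weighted_imageR mphi mw w0 ME (g := fun x => F x ord0 j * \1_D x)).
    have [nu nuE] := weighted_image_exists mu mphi mw w0.
    have MN B : measurable B -> M B = nu B by move=> mB; rewrite ME// nuE.
    rewrite /rint (eq_measurable_integral D _ MN) (eq_measurable_integral setT _ MN).
    rewrite [X in fine X = _]integral_mkcond; congr fine; apply: eq_integral => x _.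
    by rewrite patchE indicE; case: (x \in D); rewrite ?mulr1 ?mulr0.
  apply: measurable_funM; last exact: measurable_indic.
  exact: measurable_coord_comp.
rewrite -(rint_sum (index_enum _) Gi).2; apply: eq_rint => p.
by rewrite -!mulrA !mulr_suml; apply: eq_bigr => j _; rewrite /G !mulrA.
Qed.

End vector_integrals.

Section ou_exponent.
Variables (R : realType) (d : nat) (alpha : R).
Local Notation V := 'rV[R]_d.
Local Notation leb := (@lebesgue_measure R).
Hypothesis alpha0 : 0 < alpha.
Hypothesis alpha2 : alpha < 2.
Variable sigma : {finite_measure set V -> \bar R}.
Variable q : V -> R -> R.
Hypothesis q_borel : measurable_fun (sphere `*` `]0, +oo[ : set (V * R))
  (fun p : V * R => q p.1 p.2).
Hypothesis q01 : forall xi u, sphere xi -> 0 < u -> 0 <= q xi u <= 1.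
Hypothesis q_nonincr : forall xi u v, sphere xi -> 0 < u -> u <= v -> q xi v <= q xi u.
Variables (lambda t : R).
Hypothesis lambda0 : 0 < lambda.
Hypothesis t0 : 0 < t.
Local Notation mu := (polar_measure sigma).
Local Notation radius := (radius alpha q).
Local Notation bdlp_point := (@bdlp_point R d alpha q).
Local Notation bdlp_weight := (@bdlp_weight R d alpha q).
Local Notation flow := (flow_measure sigma).
Local Notation flow_point := (@flow_point R d alpha q lambda t).
Local Notation flow_weight := (@flow_weight R d alpha q lambda t).
Local Notation trans_density := (@trans_density R d alpha q lambda t).
Local Notation T := (lambda * t).
Local Notation decay s := (expR (- (lambda * (t - s)))).

Let mbp : measurable_fun setT bdlp_point.
Proof. exact: measurable_bdlp_point. Qed.

Let mbw : measurable_fun setT bdlp_weight.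
Proof. exact: measurable_bdlp_weight. Qed.

Definition bdlp_re (z : V) : R :=
  rint mu setT (fun p => kernel_re z (bdlp_point p) * bdlp_weight p).
Definition bdlp_im (z : V) : R :=
  rint mu setT (fun p => kernel_im alpha z (bdlp_point p) * bdlp_weight p).

Lemma norm1Z (r : R) (z : V) : norm1 (r *: z) = `|r| * norm1 z.
Proof. by rewrite /norm1 mulr_sumr; apply: eq_bigr => j _; rewrite mxE normrM. Qed.

(** What the real and the imaginary part of the Levy-Khintchine kernel share. *)
Let kint (k : V -> V -> R) :=
  (forall z, measurable_fun setT (k z)) /\
  (forall c z x, norm1 z <= c ->
     `|k z x| <= kernel_const c * levy_gauge alpha (enorm x)).

Let kint_re : kint (@kernel_re R d).
Proof.
split; first by move=> z; exact: measurable_kernel_re.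
by move=> c z x zc; exact: (kernel_bound alpha x zc).1.
Qed.

Let kint_im : kint (@kernel_im R d alpha).
Proof.
split; first by move=> z; exact: measurable_kernel_im.
by move=> c z x zc; exact: (kernel_bound alpha x zc).2.
Qed.

Let kint_integrable k z : kint k ->
  mu.-integrable setT (EFin \o (fun p => k z (bdlp_point p) * bdlp_weight p)).
Proof.
move=> [mk bk]; apply: (bdlp_integrable alpha0 alpha2 sigma q_borel q01 q_nonincr
  (H := fun p => k z (bdlp_point p)) (C := kernel_const (norm1 z))).
  exact: measurableT_comp.
move=> p; rewrite -(enorm_bdlp_point alpha0 q01)//.
exact: bk.
Qed.

Lemma bdlp_exponentE (c z : V) :
  ID_exponent 0 (fun B => lambda%:E * bdlp_levy alpha sigma q B)%E (lambda *: c)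
    (trunc alpha) z =
  Complex (lambda * bdlp_re z) (lambda * (dot c z + bdlp_im z)).
Proof.
have mlw : measurable_fun setT (fun p => lambda * bdlp_weight p).
  exact: measurable_funM.
have lw0 p : 0 <= lambda * bdlp_weight p by rewrite mulr_ge0 ?bdlp_weight_ge0// ltW.
rewrite (@ID_exponentE _ _ alpha _ _ mu bdlp_point (fun p => lambda * bdlp_weight p))//.
  rewrite dotZl mulrDr /bdlp_re /bdlp_im -!rintZl; last 2 first.
  - exact: kint_integrable kint_im.
  - exact: kint_integrable kint_re.
  by congr Complex; last congr (_ + _); apply: eq_rint => p; rewrite mulrCA.
move=> B mB; rewrite (bdlp_levyE sigma alpha0 q_borel q01 q_nonincr mB).
rewrite -ge0_integralZl//.
- by apply: eq_integral => p _; rewrite -EFinM mulrCA.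
- apply/measurable_EFinP/measurable_funM => //.
  by apply: measurableT_comp => //; exact: measurable_indic.
- by move=> p _; rewrite lee_fin mulr_ge0// bdlp_weight_ge0.
- by rewrite lee_fin ltW.
Qed.

Let kint_ray k (z : V) : kint k -> (forall x : V, continuous (fun r : R => k (r *: z) x)) ->
  continuous (fun r : R => rint mu setT (fun p => k (r *: z) (bdlp_point p) * bdlp_weight p)).
Proof.
move=> kk ck r; have [mk bk] := kk.
pose rho := `|r| + 1.
pose C := kernel_const (rho * norm1 z).
have rI : r \in `]- rho, rho[%classic.
  by rewrite mem_setE in_itv /= -ltr_norml ltrDl.
apply: (@continuity_under_integral R _ _ mu
  (fun r p => k (r *: z) (bdlp_point p) * bdlp_weight p) setT measurableT (- rho) rho _ _
  (fun p => C * (levy_gauge alpha (radius p) * bdlp_weight p)) _ _ r rI).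
- by move=> x _; exact: kint_integrable.
- apply: aeW => p _ x _; apply: cvgM; [exact: ck|exact: cvg_cst].
- by apply: integrable_mulr; exact: bdlp_gauge_integrable.
- move=> x; rewrite /= in_itv /= -ltr_norml => /ltW xr.
  apply: aeW => p _; rewrite normrM (ger0_norm (bdlp_weight_ge0 _ _ _)) mulrA.
  rewrite ler_wpM2r ?bdlp_weight_ge0// -(enorm_bdlp_point alpha0 q01)//.
  by apply: bk; rewrite norm1Z ler_wpM2r ?norm1_ge0.
Qed.

Let mulr_continuous (c : R) : continuous (fun r : R => r * c).
Proof. by move=> r; apply: cvgM; [exact: cvg_id|exact: cvg_cst]. Qed.

Lemma bdlp_re_ray (z : V) : continuous (fun r : R => bdlp_re (r *: z)).
Proof.
apply: kint_ray kint_re _ => x.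
have -> : (fun r : R => kernel_re (r *: z) x) = (fun r => cos (r * dot z x) - 1).
  by apply/funext => r; rewrite /kernel_re dotZl.
have cc : continuous (fun r : R => cos (r * dot z x)).
  by move=> r; apply: continuous_comp; [exact: mulr_continuous|exact: continuous_cos].
by move=> r; apply: cvgB; [exact: cc|exact: cvg_cst].
Qed.

Lemma bdlp_im_ray (z : V) : continuous (fun r : R => bdlp_im (r *: z)).
Proof.
apply: kint_ray kint_im _ => x.
have -> : (fun r : R => kernel_im alpha (r *: z) x) =
    (fun r => sin (r * dot z x) - r * (dot z x * trunc alpha x)).
  by apply/funext => r; rewrite /kernel_im dotZl mulrA.
have cs : continuous (fun r : R => sin (r * dot z x)).
  by move=> r; apply: continuous_comp; [exact: mulr_continuous|exact: continuous_sin].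
by move=> r; apply: cvgB; [exact: cs|exact: mulr_continuous].
Qed.

Lemma bdlp_re0 : bdlp_re 0 = 0.
Proof.
rewrite /bdlp_re /rint integral0_eq// => p _.
by rewrite /kernel_re dot0l cos0 subrr mul0r.
Qed.

Lemma bdlp_im0 : bdlp_im 0 = 0.
Proof.
rewrite /bdlp_im /rint integral0_eq// => p _.
by rewrite /kernel_im dot0l sin0 mul0r subrr mul0r.
Qed.

Let decay_le s : s < t -> 0 <= decay s <= 1.
Proof.
by move=> st; rewrite expR_ge0 -expR0 ler_expR oppr_le0 mulr_ge0 ?subr_ge0// ltW.
Qed.

Let mdecay : measurable_fun setT (fun p : V * R * R => decay p.2).
Proof.
apply: measurableT_comp => //; apply: measurableT_comp => //; apply: measurable_funM => //.
by apply: measurable_funB => //; exact: measurable_snd.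
Qed.

Let mbp1 : measurable_fun setT (fun p : V * R * R => bdlp_point p.1).
Proof. exact: (measurableT_comp mbp measurable_fst). Qed.

Let decay_norm1 (z : V) s : s < t -> norm1 (decay s *: z) <= norm1 z.
Proof.
move=> st; have /andP[d0 d1] := decay_le st.
by rewrite norm1Z ger0_norm// ler_piMl// norm1_ge0.
Qed.

Let gauge_enorm p : levy_gauge alpha (enorm (bdlp_point p)) = levy_gauge alpha (radius p).
Proof. by rewrite enorm_bdlp_point. Qed.

(** Time integrals of the exponent of the driving process are integrals over jumps
    and their times. *)
Let kflow k (z : V) : kint k -> measurable_fun setT (fun p : V * R * R => k (decay p.2 *: z) (bdlp_point p.1)) ->
  rint leb setT (fun s => lambda *
    rint mu setT (fun p => k (decay s *: z) (bdlp_point p) * bdlp_weight p) *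
      (0 <= s < t)%R%:R) =
  rint flow setT (fun p => k (decay p.2 *: z) (bdlp_point p.1) * flow_weight p).
Proof.
move=> [mk bk] mH; apply/esym.
apply: (flow_rint alpha0 alpha2 sigma q_borel q01 q_nonincr lambda0 t0
  (H := fun p => k (decay p.2 *: z) (bdlp_point p.1)) (C := kernel_const (norm1 z))) => //.
  exact: kernel_const_ge0 (norm1_ge0 z).
move=> p /andP[_ st]; rewrite -gauge_enorm; apply: bk; exact: decay_norm1.
Qed.

Let flow_re_eq (z : V) p : kernel_re (decay p.2 *: z) (bdlp_point p.1) = kernel_re z (flow_point p).
Proof. by rewrite /kernel_re /flow_point dotZl dotZr. Qed.

(** The contraction can be moved from the frequency to the jump, since
    [<e z, x> = <z, e x>]; then [flow_integral] applies. *)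
Lemma flow_re (z : V) :
  rint leb setT (fun s => lambda * bdlp_re (decay s *: z) * (0 <= s < t)%R%:R) =
  rint mu setT (fun p => kernel_re z (polar_point p) * trans_density p).
Proof.
have mH : measurable_fun setT (fun p : V * R * R => kernel_re (decay p.2 *: z) (bdlp_point p.1)).
  under eq_fun do rewrite flow_re_eq.
  apply: measurableT_comp; first exact: measurable_kernel_re.
  exact: measurable_flow_point.
rewrite (kflow kint_re mH).
transitivity (rint flow setT (fun p => kernel_re z (flow_point p) * flow_weight p)).
  by apply: eq_rint => p; rewrite flow_re_eq.
rewrite /rint (flow_integral alpha0 sigma q_borel q01 q_nonincr lambda0 t0)//.
exact: measurable_kernel_re.
Qed.

(** What the truncation at the Euclidean unit ball loses when it does not
    commute with the contraction of the flow. *)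
Definition flow_correction (z : V) : R :=
  rint flow setT (fun p => decay p.2 * dot z (bdlp_point p.1) *
    (trunc alpha (flow_point p) - trunc alpha (bdlp_point p.1)) * flow_weight p).

Let mcorr (z : V) : measurable_fun setT (fun p : V * R * R => decay p.2 * dot z (bdlp_point p.1) *
  (trunc alpha (flow_point p) - trunc alpha (bdlp_point p.1))).
Proof.
apply: measurable_funM.
  by apply: measurable_funM => //; apply: measurableT_comp mbp1; exact: measurable_dot.
apply: measurable_funB; last first.
  by apply: measurableT_comp mbp1; exact: measurable_trunc.
by apply: measurableT_comp; [exact: measurable_trunc|exact: measurable_flow_point].
Qed.

Let trunc_jump p : 0 <= p.2 < t ->
  trunc alpha (flow_point p) - trunc alpha (bdlp_point p.1) =
  [&& alpha == 1, 1 < radius p.1 & decay p.2 * radius p.1 <= 1]%:R.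
Proof.
move=> /andP[_ st]; have /andP[d0 d1] := decay_le st.
rewrite /trunc (enorm_flow_point alpha0 q01) (enorm_bdlp_point alpha0 q01).
have [a1|a1] := ltP alpha 1; first by rewrite subrr lt_eqF.
have [a1'|a1'] := eqVneq alpha 1; last by rewrite subrr.
have [r1|r1] := leP (radius p.1) 1.
  rewrite ifT ?subrr// (le_trans _ r1)// ler_piMl//.
  by rewrite -(enorm_bdlp_point alpha0 q01) enorm_ge0.
by rewrite subr0 /=; case: (_ <= 1).
Qed.

Let corr_bound (z : V) p : 0 <= p.2 < t ->
  `|decay p.2 * dot z (bdlp_point p.1) *
    (trunc alpha (flow_point p) - trunc alpha (bdlp_point p.1))| <=
  norm1 z * levy_gauge alpha (radius p.1).
Proof.
move=> pt; rewrite (trunc_jump pt).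
have r0 : 0 <= radius p.1 by rewrite -(enorm_bdlp_point alpha0 q01) enorm_ge0.
have [/and3P[/eqP a1 r1 dr]|_] := boolP [&& _, _ & _]; last first.
  by rewrite mulr0 normr0 mulr_ge0 ?norm1_ge0// levy_gauge_ge0.
rewrite (levy_gauge_eq1 a1 (ltW r1)).
rewrite !mulr1 normrM (ger0_norm (expR_ge0 _)).
apply: (@le_trans _ _ (decay p.2 * (norm1 z * radius p.1))).
  by rewrite ler_wpM2l ?expR_ge0// -(enorm_bdlp_point alpha0 q01) dot_le.
by rewrite mulrCA ler_piMr// norm1_ge0.
Qed.

Let flow_im_eq (z : V) p : kernel_im alpha (decay p.2 *: z) (bdlp_point p.1) =
  kernel_im alpha z (flow_point p) + decay p.2 * dot z (bdlp_point p.1) *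
    (trunc alpha (flow_point p) - trunc alpha (bdlp_point p.1)).
Proof. by rewrite /kernel_im /flow_point dotZl dotZr; ring. Qed.

Let mkim (z : V) : measurable_fun setT (fun p : V * R * R => kernel_im alpha z (flow_point p)).
Proof.
by apply: measurableT_comp; [exact: measurable_kernel_im|exact: measurable_flow_point].
Qed.

(** As for [flow_re], except that moving the contraction to the jump also moves
    the argument of the truncation. *)
Lemma flow_im (z : V) :
  rint leb setT (fun s => lambda * bdlp_im (decay s *: z) * (0 <= s < t)%R%:R) =
  rint mu setT (fun p => kernel_im alpha z (polar_point p) * trans_density p) +
  flow_correction z.
Proof.
have mH : measurable_fun setT
    (fun p : V * R * R => kernel_im alpha (decay p.2 *: z) (bdlp_point p.1)).
  by under eq_fun do rewrite flow_im_eq; exact: measurable_funD.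
rewrite (kflow kint_im mH).
have -> : rint mu setT (fun p => kernel_im alpha z (polar_point p) * trans_density p) =
    rint flow setT (fun p => kernel_im alpha z (flow_point p) * flow_weight p).
  rewrite /rint (flow_integral alpha0 sigma q_borel q01 q_nonincr lambda0 t0)//.
  exact: measurable_kernel_im.
rewrite /flow_correction -rintD.
- by apply: eq_rint => p; rewrite flow_im_eq mulrDl.
- apply: (flow_integrable alpha0 alpha2 sigma q_borel q01 q_nonincr lambda0 t0
    (kernel_const_ge0 (norm1_ge0 z))) => // p pt.
  apply: le_trans (kernel_bound alpha (flow_point p) (lexx (norm1 z))).2 _.
  rewrite ler_wpM2l ?kernel_const_ge0 ?norm1_ge0//.
  exact: flow_gauge_le.
- apply: (flow_integrable alpha0 alpha2 sigma q_borel q01 q_nonincr lambda0 t0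
    (norm1_ge0 z)) => // p.
  exact: corr_bound.
Qed.

Lemma flow_correction_neq1 (z : V) : alpha != 1 -> flow_correction z = 0.
Proof.
move=> a1; rewrite /flow_correction /rint integral0_eq// => p _.
have [pt|pt] := boolP (0 <= p.2 < t); last by rewrite /flow_weight (negbTE pt) !mulr0.
by rewrite trunc_jump// (negbTE a1) mulr0 mul0r.
Qed.

Let shell : set V := [set x | 1 < enorm x <= expR T].

(** A jump of size [r > 1] is not compensated by the driving process, but its
    contraction has size at most [1] at the times [s] with
    [e^(- lambda (t - s)) <= 1 / r]. The integral of [lambda e^(- lambda (t - s))]
    over these times in [[0, t]] is [1 / r - e^(- lambda t)] if
    [r <= e^(lambda t)]; otherwise there are none. *)
Lemma flow_correction1 (z : V) : alpha = 1 -> flow_correction z =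
  dot z (vint (bdlp_levy alpha sigma q) [set x | 1 < enorm x <= expR T]
           (fun x => ((enorm x)^-1 - expR (- T)) *: x)).
Proof.
move=> a1; pose F (x : V) := ((enorm x)^-1 - expR (- T)) *: x.
have eT0 : 0 < expR T by exact: expR_gt0.
have mshell : measurable shell.
  rewrite (_ : shell = [set x | 1 < enorm x] `&` [set x | enorm x <= expR T]); last first.
    by rewrite /shell; apply/seteqP; split=> x /=; [move=> /andP|move=> [-> ->]].
  by apply: measurableI; [apply: measurable_set_lt|apply: measurable_set_le] => //;
    exact: measurable_enorm.
have mF : measurable_fun setT F.
  apply: measurable_vecZ => //; apply: measurable_funB => //.
  rewrite (_ : (fun x : V => (enorm x)^-1) = (fun x => enorm x `^ (- 1))); last first.
    by apply/funext => x; rewrite powR_inv1// enorm_ge0.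
  apply: (measurableT_comp (f := fun v : R => v `^ (- 1))); first exact: measurable_powR.
  exact: measurable_enorm.
rewrite (@dot_vint_image _ _ _ _ mu bdlp_point bdlp_weight mbp mbw (bdlp_weight_ge0 _ _)
  (bdlp_levy alpha sigma q) shell F z _ mshell mF); first last.
- move=> j; apply: (bdlp_integrable alpha0 alpha2 sigma q_borel q01 q_nonincr
    (H := fun p => F (bdlp_point p) ord0 j * \1_shell (bdlp_point p)) (C := 1)).
    apply: measurable_funM.
      by apply: measurable_coord_comp; exact: measurableT_comp.
    by apply: measurableT_comp mbp; exact: measurable_indic.
  move=> p; rewrite mul1r indicE.
  have r0 : 0 <= radius p by rewrite -(enorm_bdlp_point alpha0 q01) enorm_ge0.
  have [/set_mem/=/andP[r1 rT]|_] := boolP (_ \in shell); last first.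
    by rewrite mulr0 normr0 levy_gauge_ge0.
  rewrite (enorm_bdlp_point alpha0 q01) in r1 rT.
  have rp : 0 < radius p by exact: lt_trans r1.
  rewrite (levy_gauge_eq1 a1 (ltW r1)).
  rewrite mulr1; apply: le_trans (coord_le_enorm _ _) _.
  rewrite enormZ (enorm_bdlp_point alpha0 q01) ger0_norm.
    rewrite mulrBl mulVf ?gt_eqF// lerBlDr lerDl mulr_ge0// expR_ge0.
  by rewrite subr_ge0 expRN lef_pV2 ?posrE.
- by move=> B mB; exact: bdlp_levyE.
have ci : flow.-integrable setT (EFin \o (fun p => decay p.2 * dot z (bdlp_point p.1) *
    (trunc alpha (flow_point p) - trunc alpha (bdlp_point p.1)) * flow_weight p)).
  apply: (flow_integrable alpha0 alpha2 sigma q_borel q01 q_nonincr lambda0 t0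
    (norm1_ge0 z)) => // p; exact: corr_bound.
rewrite /flow_correction /rint (@sf_fubini1 _ _ _ _ R mu leb _ ci); congr fine.
apply: eq_integral => p _ /=.
pose a := dot z (bdlp_point p) * bdlp_weight p.
pose c := (1 < radius p)%R%:R : R.
pose k (s : R) : R :=
  decay s * ((0 <= s < t) && (decay s <= (radius p)^-1))%R%:R * lambda.
have k0 s : 0 <= k s by rewrite !mulr_ge0 ?expR_ge0// ltW.
transitivity (\int[leb]_s ((a * c) * k s)%:E)%E.
  apply: eq_integral => s _; congr EFin; rewrite /flow_weight /= /k.
  have [st|st] := boolP (0 <= s < t); last by rewrite !mulr0 mul0r mulr0.
  rewrite (trunc_jump (p := (p, s)) st) (introT eqP a1) /= /c.
  have [r1|r1] := ltP 1 (radius p); last by rewrite /= !mulr0 !mul0r.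
  rewrite /= -ler_pdivlMr ?mul1r; last exact: lt_trans r1.
  by rewrite /a; ring.
rewrite (_ : dot z (F (bdlp_point p)) * _ * _ =
    (a * c) * (((radius p)^-1 - expR (- T)) * (radius p <= expR T)%R%:R)); last first.
  rewrite /F dotZr (enorm_bdlp_point alpha0 q01) indicE.
  have -> : (bdlp_point p \in shell) = (1 < radius p) && (radius p <= expR T).
    by apply/idP/idP => [/set_mem|?]; [|apply/mem_set]; rewrite /shell /= (enorm_bdlp_point alpha0 q01).
  by rewrite /a /c -mulnb natrM; ring.
have mk : measurable_fun setT k.
  have mdec : measurable_fun setT (fun s : R => decay s).
    apply: measurableT_comp => //; apply: measurableT_comp => //; apply: measurable_funM => //.
    exact: measurable_funB.
  apply: measurable_funM => //; apply: measurable_funM => //; apply: measurableT_comp => //.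
  apply: measurable_and; last exact: measurable_fun_ler.
  by apply: measurable_and; [exact: measurable_fun_ler|exact: measurable_fun_ltr].
have [c0|c0] := ltP 1 (radius p); last first.
  have -> : c = 0 by rewrite /c ltNge c0.
  by rewrite mulr0 mul0r integral0_eq// => s _; rewrite mul0r.
have rp : 0 < radius p by exact: lt_trans c0.
have ik : (\int[leb]_s (k s)%:E =
    (((radius p)^-1 - expR (- T)) * (radius p <= expR T)%R%:R)%:E)%E.
  have [rT|rT] := leP (radius p) (expR T).
    rewrite mulr1 /k exponential_time_integral//.
      by rewrite expRN lef_pV2 ?posrE.
    by rewrite invf_le1// ltW.
  rewrite mulr0 integral0_eq// => s _; rewrite /k.
  have [/andP[s0 st]|_] := boolP (0 <= s < t); last by rewrite mulr0 mul0r.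
  rewrite leNgt (_ : _ < _) ?mulr0 ?mul0r//.
  apply: (@lt_le_trans _ _ (expR (- T))); first by rewrite expRN ltf_pV2 ?posrE.
  by rewrite ler_expR lerN2 ler_pM2l// lerBlDr lerDl.
have kint_k : leb.-integrable setT (EFin \o k).
  apply/integrableP; split; first exact/measurable_EFinP.
  by under eq_integral do rewrite /= ger0_norm//; rewrite ik ltry.
under eq_integral do rewrite EFinM.
by rewrite integralZl// ik -EFinM.
Qed.

(** The Riemann sums converge to the time integrals computed by [flow_re] and
    [flow_im]; the linear term of the exponent integrates to
    [(1 - e^(- lambda t)) c]. *)
Lemma ou_exponent (c z : V) :
  ccvg (fun n => \sum_(k < n.+1) real_complex R (t / n.+1%:R) *
      ID_exponent 0 (fun B => lambda%:E * bdlp_levy alpha sigma q B)%E (lambda *: c)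
        (trunc alpha) (decay (k%:R * (t / n.+1%:R)) *: z))
    (Complex (rint mu setT (fun p => kernel_re z (polar_point p) * trans_density p))
       ((1 - expR (- T)) * dot c z +
        (rint mu setT (fun p => kernel_im alpha z (polar_point p) * trans_density p) +
         flow_correction z))).
Proof.
have cdec : continuous (fun s : R => decay s).
  have ce : continuous (fun s : R => - (lambda * (t - s))).
    move=> s; apply: cvgN; apply: cvgM; first exact: cvg_cst.
    by apply: cvgB; [exact: cvg_cst|exact: cvg_id].
  by move=> s; apply: continuous_comp; [exact: ce|exact: continuous_expR].
pose phi_re (s : R) := lambda * bdlp_re (decay s *: z).
pose phi1 (s : R) := lambda * decay s * dot c z.
pose phi2 (s : R) := lambda * bdlp_im (decay s *: z).
have comp (g : R -> R) : continuous g -> continuous (fun s : R => lambda * g (decay s)).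
  move=> cg; have cgd : continuous (fun s : R => g (decay s)).
    by move=> s; apply: continuous_comp; [exact: cdec|exact: cg].
  by move=> s; apply: cvgM; [exact: cvg_cst|exact: cgd].
have cre : continuous phi_re := comp _ (@bdlp_re_ray z).
have cim : continuous phi2 := comp _ (@bdlp_im_ray z).
have c1 : continuous phi1.
  have cl : continuous (fun s : R => lambda * decay s) := comp id (fun r => cvg_id).
  by move=> s; apply: cvgM; [exact: cl|exact: cvg_cst].
have sumE n : \sum_(k < n.+1) real_complex R (t / n.+1%:R) *
      ID_exponent 0 (fun B => lambda%:E * bdlp_levy alpha sigma q B)%E (lambda *: c)
        (trunc alpha) (decay (k%:R * (t / n.+1%:R)) *: z) =
    Complex (\sum_(k < n.+1) t / n.+1%:R * phi_re (k%:R * (t / n.+1%:R)))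
      (\sum_(k < n.+1) t / n.+1%:R * (phi1 (k%:R * (t / n.+1%:R)) + phi2 (k%:R * (t / n.+1%:R)))).
  have addC (x y x' y' : R) : Complex x y + Complex x' y' = Complex (x + x') (y + y') by [].
  have mulC (r x y : R) : real_complex R r * Complex x y = Complex (r * x) (r * y).
    apply: complex_eq.
      by transitivity (r * x - 0 * y : R); [|rewrite mul0r subr0].
    by transitivity (r * y + 0 * x : R); [|rewrite mul0r addr0].
  apply: (big_ind3 (fun u x y => u = Complex x y)) => //.
    by move=> _ x1 y1 _ x2 y2 -> ->; rewrite addC.
  move=> k _; rewrite bdlp_exponentE /phi_re /phi1 /phi2 dotZr.
  rewrite mulC; congr Complex; ring.
split.
  under eq_fun do rewrite sumE /=.
  rewrite -flow_re; exact: riemann_sum_cvg.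
have cv : (\sum_(k < n.+1) t / n.+1%:R * (phi1 (k%:R * (t / n.+1%:R)) +
    phi2 (k%:R * (t / n.+1%:R)))) @[n --> \oo] -->
    rint leb setT (fun s => (phi1 s + phi2 s) * (0 <= s < t)%R%:R).
  by apply: (riemann_sum_cvg (phi := fun s => phi1 s + phi2 s)) => // s; apply: cvgD; [exact: c1|exact: cim].
suff E : (1 - expR (- T)) * dot c z +
    (rint mu setT (fun p => kernel_im alpha z (polar_point p) * trans_density p) +
     flow_correction z) = rint leb setT (fun s => (phi1 s + phi2 s) * (0 <= s < t)%R%:R).
  by move: cv; rewrite -E => cv; under eq_fun do rewrite sumE; exact: cv.
rewrite -flow_im; have [_ [_ i1]] := integrable_on_window t0 c1.
have [_ [_ i2]] := integrable_on_window t0 cim.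
have -> : (1 - expR (- T)) * dot c z = rint leb setT (fun s => phi1 s * (0 <= s < t)%R%:R).
  have E (s : R) : phi1 s * (0 <= s < t)%R%:R =
      dot c z * (decay s * ((0 <= s < t) && (decay s <= 1))%R%:R * lambda).
    have [/andP[s0 st]|_] := boolP (0 <= s < t); last by rewrite !mulr0 mul0r mulr0.
    by have /andP[_ ->] := decay_le st; rewrite /phi1 /=; ring.
  have ki : leb.-integrable setT (EFin \o (fun s : R =>
      decay s * ((0 <= s < t) && (decay s <= 1))%R%:R * lambda)).
    apply/integrableP; split.
      apply/measurable_EFinP; apply: measurable_funM => //; apply: measurable_funM.
        exact: continuous_measurable_fun.
      apply: measurableT_comp => //; apply: measurable_and.
        by apply: measurable_and; [exact: measurable_fun_ler|exact: measurable_fun_ltr].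
      apply: measurable_fun_ler => //; exact: continuous_measurable_fun.
    under eq_integral do rewrite /= ger0_norm ?mulr_ge0 ?expR_ge0 ?(ltW lambda0)//.
    rewrite exponential_time_integral ?ltry//.
    by rewrite -expR0 ler_expR oppr_le0 mulr_ge0// ltW.
  transitivity (rint leb setT (fun s : R => dot c z *
      (decay s * ((0 <= s < t) && (decay s <= 1))%R%:R * lambda))); last first.
    by apply/esym; apply: eq_rint => s; exact: E.
  rewrite rintZl// mulrC; congr (_ * _).
  rewrite /rint exponential_time_integral//.
  by rewrite -expR0 ler_expR oppr_le0 mulr_ge0// ltW.
by rewrite -(rintD i1 i2); apply: eq_rint => s; rewrite mulrDl.
Qed.

End ou_exponent.

(** * The transition law *)

Section laws.
Variables (R : realType) (d : nat).
Local Notation V := 'rV[R]_d.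

Definition rv_of (disp : measure_display) (T : measurableType disp) (P : probability T R)
    (U : T -> V) (mU : measurable_fun setT U) : {RV P >-> V} :=
  HB.pack U (isMeasurableFun.Build _ _ _ _ U mU).

Lemma eq_law_of_cfun (d1 d2 : measure_display) (T1 : measurableType d1)
    (T2 : measurableType d2) (P1 : probability T1 R) (P2 : probability T2 R)
    (U1 : T1 -> V) (U2 : T2 -> V) :
  measurable_fun setT U1 -> measurable_fun setT U2 ->
  (forall z, cfun P1 U1 z = cfun P2 U2 z) ->
  forall B, measurable B -> P1 [set w | B (U1 w)] = P2 [set w | B (U2 w)].
Proof.
move=> m1 m2 U12 B mB.
apply: (charfun_inj (mu := distribution P1 (rv_of P1 m1)) (nu := distribution P2 (rv_of P2 m2))) => //.
by move=> z; rewrite (charfun_law (P := P1) _ m1)// (charfun_law (P := P2) _ m2).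
Qed.

Lemma cfun_shift (disp : measure_display) (T : measurableType disp) (P : probability T R)
    (m : V) (X : T -> V) z : measurable_fun setT X ->
  cfun P (fun w => m + X w) z = cis (dot z m) * cfun P X z.
Proof.
move=> mX; rewrite /cfun.
have -> : (fun w => cis (dot z (m + X w))) = (fun w => cis (dot z m) * cis (dot z (X w))).
  by apply/funext => w; rewrite dotDr cisD.
apply: cintZ; apply: cbounded_integrable; last exact: cbounded_cis.
by apply: cmeasurable_cis; exact: measurable_dotl.
Qed.

End laws.

Section transition.
Context (R : realType) (disp : measure_display) (T : measurableType disp).
Variables (P : probability T R) (d : nat).
Local Notation V := 'rV[R]_d.
Variables (lambda : R) (Z Y : R -> {RV P >-> V}).

Lemma sigma_processT (X : R -> {RV P >-> V}) J : sigma_process X J setT.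
Proof.
have [s0 sC _] := smallest_sigma_algebra setT (\bigcup_(r in J) g_sigma_algebra_preimage (X r)).
by have := sC _ s0; rewrite setD0.
Qed.

(** The Ornstein-Uhlenbeck equation is affine in the initial value, so the
    process started from the constant [y] lives on the same space and has the
    same transition function. *)
Lemma ou_transition_law (Pt : R -> R.-pker V ~> V) (t : R) (y : V) :
  is_OU lambda Z Y -> is_OU_transition lambda Z Pt -> 0 < t ->
  forall B, measurable B -> Pt t y B =
    P [set w | B (expR (- (lambda * t)) *: y +
                  (Y t w - expR (- (lambda * t)) *: Y 0 w))].
Proof.
move=> [l0 levyZ indep stoch] [_ markov] t0 B mB.
pose U (u : R) (w : T) : V := expR (- (lambda * u)) *: y +
  (Y u w - expR (- (lambda * u)) *: Y 0 w).
have mU u : measurable_fun setT (U u).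
  apply: measurable_vecD; first exact: measurable_cst.
  apply: measurable_vecB; first exact: measurable_funPT.
  by apply: measurable_vecZ; [exact: measurable_cst|exact: measurable_funPT].
pose Y' (u : R) : {RV P >-> V} := rv_of P (mU u).
have Y'0 w : Y' 0 w = y.
  by rewrite /Y' /= /U mulr0 oppr0 expR0 !scale1r subrr addr0.
have ouY' : is_OU lambda Z Y'.
  split; [exact: l0|exact: levyZ| |]; last first.
    move=> u u0; have := stoch u u0; congr (is_stoch_integral _ _ _ _ _).
    by apply/funext => w; rewrite Y'0 /Y' /= /U addrAC subrr add0r.
  (* The initial value is constant, hence independent of everything. *)
  have triv A : g_sigma_algebra_preimage (Y' 0) A -> A = set0 \/ A = setT.
    move=> [C mC <-]; have [yC|yC] := pselect (C y); [right|left]; apply/seteqP; split => // w.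
      have Cw : C (Y' 0 w) by rewrite Y'0.
      by [].
    by move=> [_ Cw]; apply: yC; rewrite -(Y'0 w).
  pose E (b : bool) := if b then g_sigma_algebra_preimage (Y' 0)
                       else sigma_process Z [set r | 0 <= r].
  have pairE (A C : set T) : E true A -> E false C -> P (A `&` C) = (P A * P C)%E.
    move=> /triv[->|->] _.
      by rewrite set0I !measure0 mul0e.
    by rewrite setTI probability_setT mul1e.
  (* A duplicate-free list of booleans has at most two entries. *)
  move=> [|a [|a' [|a'' s]]] A us EA.
  - by rewrite big_nil (_ : [set` [::]] = set0) ?bigcap_set0 ?probability_setT//; apply/seteqP; split.
  - rewrite big_seq1 (_ : [set` [:: a]] = [set a]) ?bigcap_set1//.
    by apply/seteqP; split => i /=; rewrite inE => /eqP.
  - rewrite big_cons big_seq1.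
    have -> : \bigcap_(i in [set` [:: a; a']]) A i = A a `&` A a'.
      apply/seteqP; split => [w Aw|w [Aa Aa'] i /=].
        by split; apply: Aw; rewrite /= !inE eqxx ?orbT.
      by rewrite !inE => /orP[/eqP->|/eqP->].
    have Ea := EA a (mem_head _ _).
    have Ea' : E a' (A a') by apply: EA; rewrite !inE eqxx orbT.
    move: us Ea Ea'; rewrite /= inE andbT; case: a {EA}; case: a' => // _ Ea Ea'.
      exact: pairE.
    by rewrite setIC muleC; exact: pairE.
  - move: us; rewrite /= !inE !negb_or => /and4P[/and3P[h1 h2 _] /andP[h3 _] _ _].
    by clear EA; move: h1 h2 h3; case: a; case: a'; case: a''.
(* The Markov property from time [0], on the whole space. *)
have := markov Y' ouY' 0 t (lexx 0) (ltW t0) setT B (@sigma_processT Y' _) mB.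
rewrite add0r setTI => PE.
transitivity (\int[P]_w Pt t (Y' 0%R w) B)%E; last exact: (esym PE).
rewrite (eq_integral (fun=> Pt t y B)); last by move=> w _; rewrite Y'0.
rewrite (integral_cst P measurableT (Pt t y B)) -[LHS]mule1; congr (_ * _)%E.
exact: (esym (probability_setT P)).
Qed.

End transition.

Lemma cis_cexp (R : realType) (x : R) : cis x = cexp (Complex 0 x).
Proof.
rewrite -cisE; congr cexp; apply: complex_eq.
  by transitivity (0 * x - 1 * 0 : R); [|rewrite mul0r mulr0 subrr].
by transitivity (0 * 0 + 1 * x : R); [|rewrite mul0r mul1r add0r].
Qed.

Section ou_law.
Variables (R : realType) (d : nat) (alpha lambda t : R).
Local Notation V := 'rV[R]_d.
Hypothesis alpha0 : 0 < alpha.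
Hypothesis alpha2 : alpha < 2.
Variable sigma : {finite_measure set V -> \bar R}.
Variable q : V -> R -> R.
Hypothesis q_borel : measurable_fun (sphere `*` `]0, +oo[ : set (V * R))
  (fun p : V * R => q p.1 p.2).
Hypothesis q01 : forall xi u, sphere xi -> 0 < u -> 0 <= q xi u <= 1.
Hypothesis q_nonincr : forall xi u v, sphere xi -> 0 < u -> u <= v -> q xi v <= q xi u.
Hypothesis lambda0 : 0 < lambda.
Hypothesis t0 : 0 < t.
Context (disp : measure_display) (T : measurableType disp) (P : probability T R).
Variables (b : V) (Z Y : R -> {RV P >-> V}).
Local Notation mu := (polar_measure sigma).
Local Notation trans_density := (@trans_density R d alpha q lambda t).
Local Notation eT := (expR (- (lambda * t))).

Definition trans_exponent (z : V) : R[i] :=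
  Complex (rint mu setT (fun p => kernel_re z (polar_point p) * trans_density p))
          (rint mu setT (fun p => kernel_im alpha z (polar_point p) * trans_density p)).

(** The drift accumulated by the driving process and the correction for the
    truncation make up the vector [d_alpha]. *)
Lemma dot_trans_drift (z : V) : dot z (trans_drift alpha sigma q lambda t b) =
  (1 - eT) * dot (bdlp_drift alpha sigma q b) z + flow_correction alpha sigma q lambda t z.
Proof.
rewrite /trans_drift /bdlp_drift; have [a1|a1] := eqVneq alpha 1.
  rewrite (flow_correction1 alpha0 alpha2 sigma q_borel q01 q_nonincr lambda0 t0 z a1).
  by rewrite !(dotDr, dotNr, dotZr) dotDl dotNl ![dot _ z]dotC; ring.
by rewrite flow_correction_neq1// addr0 dotZr dotC.
Qed.

(** The increment is a stochastic integral with deterministic integrand, so its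
    characteristic function is given by [stochastic_integral_cfun] and
    [ou_exponent]. *)
Lemma ou_increment_cfun (z : V) : is_TSOU alpha sigma q b lambda Z Y ->
  cfun P (fun w => Y t w - eT *: Y 0 w) z =
  cis (dot z (trans_drift alpha sigma q lambda t b)) * cexp (trans_exponent z).
Proof.
move=> [[_ levyZ _ stoch] Z1].
have E c z' := bdlp_exponentE alpha0 alpha2 sigma q_borel q01 q_nonincr lambda0 c z'.
rewrite (stochastic_integral_cfun levyZ _ _ _ _ t0 (stoch t (ltW t0))
  (ou_exponent alpha0 alpha2 sigma q_borel q01 q_nonincr lambda0 t0 (bdlp_drift alpha sigma q b) z)).
- rewrite dot_trans_drift cis_cexp -cexpD; congr cexp.
  set u := (1 - eT) * _; set f := flow_correction _ _ _ _ _ _.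
  have alg (v : R) : u + (v + f) = u + f + v by ring.
  apply: complex_eq; first by rewrite ReD add0r.
  exact: alg.
- by rewrite E bdlp_re0 bdlp_im0 dotC dot0l addr0 !mulr0.
- move=> z'; split; under eq_fun do rewrite E /=.
  + move=> r; apply: cvgM; first exact: cvg_cst.
    exact: bdlp_re_ray.
  + have c1 : continuous (fun r : R => r * dot (bdlp_drift alpha sigma q b) z').
      by move=> r; apply: cvgM; [exact: cvg_id|exact: cvg_cst].
    have c2 := @bdlp_im_ray _ _ _ alpha0 alpha2 sigma q q_borel q01 q_nonincr z'.
    have c12 : continuous (fun r : R => dot (bdlp_drift alpha sigma q b) (r *: z') +
        bdlp_im alpha sigma q (r *: z')).
      have -> : (fun r : R => dot (bdlp_drift alpha sigma q b) (r *: z') +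
          bdlp_im alpha sigma q (r *: z')) = (fun r => r * dot (bdlp_drift alpha sigma q b) z' +
          bdlp_im alpha sigma q (r *: z')) by apply/funext => r; rewrite dotZr.
      by move=> r; apply: cvgD; [exact: c1|exact: c2].
    by move=> r; apply: cvgM; [exact: cvg_cst|exact: c12].
- by move=> z'; rewrite -(charfun_law (P := P) _ (measurable_funPT (Z 1)) (nu := distribution P (Z 1)))//; exact: Z1.
- apply: measurable_vecB; first exact: measurable_funPT.
  by apply: measurable_vecZ; [exact: measurable_cst|exact: measurable_funPT].
Qed.

End ou_law.

(** * The complex exponential series *)

Section complex_exponential_series.
Variable R : realType.
Implicit Types (u v w : R[i]) (f g : R -> R[i]) (s : R).

Definition cderive f s (df : R[i]) :=
  is_derive s 1 (fun r => complex.Re (f r)) (complex.Re df) /\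
  is_derive s 1 (fun r => complex.Im (f r)) (complex.Im df).

Lemma cderive_eq f s u v : cderive f s u -> u = v -> cderive f s v.
Proof. by move=> ? <-. Qed.

Lemma cderiveD f g s u v : cderive f s u -> cderive g s v ->
  cderive (fun r => f r + g r) s (u + v).
Proof.
move=> [f1 f2] [g1 g2]; split.
  rewrite ReD (_ : (fun _ => _) = (fun r => complex.Re (f r) + complex.Re (g r))).
    exact: is_deriveD.
  by apply/funext => r; rewrite ReD.
rewrite ImD (_ : (fun _ => _) = (fun r => complex.Im (f r) + complex.Im (g r))).
  exact: is_deriveD.
by apply/funext => r; rewrite ImD.
Qed.

Lemma cderiveM f g s u v : cderive f s u -> cderive g s v ->
  cderive (fun r => f r * g r) s (u * g s + f s * v).
Proof.
move=> [f1 f2] [g1 g2]; split.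
  rewrite (_ : (fun _ => _) = (fun r => complex.Re (f r) * complex.Re (g r) -
                                        complex.Im (f r) * complex.Im (g r))); last first.
    by apply/funext => r; rewrite ReM.
  apply: is_derive_eq.
  by rewrite /GRing.scale /= ReD !ReM; ring.
rewrite (_ : (fun _ => _) = (fun r => complex.Re (f r) * complex.Im (g r) +
                                      complex.Im (f r) * complex.Re (g r))); last first.
  by apply/funext => r; rewrite ImM.
apply: is_derive_eq.
by rewrite /GRing.scale /= ImD !ImM; ring.
Qed.

Lemma cderive_cst u s : cderive (fun=> u) s 0.
Proof. by split; exact: is_derive_cst. Qed.

Lemma cderive_real (h : R -> R) s (dh : R) : is_derive s 1 h dh ->
  cderive (fun r => real_complex R (h r)) s (real_complex R dh).
Proof. by move=> dhE; split => //; exact: is_derive_cst. Qed.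

Lemma cderive_cexp w s : cderive (fun r => cexp (real_complex R r * w)) s
  (w * cexp (real_complex R s * w)).
Proof.
have lin (a : R) : is_derive s 1 (fun r => r * a) a.
  by apply: is_derive_eq; rewrite /GRing.scale /= mulr0 mulr1 add0r.
have E : (fun r => cexp (real_complex R r * w)) =
    (fun r => real_complex R (expR (r * complex.Re w)) * cis (r * complex.Im w)).
  apply/funext => r; rewrite cexpE; congr (real_complex R (expR _) * cis _).
    by rewrite ReM Re_real Im_real mul0r subr0.
  by rewrite ImM Re_real Im_real mul0r addr0.
rewrite E.
have d1 : cderive (fun r => real_complex R (expR (r * complex.Re w))) s
    (real_complex R (complex.Re w * expR (s * complex.Re w))).
  by apply: cderive_real; apply: is_derive_eq; rewrite mulrC.
have d2 : cderive (fun r => cis (r * complex.Im w)) s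
    (Complex 0 (complex.Im w) * cis (s * complex.Im w)).
  split; rewrite /cis /=.
    by apply: is_derive_eq; rewrite mul0r sub0r mulNr mulrC.
  by apply: is_derive_eq; rewrite mul0r add0r mulrC.
apply: cderive_eq; first exact: cderiveM d1 d2.
have := congr1 (fun h => h s) E => /= ->.
have -> : w = real_complex R (complex.Re w) + Complex 0 (complex.Im w).
  by apply: complex_eq; rewrite ?ReD ?ImD /= ?addr0 ?add0r.
rewrite rmorphM /=.
rewrite !addr0 !add0r; ring.
Qed.

Definition ctaylor w n s : R[i] := \sum_(k < n) w ^+ k * real_complex R (s ^+ k / k`!%:R).

Lemma cderive_ctaylor w n s : cderive (ctaylor w n.+1) s (w * ctaylor w n s).
Proof.
elim: n => [|n IH].
  rewrite (_ : ctaylor w 1 = (fun=> 1)); last first.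
    by apply/funext => r; rewrite /ctaylor big_ord1 !expr0 fact0 divr1 mulr1.
  by rewrite /ctaylor big_ord0 mulr0; exact: cderive_cst.
rewrite (_ : ctaylor w n.+2 = (fun r => ctaylor w n.+1 r +
    w ^+ n.+1 * real_complex R (r ^+ n.+1 / n.+1`!%:R))); last first.
  by apply/funext => r; rewrite /ctaylor big_ord_recr.
apply: cderive_eq.
  apply: cderiveD; first exact: IH.
  apply: cderiveM; first exact: cderive_cst.
  apply: (@cderive_real _ _ (s ^+ n / n`!%:R)).
  have dX : is_derive s 1 (fun r : R => r ^+ n.+1) (n.+1%:R * s ^+ n).
    by apply: DeriveDef; [exact: exprn_derivable|rewrite exp_derive /GRing.scale /= mulr1].
  apply: is_derive_eq; rewrite /GRing.scale /=.
  rewrite ?mulr0 ?add0r ?addr0 factS natrM invfM.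
  by rewrite mulrACA mulVf ?mul1r 1?mulrC// pnatr_eq0.
by rewrite mul0r add0r [ctaylor w n.+1 s in RHS]/ctaylor big_ord_recr /= mulrDr exprS mulrA.
Qed.

Definition cnorm1 u : R := `|complex.Re u| + `|complex.Im u|.

Lemma cnorm1M u v : cnorm1 (u * v) <= cnorm1 u * cnorm1 v.
Proof.
rewrite /cnorm1 ReM ImM.
have h1 := ler_normB (complex.Re u * complex.Re v) (complex.Im u * complex.Im v).
have h2 := ler_normD (complex.Re u * complex.Im v) (complex.Im u * complex.Re v).
rewrite !normrM in h1 h2; rewrite mulrDl !mulrDr; lra.
Qed.

Lemma cnorm1_ge0 u : 0 <= cnorm1 u. Proof. by rewrite addr_ge0. Qed.

Lemma cnorm1X u n : cnorm1 (u ^+ n) <= cnorm1 u ^+ n.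
Proof.
elim: n => [|n IH]; first by rewrite !expr0 /cnorm1 /= normr1 normr0 addr0.
rewrite !exprS; apply: le_trans (cnorm1M _ _) _.
by rewrite ler_wpM2l// cnorm1_ge0.
Qed.

Lemma cnorm1_real (a : R) : cnorm1 (real_complex R a) = `|a|.
Proof. by rewrite /cnorm1 /= normr0 addr0. Qed.

(** Differentiating [cexp (- s w) * ctaylor w n s] in [s] leaves only the last
    term of the Taylor polynomial, and this tends to [0] uniformly on [[0, 1]]. *)
Lemma ccvg_ctaylor w : ccvg (fun n => ctaylor w n.+1 1) (cexp w).
Proof.
pose h n s := cexp (real_complex R s * - w) * ctaylor w n.+1 s.
pose dh n s := - (w ^+ n.+1 * real_complex R (s ^+ n / n`!%:R)) * cexp (real_complex R s * - w).
have dhE n s : cderive (h n) s (dh n s).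
  apply: cderive_eq; first by apply: cderiveM; [exact: cderive_cexp|exact: cderive_ctaylor].
  rewrite /dh /ctaylor big_ord_recr /= exprS; ring.
pose M := cnorm1 w; pose C := 2 * expR `|complex.Re w|.
have bound n s : `|s| <= 1 -> cnorm1 (dh n s) <= C * M * (M ^+ n / n`!%:R).
  move=> s1; apply: le_trans (cnorm1M _ _) _.
  have -> : cnorm1 (- (w ^+ n.+1 * real_complex R (s ^+ n / n`!%:R))) =
      cnorm1 (w ^+ n.+1 * real_complex R (s ^+ n / n`!%:R)).
    by rewrite /cnorm1 ReN ImN !normrN.
  have b1 : cnorm1 (w ^+ n.+1 * real_complex R (s ^+ n / n`!%:R)) <= M ^+ n.+1 / n`!%:R.
    apply: le_trans (cnorm1M _ _) _; apply: ler_pM; rewrite ?cnorm1_ge0//.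
      exact: cnorm1X.
    rewrite cnorm1_real normrM normfV normrX (ger0_norm (ler0n _ _)).
    by rewrite -[leRHS]mul1r ler_wpM2r ?invr_ge0// exprn_ile1.
  have b2 : cnorm1 (cexp (real_complex R s * - w)) <= C.
    rewrite cexpE; apply: le_trans (cnorm1M _ _) _.
    rewrite cnorm1_real ger0_norm ?expR_ge0// /C mulrC.
    apply: ler_pM; rewrite ?cnorm1_ge0 ?expR_ge0//.
      rewrite /cnorm1; have [c1 c2] := cis_bounds (complex.Im (real_complex R s * - w)).
      by rewrite /=; lra.
    rewrite ler_expR ReM Re_real Im_real mul0r subr0 ReN.
    apply: le_trans (ler_norm _) _; rewrite normrM normrN.
    by rewrite -[leRHS]mul1r ler_wpM2r.
  apply: le_trans (ler_pM (cnorm1_ge0 _) (cnorm1_ge0 _) b1 b2) _.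
  by rewrite le_eqVlt; apply/orP; left; apply/eqP; rewrite exprS; ring.
have h0 n : h n 0 = 1.
  rewrite /h mul0r cexp0 mul1r /ctaylor big_ord_recl big1 ?addr0.
    by rewrite !expr0 fact0 divr1 mulr1.
  by move=> i _; rewrite /= expr0n /= mul0r mulr0.
have lim0 : C * M * (M ^+ n / n`!%:R) @[n --> \oo] --> 0.
  rewrite -(mulr0 (C * M)); apply: cvgM; first exact: cvg_cst.
  exact: (cvg_series_cvg_0 (is_cvg_series_exp_coeff M)).
have cvh : ccvg (fun n => h n 1) 1.
  have aux (c : R[i] -> R) : (forall u, `|c u| <= cnorm1 u) ->
      (forall n s, is_derive s 1 (fun r => c (h n r)) (c (dh n s))) ->
      c (h n 1) @[n --> \oo] --> c 1.
    move=> cN cd; apply/cvgrPdist_le => e e0.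
    have /cvgrPdist_le/(_ e e0) := lim0; apply: filterS => n.
    rewrite sub0r normrN => le_e.
    have [x x1 E] := mean_value_between (cd n) 1.
    rewrite h0 mulr1 in E; rewrite -normrN opprB E.
    apply: le_trans (cN _) _; apply: le_trans (bound n x _) _; first by rewrite normr1 in x1.
    exact: le_trans (ler_norm _) le_e.
  split.
    apply: (aux (@complex.Re R)); first by move=> u; rewrite lerDl.
    by move=> n s; have [] := dhE n s.
  apply: (aux (@complex.Im R)); first by move=> u; rewrite lerDr.
  by move=> n s; have [] := dhE n s.
have := ccvg_mul (ccvg_cst (cexp w)) cvh; rewrite mulr1.
have -> // : (fun n => cexp w * h n 1) = (fun n => ctaylor w n.+1 1).
apply/funext => n; rewrite /h mulrA -cexpD.
have -> : w + real_complex R 1 * - w = 0 by rewrite mul1r subrr.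
by rewrite cexp0 mul1r.
Qed.

Lemma ccvg_poisson (kappa : R) (phi : R[i]) : 0 < kappa ->
  ccvg (fun n => \sum_(k < n.+1) real_complex R (poisson_pmf kappa k) * phi ^+ k)
       (cexp (real_complex R kappa * (phi - 1))).
Proof.
move=> k0; have := ccvg_mul (ccvg_cst (real_complex R (expR (- kappa))))
  (ccvg_ctaylor (real_complex R kappa * phi)).
have -> : real_complex R (expR (- kappa)) * cexp (real_complex R kappa * phi) =
    cexp (real_complex R kappa * (phi - 1)).
  have -> : real_complex R (expR (- kappa)) = cexp (real_complex R (- kappa)).
    by rewrite cexpE /= cis0 mulr1.
  by rewrite -cexpD; congr cexp; rewrite rmorphN /=; ring.
have -> // : (fun n => real_complex R (expR (- kappa)) * ctaylor (real_complex R kappa * phi) n.+1 1) =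
  (fun n => \sum_(k < n.+1) real_complex R (poisson_pmf kappa k) * phi ^+ k).
apply/funext => n; rewrite /ctaylor mulr_sumr; apply: eq_bigr => k _.
rewrite /poisson_pmf k0 expr1n mul1r !rmorphM /= exprMn -rmorphXn /=; ring.
Qed.

End complex_exponential_series.

(** * Compound Poisson sums *)

Section compound_sums.
Context (R : realType) (disp : measure_display) (T : measurableType disp).
Variables (P : probability T R) (d : nat).
Local Notation V := 'rV[R]_d.
Variables (N : {RV P >-> nat}) (X : nat -> {RV P >-> V}).

Definition random_sum (k : nat) (w : T) : V := X 0%N w + \sum_(1 <= j < k.+1) X j w.

Lemma measurable_random_sum k : measurable_fun setT (random_sum k).
Proof.
apply: measurable_vecD; first exact: measurable_funPT.
under eq_fun do rewrite big_add1 big_mkord.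
by apply: measurable_vec_sum => i; exact: measurable_funPT.
Qed.

Let mNk k : measurable [set w | N w = k].
Proof.
have : measurable_fun setT N by exact: measurable_funPT.
move=> /(_ measurableT [set k]); by rewrite setTI; apply.
Qed.

Lemma measurable_random_index (S : nat -> T -> V) : (forall k, measurable_fun setT (S k)) ->
  measurable_fun setT (fun w => S (N w) w).
Proof.
move=> mS _ B mB; rewrite setTI.
rewrite (_ : _ @^-1` B = \bigcup_k ([set w | N w = k] `&` S k @^-1` B)).
  apply: bigcupT_measurable => k; apply: measurableI; first exact: mNk.
  by have := mS k measurableT B mB; rewrite setTI.
apply/seteqP; split=> [w Bw|w [k _ [<- Bw]]] //.
by exists (N w).
Qed.

Lemma cint_sum (I : Type) (r : seq I) (F : I -> T -> R[i]) :
  (forall i, cmeasurable (F i)) -> (forall i, cbounded (F i)) ->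
  cint P setT (fun w => \sum_(i <- r) F i w) = \sum_(i <- r) cint P setT (F i).
Proof.
move=> mF bF; have Fi i : cintegrable P (F i) by exact: cbounded_integrable.
suff [//] : cintegrable P (fun w => \sum_(i <- r) F i w) /\
  cint P setT (fun w => \sum_(i <- r) F i w) = \sum_(i <- r) cint P setT (F i).
elim: r => [|i r [IHi IH]].
  have E : (fun w => \sum_(i <- [::]) F i w) = (fun=> 0) by apply/funext => w; rewrite big_nil.
  rewrite E big_nil; split.
    by apply: cbounded_integrable; [exact: cmeasurable_cst|exact: cbounded_cst].
  by rewrite /cint /rint /= !integral0.
have E : (fun w => \sum_(j <- i :: r) F j w) = (fun w => F i w + \sum_(j <- r) F j w).
  by apply/funext => w; rewrite big_cons.
by rewrite E big_cons -IH; split; [exact: cintegrableD|exact: cintD].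
Qed.

Hypothesis indep : independent_systems P (fun i : option nat =>
  if i is Some j then g_sigma_algebra_preimage (X j) else g_sigma_algebra_preimage N).

Let wave (z : V) (i : option nat) (w : T) : R[i] :=
  if i is Some j then cis (dot z (X j w)) else 1.

Let cmeasurable_wave z i : cmeasurable (wave z i).
Proof.
case: i => [j|]; last exact: cmeasurable_cst.
by apply: cmeasurable_cis; apply: measurable_dotl; exact: measurable_funPT.
Qed.

Let cbounded_wave z i : cbounded (wave z i).
Proof. by case: i => [j|]; [exact: cbounded_cis|exact: cbounded_cst]. Qed.

(** On the event [N = k] the sum has [k] summands, and this event is independent of
    them: the case of [independent_expectation_mixed] with one event. *)
Lemma cint_random_sum_on (z : V) (k : nat) (phi : R[i]) :
  (forall j, (0 < j)%N -> cfun P (X j) z = phi) ->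
  cint P setT (fun w => real_complex R (\1_[set w | N w = k] w) * cis (dot z (random_sum k w))) =
  cfun P (X 0%N) z * phi ^+ k * real_complex R (fine (P [set w | N w = k])).
Proof.
move=> Xphi.
pose E (i : option nat) : set (set T) :=
  if i is Some j then g_sigma_algebra_preimage (X j) else g_sigma_algebra_preimage N.
pose s := [seq Some j | j <- iota 0 k.+1].
pose A (i : option nat) := [set w | N w = k].
have mixed := @independent_expectation_mixed R disp T P _ E (wave z) _ indep _
  (cmeasurable_wave z) (cbounded_wave z) s [:: None] A _ _.
have -> : (fun w => real_complex R (\1_[set w | N w = k] w) * cis (dot z (random_sum k w))) =
    (fun w => real_complex R (\1_(\bigcap_(i in [set` [:: None]]) A i) w) *
              \prod_(i <- s) wave z i w).
  apply/funext => w; congr (real_complex R _ * _).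
    rewrite (_ : [set` [:: None]] = [set None]) ?bigcap_set1//.
    by apply/seteqP; split => i /=; rewrite inE => /eqP.
  rewrite /s big_map /= big_cons /random_sum dotDr cisD; congr (_ * _).
  rewrite dotC /dot.
  have -> : iota 1 k = index_iota 1 k.+1 by rewrite /index_iota subSS subn0.
  rewrite -cis_sum; congr cis.
  rewrite exchange_big /=; apply: eq_bigr => j _.
  by rewrite summxE mulr_suml; apply: eq_bigr => l _; rewrite mulrC.
rewrite mixed.
- rewrite big_seq1 /s big_map /= big_cons; congr (_ * _ * _).
  rewrite (eq_big_seq (fun=> phi)); last first.
    by move=> j; rewrite mem_iota => /andP[j0 _]; exact: Xphi.
  by rewrite big_const_seq count_predT size_iota -Monoid.iteropE.
- by move=> [j|]; apply: preimage_system_measurable; exact: measurable_funPT.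
- move=> [j|].
    apply: (events_in_preimage (X j) (g := fun x => cis (dot z x))).
    by apply: cmeasurable_cis; exact: measurable_dot.
  by apply: (events_in_preimage N (g := fun=> 1)); exact: cmeasurable_cst.
- rewrite /s cats1 rcons_uniq; apply/andP; split.
    by apply/negP => /mapP[j _].
  by rewrite map_inj_uniq ?iota_uniq// => a b [].
- move=> i; rewrite inE => /eqP ->; exists [set k] => //.
  by rewrite setTI.
Qed.

(** Splitting over the values of [N] gives the generating function of the Poisson
    law at the common characteristic function [phi] of the summands. *)
Lemma compound_poisson_cfun (kappa : R) (z : V) (phi : R[i]) : 0 < kappa ->
  (forall k, P [set w | N w = k] = (poisson_pmf kappa k)%:E) ->
  (forall j, (0 < j)%N -> cfun P (X j) z = phi) ->
  cfun P (fun w => random_sum (N w) w) z =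
  cfun P (X 0%N) z * cexp (real_complex R kappa * (phi - 1)).
Proof.
move=> k0 PN Xphi.
pose G (k : nat) (w : T) := real_complex R (\1_[set w | N w = k] w) * cis (dot z (random_sum k w)).
have mS k : cmeasurable (fun w => cis (dot z (random_sum k w))).
  by apply: cmeasurable_cis; apply: measurable_dotl; exact: measurable_random_sum.
have mG k : cmeasurable (G k).
  apply: cmeasurable_mul => //; apply: cmeasurable_real.
  exact: measurable_indic.
have bG k : cbounded (G k).
  apply: cbounded_mul; last exact: cbounded_cis.
  by apply: (cbounded_real (M := 1)) => w; exact: indic_le1.
have GE n w : \sum_(k < n.+1) G k w =
    if (N w < n.+1)%N then cis (dot z (random_sum (N w) w)) else 0.
  have [Nn|Nn] := ltnP (N w) n.+1.
    rewrite (bigD1 (Ordinal Nn))//= big1 ?addr0; last first.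
      move=> i /eqP iN; rewrite /G indicE memNset ?mul0r// => E.
      by apply: iN; apply: val_inj.
    by rewrite /G indicE mem_set// mul1r.
  rewrite big1// => i _; rewrite /G indicE memNset ?mul0r// => /= E.
  by move: Nn; rewrite E leqNgt ltn_ord.
have lhs : ccvg (fun n => cint P setT (fun w => \sum_(k < n.+1) G k w))
    (cfun P (fun w => random_sum (N w) w) z).
  have mGn n : cmeasurable (fun w => \sum_(k < n.+1) G k w).
    have sumRI (m : nat) w : complex.Re (\sum_(k < m) G k w) = \sum_(k < m) complex.Re (G k w) /\
        complex.Im (\sum_(k < m) G k w) = \sum_(k < m) complex.Im (G k w).
      elim: m => [|m [IH1 IH2]]; first by rewrite !big_ord0.
      by rewrite !big_ord_recr /= ReD ImD IH1 IH2.
    split; [under eq_fun do rewrite (sumRI _ _).1|under eq_fun do rewrite (sumRI _ _).2];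
      by apply: measurable_sum => k; have [] := mG k.
  have aux (c : R[i] -> R) : c 0 = 0 -> (forall a, `|c (cis a)| <= 1) ->
      (forall n, measurable_fun setT (fun w => c (\sum_(k < n.+1) G k w))) ->
      rint P setT (fun w => c (\sum_(k < n.+1) G k w)) @[n --> \oo] -->
      rint P setT (fun w => c (cis (dot z (random_sum (N w) w)))).
    move=> c0 c1 mc; apply: (rint_dominated (integrable_cst P 1)) => //.
    - move=> w; apply: cvg_near_cst; exists (N w) => // n /= Nn.
      by rewrite GE ltnS Nn.
    - by move=> n w; rewrite GE; case: ifP => _; rewrite ?c0 ?normr0 ?ler01.
  split; apply: aux => //.
  - by move=> a; exact: (cis_bounds a).1.
  - by move=> n; have [] := mGn n.
  - by move=> a; exact: (cis_bounds a).2.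
  - by move=> n; have [] := mGn n.
have rhs := ccvg_mul (ccvg_cst (cfun P (X 0%N) z)) (ccvg_poisson phi k0).
apply: ccvg_unique lhs _.
have -> // : (fun n => cint P setT (fun w => \sum_(k < n.+1) G k w)) =
  (fun n => cfun P (X 0%N) z * \sum_(k < n.+1) real_complex R (poisson_pmf kappa k) * phi ^+ k).
apply/funext => n; rewrite (cint_sum (index_enum _) (fun k : 'I_n.+1 => mG k) (fun k : 'I_n.+1 => bG k)).
rewrite mulr_sumr; apply: eq_bigr => k _.
by rewrite (cint_random_sum_on k Xphi) PN /= mulrAC mulrA.
Qed.

End compound_sums.

(** * The tempered stable part and the jump part *)

Section jump_part.
Variables (R : realType) (d : nat) (alpha lambda t : R).
Local Notation V := 'rV[R]_d.
Local Notation leb := (@lebesgue_measure R).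
Hypothesis alpha0 : 0 < alpha.
Hypothesis alpha2 : alpha < 2.
Variable sigma : {finite_measure set V -> \bar R}.
Variable q : V -> R -> R.
Hypothesis q_borel : measurable_fun (sphere `*` `]0, +oo[ : set (V * R))
  (fun p : V * R => q p.1 p.2).
Hypothesis q01 : forall xi u, sphere xi -> 0 < u -> 0 <= q xi u <= 1.
Hypothesis q_nonincr : forall xi u v, sphere xi -> 0 < u -> u <= v -> q xi v <= q xi u.
Hypothesis lambda0 : 0 < lambda.
Hypothesis t0 : 0 < t.
Local Notation polar_set := (@polar_set R d).
Local Notation mu := (polar_measure sigma).
Local Notation trans_density := (@trans_density R d alpha q lambda t).
Local Notation ts_density := (@ts_density R d alpha q).
Local Notation jump_density := (@jump_density R d alpha q lambda t).
Local Notation eaT := (expR (- (alpha * lambda * t))).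
Local Notation K := (jump_mass alpha sigma q lambda t).

Let mpp : measurable_fun setT (@polar_point R d).
Proof. exact: measurable_polar_point. Qed.

Let mts : measurable_fun setT ts_density.
Proof. exact: measurable_ts_density. Qed.

Let mjd : measurable_fun setT jump_density.
Proof. exact: measurable_jump_density. Qed.

Let ts0 p : 0 <= ts_density p. Proof. exact: ts_density_ge0. Qed.

Let jd0 p : 0 <= jump_density p. Proof. exact: jump_density_ge0. Qed.

Let c0 : 0 <= 1 - eaT.
Proof. by rewrite subr_ge0 -expR0 ler_expR oppr_le0 !mulr_ge0// ltW. Qed.

Definition ts_exponent (z : V) : R[i] :=
  Complex (rint mu setT (fun p => kernel_re z (polar_point p) * ((1 - eaT) * ts_density p)))
          (rint mu setT (fun p => kernel_im alpha z (polar_point p) * ((1 - eaT) * ts_density p))).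

Definition jump_exponent (z : V) : R[i] :=
  Complex (rint mu setT (fun p => kernel_re z (polar_point p) * (eaT * jump_density p)))
          (rint mu setT (fun p => kernel_im alpha z (polar_point p) * (eaT * jump_density p))).

Lemma trans_exponent_split (z : V) :
  trans_exponent alpha lambda t sigma q z = ts_exponent z + jump_exponent z.
Proof.
have C0 := kernel_const_ge0 (norm1_ge0 z).
have split (G : V -> R) : measurable_fun setT G ->
    (forall v, `|G v| <= kernel_const (norm1 z) * levy_gauge alpha (enorm v)) ->
    rint mu setT (fun p => G (polar_point p) * trans_density p) =
    rint mu setT (fun p => G (polar_point p) * ((1 - eaT) * ts_density p)) +
    rint mu setT (fun p => G (polar_point p) * (eaT * jump_density p)).
  move=> mG GC.
  have i1 := ts_integrable alpha0 alpha2 sigma q_borel q01 q_nonincr lambda0 t0 C0 mG GC.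
  have i2 := jump_integrable alpha0 alpha2 sigma q_borel q01 q_nonincr lambda0 t0 C0 mG GC.
  rewrite -(rintD i1 i2); apply: eq_rint => p.
  by rewrite -mulrDr -trans_density_split.
rewrite /trans_exponent !split; [by []| | | |].
- exact: measurable_kernel_im.
- by move=> v; exact: (kernel_bound alpha v (lexx (norm1 z))).2.
- exact: measurable_kernel_re.
- by move=> v; exact: (kernel_bound alpha v (lexx (norm1 z))).1.
Qed.

(** The scaled set function is itself a finite measure, to which [TS_levyE]
    applies. *)
Lemma TS_levy_scaled B : measurable B ->
  TS_levy alpha (fun A => (1 - eaT)%:E * sigma A)%E q B =
  (\int[mu]_p (\1_B (polar_point p) * ((1 - eaT) * ts_density p))%:E)%E.
Proof.
move=> mB; pose k : {nonneg R} := NngNum c0.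
pose sm : {measure set V -> \bar R} := mscale k sigma.
have fin : fin_num_fun sm.
  by move=> A mA; rewrite /sm /= /mscale fin_numM ?fin_num_measure.
pose s0 : {finite_measure set V -> \bar R} :=
  HB.pack (Measure.sort sm) (Measure_isFinite.Build _ _ _ sm fin).
transitivity (TS_levy alpha s0 q B); first by [].
pose h (p : V * R) : R := \1_B (polar_point p) * ts_density p.
have mh : measurable_fun setT h.
  by apply: measurable_funM => //; apply: measurableT_comp => //; exact: measurable_indic.
have h0 p : 0 <= h p by rewrite mulr_ge0.
rewrite (TS_levyE alpha s0 q_borel q01 mB) (@polar_tonelli _ _ s0 h mh h0).
transitivity ((1 - eaT)%:E * \int[mu]_p (h p)%:E)%E.
  rewrite (@polar_tonelli _ _ sigma h mh h0).
  apply: (ge0_integral_mscale sigma measurableT k).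
    exact: (@sf_tonelli_measurable _ _ _ _ R leb h mh h0).
  by move=> xi _; apply: integral_ge0 => u _; rewrite lee_fin.
rewrite -ge0_integralZl//.
- by apply: eq_integral => p _; rewrite -EFinM mulrCA.
- exact/measurable_EFinP.
- by move=> p _; rewrite lee_fin.
Qed.

Lemma ts_cfun (disp : measure_display) (T : measurableType disp) (P : probability T R)
    (X : {RV P >-> V}) (z : V) :
  is_TS alpha (fun A => (1 - eaT)%:E * sigma A)%E q 0 (distribution P X) ->
  cfun P X z = cexp (ts_exponent z).
Proof.
move=> /(_ z); rewrite (charfun_law (P := P) _ (measurable_funPT X))// => ->.
rewrite (@ID_exponentE _ _ alpha _ _ mu (@polar_point R d) (fun p => (1 - eaT) * ts_density p))//.
- by rewrite dot0l add0r.
- exact: measurable_funM.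
- by move=> p; rewrite mulr_ge0.
- exact: TS_levy_scaled.
Qed.

(** A nonnegative density with integral [0] vanishes almost everywhere. *)
Lemma jump_exponent0 (z : V) : K = 0%E -> jump_exponent z = 0.
Proof.
rewrite (jump_massE alpha sigma q_borel q_nonincr lambda0 t0) => K0.
have ae0 : ae_eq mu setT (fun p => (jump_density p)%:E) (cst 0%E).
  apply/(ae_eq_integral_abs mu measurableT); first exact/measurable_EFinP.
  by rewrite -[RHS]K0; apply: eq_integral => p _; rewrite /= ger0_norm.
have rint0 (G : V -> R) : measurable_fun setT G ->
    rint mu setT (fun p => G (polar_point p) * (eaT * jump_density p)) = 0.
  move=> mG; rewrite /rint (ae_eq_integral (cst 0%E))//.
  - by rewrite integral0.
  - apply/measurable_EFinP; apply: measurable_funM; first exact: measurableT_comp.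
    exact: measurable_funM.
  - by apply: filterS ae0 => p /= /(_ I)[->] _; rewrite !mulr0.
rewrite /jump_exponent !rint0//; [exact: measurable_kernel_im|exact: measurable_kernel_re].
Qed.

Hypothesis Kpos : (0 < K < +oo)%E.

Let KE : (\int[mu]_p (jump_density p)%:E)%E = (fine K)%:E.
Proof.
rewrite -(jump_massE alpha sigma q_borel q_nonincr lambda0 t0) fineK//.
by case/andP: Kpos => K0 Koo; rewrite ge0_fin_numE// ltW.
Qed.

Let fK0 : 0 < fine K.
Proof. by apply: fine_gt0. Qed.

Let jd_integrable : mu.-integrable setT (EFin \o jump_density).
Proof.
apply/integrableP; split; first exact/measurable_EFinP.
under eq_integral do rewrite /= ger0_norm//.
by rewrite KE ltry.
Qed.

Let bounded_jd (G : V -> R) : measurable_fun setT G -> (forall v, `|G v| <= 1) ->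
  mu.-integrable setT (EFin \o (fun p => G (polar_point p) * jump_density p)).
Proof.
move=> mG G1; apply: (dominated_integrable_real jd_integrable).
  by apply: measurable_funM => //; exact: measurableT_comp.
by move=> p; rewrite normrM (ger0_norm (jd0 p)) ler_piMl.
Qed.

Lemma charfun_jump_law (z : V) : charfun (jump_law alpha sigma q lambda t) z =
  Complex ((fine K)^-1 * rint mu setT (fun p => cos (dot z (polar_point p)) * jump_density p))
          ((fine K)^-1 * rint mu setT (fun p => sin (dot z (polar_point p)) * jump_density p)).
Proof.
have mw : measurable_fun setT (fun p => (fine K)^-1 * jump_density p) by exact: measurable_funM.
have w0 p : 0 <= (fine K)^-1 * jump_density p by rewrite mulr_ge0// invr_ge0 ltW.
have ME B : measurable B -> jump_law alpha sigma q lambda t B =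
    (\int[mu]_p (\1_B (polar_point p) * ((fine K)^-1 * jump_density p))%:E)%E.
  move=> mB; rewrite (jump_lawE alpha sigma q_borel q_nonincr lambda0 t0 mB).
  rewrite -ge0_integralZl//.
  - by apply: eq_integral => p _; rewrite -EFinM mulrCA.
  - apply/measurable_EFinP/measurable_funM => //.
    by apply: measurableT_comp => //; exact: measurable_indic.
  - by move=> p _; rewrite lee_fin mulr_ge0.
  - by rewrite lee_fin invr_ge0 ltW.
rewrite charfunE; congr Complex.
  rewrite (@integral_weighted_imageR _ _ _ _ _ mu (@polar_point R d) _ mpp mw w0 _ ME _ (measurable_cos_dot z)).
  rewrite -rintZl; first by apply: eq_rint => p; rewrite mulrCA.
  apply: (bounded_jd (G := fun v => cos (dot z v))); first exact: measurable_cos_dot.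
  by move=> v; exact: (cis_bounds _).1.
rewrite (@integral_weighted_imageR _ _ _ _ _ mu (@polar_point R d) _ mpp mw w0 _ ME _ (measurable_sin_dot z)).
rewrite -rintZl; first by apply: eq_rint => p; rewrite mulrCA.
apply: (bounded_jd (G := fun v => sin (dot z v))); first exact: measurable_sin_dot.
by move=> v; exact: (cis_bounds _).2.
Qed.

Let trunc_norm_le (v : V) : `|trunc alpha v| * enorm v <= 1 + levy_gauge alpha (enorm v).
Proof.
have v0 := enorm_ge0 v; have g0 := levy_gauge_ge0 alpha v0.
rewrite /trunc; have [a1|a1] := ltP alpha 1.
  by rewrite normr0 mul0r; lra.
have [a1'|a1'] := eqVneq alpha 1.
  by case: ifP => v1; rewrite ?normr0 ?normr1; lra.
rewrite normr1 mul1r /levy_gauge ltNge a1 (negbTE a1') /=.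
by case: (leP (enorm v) (enorm v ^+ 2)) => h; nra.
Qed.

(** The truncated identity is at most [1] plus the gauge: [1] is integrable because
    the jump mass is finite, the gauge because it always is. *)
Let truncated_jd (G : V -> R) (c : R) : 0 <= c -> measurable_fun setT G ->
  (forall v, `|G v| <= c * (`|trunc alpha v| * enorm v)) ->
  mu.-integrable setT (EFin \o (fun p => G (polar_point p) * jump_density p)).
Proof.
move=> c1 mG Gc.
have i1 : mu.-integrable setT (EFin \o (fun p => eaT^-1 *
    (levy_gauge alpha (enorm (polar_point p)) * (eaT * jump_density p)))).
  apply: integrable_mulr.
  apply: (jump_integrable alpha0 alpha2 sigma q_borel q01 q_nonincr lambda0 t0
    (G := fun v => levy_gauge alpha (enorm v)) ler01).
    by apply: measurableT_comp; [exact: measurable_levy_gauge|exact: measurable_enorm].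
  by move=> v; rewrite mul1r ger0_norm// levy_gauge_ge0// enorm_ge0.
apply: (dominated_integrable_real (integrable_mulr c (integrable_addr jd_integrable i1))).
  by apply: measurable_funM => //; exact: measurableT_comp.
move=> p; rewrite normrM (ger0_norm (jd0 p)).
have -> : c * (jump_density p + eaT^-1 *
    (levy_gauge alpha (enorm (polar_point p)) * (eaT * jump_density p))) =
    c * (1 + levy_gauge alpha (enorm (polar_point p))) * jump_density p.
  by field; rewrite gt_eqF// expR_gt0.
rewrite ler_wpM2r//; apply: le_trans (Gc _) _.
by rewrite ler_wpM2l.
Qed.

(** The inner integral of [psi] is turned into a real number before the direction
    is integrated; this agrees with the product integral because the inner
    integral is finite in almost every direction. *)
Let psi_coord (j : 'I_d) :
  rint sigma sphere (fun xi => (rint leb `]0, +oo[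
      (fun u => trunc alpha (u *: xi) * q_drop q lambda t xi u * u `^ (- alpha)) *: xi) ord0 j) =
  rint mu setT (fun p => trunc alpha (polar_point p) * polar_point p ord0 j * jump_density p).
Proof.
pose h (p : V * R) : R :=
  trunc alpha (polar_point p) * q_drop q lambda t p.1 p.2 * p.2 `^ (- alpha).
pose H := h \_ polar_set.
have HE p : H p = trunc alpha (polar_point p) * enorm (polar_point p) * jump_density p.
  rewrite /H /jump_density !patchE; case: ifPn => [/set_mem/polar_setE[s1 p2]|_].
    rewrite /h enormZ s1 mulr1 (gtr0_norm p2) powRD ?(gt_eqF p2) ?implybT//.
    by rewrite powR_inv1 ?(ltW p2)//; field; rewrite gt_eqF.
  by rewrite mulr0.
have mtr : measurable_fun setT (fun v : V => trunc alpha v * enorm v).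
  by apply: measurable_funM; [exact: measurable_trunc|exact: measurable_enorm].
have Hi : mu.-integrable setT (EFin \o H).
  rewrite (_ : H = fun p => trunc alpha (polar_point p) * enorm (polar_point p) * jump_density p).
    apply: (truncated_jd (G := fun v => trunc alpha v * enorm v) ler01 mtr) => v.
    by rewrite mul1r normrM (ger0_norm (enorm_ge0 v)).
  by apply/funext => p; exact: HE.
have tr0 (v : V) : 0 <= trunc alpha v.
  by rewrite /trunc; case: ifP => // _; case: ifP => // _; case: ifP.
have H0 p : 0 <= H p by rewrite HE !mulr_ge0 ?enorm_ge0.
have mH : measurable_fun setT H.
  by apply/measurable_EFinP; have /measurable_int := Hi.
pose F (xi : V) : \bar R := (\int[leb]_u (H (xi, u))%:E)%E.
have Fi : sigma.-integrable setT F by exact: (sf_fubini_integrable1 (m1 := sigma) (m2 := leb) Hi).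
have F0 xi : (0 <= F xi)%E by apply: integral_ge0 => u _; rewrite lee_fin.
pose G (p : V * R) : R := trunc alpha (polar_point p) * polar_point p ord0 j * jump_density p.
have GE p : G p = p.1 ord0 j * H p.
  rewrite /G HE {3}/polar_point mxE /jump_density patchE.
  case: ifPn => [/set_mem/polar_setE[s1 p2]|_]; last by rewrite !mulr0.
  by rewrite enormZ s1 mulr1 (gtr0_norm p2); ring.
have Gi : mu.-integrable setT (EFin \o G).
  apply: (truncated_jd (G := fun v => trunc alpha v * v ord0 j) ler01).
    by apply: measurable_funM; [exact: measurable_trunc|exact: measurable_coord].
  by move=> v; rewrite mul1r normrM ler_wpM2l// coord_le_enorm.
rewrite [RHS]/rint (sf_fubini1 (m1 := sigma) (m2 := leb) Gi) /rint; congr fine.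
have -> : (\int[sigma]_(xi in sphere) (((fine (\int[leb]_(u in `]0%R, +oo[)
    (trunc alpha (u *: xi) * q_drop q lambda t xi u * u `^ (- alpha))%:E) *: xi)%R ord0 j)%:E) =
    \int[sigma]_xi (fine (F xi) * xi ord0 j)%:E)%E.
  rewrite [LHS]integral_mkcond; apply: eq_integral => xi _.
  rewrite patchE; case: ifPn => [/set_mem sxi|xiS].
    rewrite mxE; congr (fine _ * _)%:E; rewrite [LHS]integral_mkcond; apply: eq_integral => u _.
    rewrite /H !patchE; case: ifPn => [/set_mem u0|u0].
      by rewrite mem_set.
    rewrite memNset// => -[_ /=] u0'; move: u0; rewrite mem_setE => /negP; exact.
  have -> : F xi = 0%E.
    rewrite /F integral0_eq// => u _; rewrite /H patchE memNset// => -[sxi _].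
    by move: xiS; rewrite mem_set.
  by rewrite mul0r.
apply: ae_eq_integral => //.
- apply/measurable_EFinP/measurable_funM; last exact: measurable_coord.
  by apply: measurableT_comp; [exact: fine_measurable|exact: measurable_int Fi].
- exact: measurable_int (sf_fubini_integrable1 (m1 := sigma) (m2 := leb) Gi).
apply: filterS (integrable_ae measurableT Fi) => xi /= /(_ I) Fxi _.
under eq_integral do rewrite GE EFinM.
rewrite integralZl//; first by rewrite EFinM fineK// muleC.
have mHxi : measurable_fun setT (fun u => H (xi, u)).
  by apply: (measurableT_comp mH); apply: measurable_fun_pair.
apply/integrableP; split; first exact/measurable_EFinP.
under eq_integral do rewrite /= ger0_norm//.
by move: Fxi; rewrite ge0_fin_numE.
Qed.

Lemma dot_psi (z : V) : dot z (psi alpha sigma q lambda t) =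
  eaT * rint mu setT (fun p => dot z (polar_point p) * trunc alpha (polar_point p) * jump_density p).
Proof.
rewrite /psi dotZr; congr (_ * _); rewrite /dot /vint.
pose G j p := z ord0 j *
  (trunc alpha (polar_point p) * polar_point p ord0 j * jump_density p).
have Gi0 j : mu.-integrable setT (EFin \o (fun p =>
    trunc alpha (polar_point p) * polar_point p ord0 j * jump_density p)).
  apply: (truncated_jd (G := fun v => trunc alpha v * v ord0 j) ler01).
    by apply: measurable_funM; [exact: measurable_trunc|exact: measurable_coord].
  by move=> v; rewrite mul1r normrM ler_wpM2l// coord_le_enorm.
have Gi j : mu.-integrable setT (EFin \o G j) by exact: integrable_mulr.
transitivity (\sum_j rint mu setT (G j)).
  by apply: eq_bigr => j _; rewrite mxE psi_coord rintZl.
rewrite -(rint_sum (index_enum _) Gi).2; apply: eq_rint => p.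
by rewrite -mulrA mulr_suml; apply: eq_bigr => j _; rewrite /G; ring.
Qed.

(** When the jump mass is finite the compensator in the Levy-Khintchine kernel can
    be integrated separately: it is the scalar product with [psi], and what
    remains is the exponent of a compound Poisson law. *)
Lemma jump_exponentE (z : V) : jump_exponent z + Complex 0 (dot z (psi alpha sigma q lambda t)) =
  real_complex R (fine K * eaT) * (charfun (jump_law alpha sigma q lambda t) z - 1).
Proof.
have K1 : rint mu setT jump_density = fine K by rewrite /rint KE.
have fKn : fine K != 0 by rewrite gt_eqF.
have ic : mu.-integrable setT (EFin \o (fun p => cos (dot z (polar_point p)) * jump_density p)).
  apply: (bounded_jd (G := fun v => cos (dot z v))); first exact: measurable_cos_dot.
  by move=> v; exact: (cis_bounds _).1.
have is_ : mu.-integrable setT (EFin \o (fun p => sin (dot z (polar_point p)) * jump_density p)).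
  apply: (bounded_jd (G := fun v => sin (dot z v))); first exact: measurable_sin_dot.
  by move=> v; exact: (cis_bounds _).2.
have it : mu.-integrable setT (EFin \o (fun p =>
    dot z (polar_point p) * trunc alpha (polar_point p) * jump_density p)).
  apply: (truncated_jd (G := fun v => dot z v * trunc alpha v) (norm1_ge0 z)).
    by apply: measurable_funM; [exact: measurable_dot|exact: measurable_trunc].
  move=> v; rewrite normrM mulrC mulrCA ler_wpM2l//; exact: dot_le.
rewrite charfun_jump_law dot_psi /jump_exponent.
set ci := rint mu setT (fun p => cos _ * _); set si := rint mu setT (fun p => sin _ * _).
set ti := rint mu setT (fun p => dot _ _ * _ * _).
have -> : rint mu setT (fun p => kernel_re z (polar_point p) * (eaT * jump_density p)) =
    eaT * (ci - fine K).
  rewrite -K1 /ci -(rintB ic jd_integrable) -rintZl; last first.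
    have := integrable_addr ic (integrable_mulr (-1) jd_integrable).
    by congr (mu.-integrable _ (EFin \o _)); apply/funext => p; rewrite mulN1r.
  by apply: eq_rint => p; rewrite /kernel_re; ring.
have -> : rint mu setT (fun p => kernel_im alpha z (polar_point p) * (eaT * jump_density p)) =
    eaT * (si - ti).
  rewrite /si /ti -(rintB is_ it) -rintZl; last first.
    have := integrable_addr is_ (integrable_mulr (-1) it).
    by congr (mu.-integrable _ (EFin \o _)); apply/funext => p; rewrite mulN1r.
  by apply: eq_rint => p; rewrite /kernel_im; ring.
apply: complex_eq.
  transitivity (eaT * (ci - fine K) + 0 : R); first by [].
  transitivity ((fine K * eaT) * ((fine K)^-1 * ci - 1) - 0 * ((fine K)^-1 * si - 0) : R); last by [].
  by field.
transitivity (eaT * (si - ti) + eaT * ti : R); first by [].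
transitivity ((fine K * eaT) * ((fine K)^-1 * si - 0) + 0 * ((fine K)^-1 * ci - 1) : R); last by [].
by field.
Qed.

End jump_part.

(** * The transition law of a tempered stable Ornstein-Uhlenbeck process *)

Theorem theorem2
  (R : realType) (d : nat) (hd : (0 < d)%N)
  (alpha lambda : R) (b : 'rV[R]_d)
  (halpha0 : 0 < alpha) (halpha2 : alpha < 2) (hlambda : 0 < lambda)
  (sigma : {finite_measure set 'rV[R]_d -> \bar R})
  (hsigma : sigma (~` sphere) = 0%E)
  (q : 'rV[R]_d -> R -> R)
  (hq_borel : measurable_fun (sphere `*` `]0, +oo[ : set ('rV[R]_d * R))
     (fun p : 'rV[R]_d * R => q p.1 p.2))
  (hq01 : forall xi u, sphere xi -> 0 < u -> 0 <= q xi u <= 1)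
  (hq_nonincr : forall xi u v, sphere xi -> 0 < u -> u <= v -> q xi v <= q xi u)
  (disp : measure_display) (Omega : measurableType disp)
  (P : probability Omega R)
  (Z Y : R -> {RV P >-> 'rV[R]_d})
  (hY : is_TSOU alpha sigma q b lambda Z Y)
  (Pt : R -> R.-pker 'rV[R]_d ~> 'rV[R]_d)
  (hPt : is_OU_transition lambda Z Pt)
  (t : R) (ht : 0 < t) (s : R) (hs : 0 <= s) (y : 'rV[R]_d) :
  let K := jump_mass alpha sigma q lambda t in
  let sigma0 := fun B => ((1 - expR (- (alpha * lambda * t)))%:E * sigma B)%E in
  let m := expR (- (lambda * t)) *: y + trans_drift alpha sigma q lambda t b in
  (K = 0%E ->
   forall (disp' : measure_display) (Omega' : measurableType disp')
     (P' : probability Omega' R) (X0 : {RV P' >-> 'rV[R]_d}),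
   is_TS alpha sigma0 q 0 (distribution P' X0) ->
   forall B : set 'rV[R]_d, measurable B ->
     law_given Pt s (s + t) y B = P' [set w | B (m + X0 w)])
  /\
  ((0 < K < +oo)%E ->
   forall (disp' : measure_display) (Omega' : measurableType disp')
     (P' : probability Omega' R)
     (N : {RV P' >-> nat}) (X : nat -> {RV P' >-> 'rV[R]_d}),
   independent_systems P' (fun i : option nat =>
     if i is Some j then g_sigma_algebra_preimage (X j)
     else g_sigma_algebra_preimage N) ->
   is_TS alpha sigma0 q 0 (distribution P' (X 0%N)) ->
   (forall j, (0 < j)%N -> forall B : set 'rV[R]_d, measurable B ->
      distribution P' (X j) B = jump_law alpha sigma q lambda t B) ->
   (forall k : nat, P' [set w | N w = k] =
      (poisson_pmf (fine K * expR (- (alpha * lambda * t))) k)%:E) ->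
   forall B : set 'rV[R]_d, measurable B ->
     law_given Pt s (s + t) y B =
     P' [set w | B (m + X 0%N w + \sum_(1 <= j < (N w).+1) X j w
                    - psi alpha sigma q lambda t)]).
Proof.
move=> K sigma0 m; have [hOU _] := hY.
pose I w := Y t w - expR (- (lambda * t)) *: Y 0 w.
have mI : measurable_fun setT I.
  apply: measurable_vecB; first exact: measurable_funPT.
  by apply: measurable_vecZ; [exact: measurable_cst|exact: measurable_funPT].
have mU : measurable_fun setT (fun w => expR (- (lambda * t)) *: y + I w).
  by apply: measurable_vecD; [exact: measurable_cst|].
have lawE B : measurable B -> law_given Pt s (s + t) y B =
    P [set w | B (expR (- (lambda * t)) *: y + I w)].
  by move=> mB; rewrite /law_given (addrC s) addrK; exact: (ou_transition_law y hOU hPt ht mB).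
have cfI z : cfun P (fun w => expR (- (lambda * t)) *: y + I w) z = cis (dot z m) *
    cexp (ts_exponent alpha lambda t sigma q z + jump_exponent alpha lambda t sigma q z).
  rewrite cfun_shift// (ou_increment_cfun halpha0 halpha2 hq_borel hq01 hq_nonincr hlambda ht z hY).
  rewrite mulrA -cisD -dotDr; congr (_ * cexp _).
  exact: trans_exponent_split.
split=> [K0 disp' Omega' P' X0 X0TS B mB|Kpos disp' Omega' P' N X indep X0TS XJ NP B mB].
  have mX0 : measurable_fun setT (fun w => m + X0 w).
    by apply: measurable_vecD; [exact: measurable_cst|exact: measurable_funPT].
  rewrite lawE//; apply: (eq_law_of_cfun mU mX0) => // z.
  rewrite cfI (cfun_shift P' m z (measurable_funPT X0)); congr (_ * _).
  rewrite (ts_cfun halpha0 hq_borel hq01 hlambda ht z X0TS).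
  by rewrite (jump_exponent0 hq_borel hq_nonincr hlambda ht z K0) addr0.
pose Psi := psi alpha sigma q lambda t.
have mS : measurable_fun setT (fun w => random_sum X (N w) w).
  by apply: measurable_random_index => k; exact: measurable_random_sum.
have mV : measurable_fun setT (fun w => (m - Psi) + random_sum X (N w) w).
  by apply: measurable_vecD; [exact: measurable_cst|].
(* The shift by [- psi] joins the deterministic part, leaving a random sum. *)
have -> : [set w | B (m + X 0%N w + \sum_(1 <= j < (N w).+1) X j w - Psi)] =
    [set w | B ((m - Psi) + random_sum X (N w) w)].
  have regroup (a b' c e : 'rV[R]_d) : a + b' + c - e = (a - e) + (b' + c).
    by rewrite [RHS]addrAC addrA.
  by apply/seteqP; split=> w /=; rewrite regroup.
rewrite lawE//; apply: (eq_law_of_cfun mU mV) => // z.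
have kappa0 : 0 < fine K * expR (- (alpha * lambda * t)).
  by rewrite mulr_gt0 ?expR_gt0// fine_gt0.
have phiE j : (0 < j)%N -> cfun P' (X j) z = charfun (jump_law alpha sigma q lambda t) z.
  move=> j0; apply/esym; apply: charfun_law; first exact: measurable_funPT.
  by move=> C mC; exact: (esym (XJ j j0 C mC)).
rewrite cfI (cfun_shift P' _ z mS) (compound_poisson_cfun indep kappa0 NP phiE).
rewrite (ts_cfun halpha0 hq_borel hq01 hlambda ht z X0TS).
rewrite -(jump_exponentE halpha0 halpha2 hq_borel hq01 hq_nonincr hlambda ht Kpos z).
rewrite !cis_cexp -!cexpD; congr cexp; rewrite (dotDr m (- Psi) z) dotNr.
have imB (u v : R) : Complex 0 (u - v) = Complex 0 u - Complex 0 v.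
  by apply: complex_eq; [transitivity (0 - 0 : R); [rewrite subrr|]|].
by rewrite imB; ring.
Qed.
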